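(* Let $g\ge 1$. The coloop subcomplex $\Lambda_g^{\mathrm{C}}$ of $LA^{\mathrm{trop},\mathrm{P}}_g$, the link of the origin in the moduli space of principally polarized tropical abelian varieties of dimension $g$ with respect to the perfect cone decomposition, is contractible.
   Context: Perfect cone decomposition. Identify quadratic forms on $\mathbb{R}^g$ with real symmetric $g\times g$ matrices. Let $\Omega_g^{\mathrm{rt}}$ be the cone of positive semidefinite forms whose kernel is defined over $\mathbb{Q}$. The group $\mathrm{GL}_g(\mathbb{Z})$ acts on it by $h\cdot Q=hQh^t$. For $Q$ positive definite let $M(Q)=\{v\in\mathbb{Z}^g\setminus\{0\}:Q(v)\le Q(v')\ \forall v'\in\mathbb{Z}^g\setminus\{0\}\}$ and $\sigma[Q]=\mathbb{R}_{\ge0}\langle vv^t\rangle_{v\in M(Q)}$. The set $\Sigma_g^{\mathrm{P}}$ of all cones $\sigma[Q]$ (together with the zero cone) is the perfect cone decomposition of $\Omega_g^{\mathrm{rt}}$. Moduli space and link. $A_g^{\mathrm{trop},\mathrm{P}}=\varinjlim\{\sigma\}_{\sigma\in\Sigma_g^{\mathrm{P}}}$, with arrows given by inclusions of faces composed with the action of $\mathrm{GL}_g(\mathbb{Z})$. For a cone $\sigma$ let $L\sigma=(\sigma\setminus\{0\})/\mathbb{R}_{>0}$ (action by scaling). The link of the origin is $LA_g^{\mathrm{trop},\mathrm{P}}=\varinjlim\{L\sigma\}_{\sigma\in\Sigma_g^{\mathrm{P}}}$ with the induced arrows. Matroidal cones. A matroid is simple if it has no circuits of size 1 or 2, and regular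 if it is representable over every field. A matrix is totally unimodular if every minor is $-1$, $0$ or $1$. For a simple regular matroid $M$ of rank $\le g$ choose a totally unimodular $g\times n$ real matrix $A$ with columns $v_1,\dots,v_n$ representing $M$ (so the circuits of $M$ are the minimal linearly dependent sets of columns), and put $\sigma_A(M)=\mathbb{R}_{\ge0}\langle v_1v_1^t,\dots,v_nv_n^t\rangle$. This is a cone in $\Sigma_g^{\mathrm{P}}$, it is simplicial of dimension $n$, and up to the action of $\mathrm{GL}_g(\mathbb{Z})$ it is independent of $A$. A matroidal cone is a cone in the $\mathrm{GL}_g(\mathbb{Z})$-orbit of some $\sigma_A(M)$. Its rank is the maximum rank of an element of it. A coloop of $M$ is an element of the ground set contained in no circuit; the coloops of a matroidal cone are those of the associated matroid. Coloop subcomplex. The coloop locus $A_g^{\mathrm{C}}\subset A_g^{\mathrm{trop},\mathrm{P}}$ is the union of (the images of) the matroidal cones $\sigma$ such that either $\sigma$ has rank less than $g$, or $\sigma$ has rank $g$ and has at least one coloop. The coloop subcomplex $\Lambda_g^{\mathrm{C}}$ is the link of the origin of $A_g^{\mathrm{C}}$, i.e. the union of the images of $L\sigma$ in $LA_g^{\mathrm{trop},\mathrm{P}}$ over the nonzero such cones $\sigma$. *)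

(* Defs.v *)
From HB Require Import structures.
From Stdlib Require Import Relation_Operators.
From mathcomp Require Import all_boot all_order all_algebra.
From mathcomp Require Import all_classical all_reals all_analysis.

Set Implicit Arguments.
Unset Strict Implicit.
Unset Printing Implicit Defensive.

Import Order.TTheory GRing.Theory Num.Theory.
Import numFieldNormedType.Exports.

Local Open Scope classical_set_scope.
Local Open Scope ring_scope.

(* Quotient of a topological space by the equivalence relation generated by
   [r], with the quotient topology. *)
Section GeneratedQuotient.
Variables (T : topologicalType) (r : T -> T -> Prop).

Definition gen_eq : rel T := fun x y => `[< clos_refl_sym_trans T r x y >].

Lemma gen_eq_refl : reflexive gen_eq.
Proof. by move=> x; apply/asboolP; exact: rst_refl. Qed.

Lemma gen_eq_sym : symmetric gen_eq.
Proof. by move=> x y; apply/asboolP/asboolP => h; exact: rst_sym. Qed.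

Lemma gen_eq_trans : transitive gen_eq.
Proof.
by move=> y x z /asboolP xy /asboolP yz; apply/asboolP; exact: rst_trans xy yz.
Qed.

Canonical gen_eq_equiv : equiv_rel T :=
  EquivRel gen_eq gen_eq_refl gen_eq_sym gen_eq_trans.

Definition gen_quotient : topologicalType :=
  quotient_topology {eq_quot gen_eq}%qT.

Definition gen_class (x : T) : gen_quotient :=
  (\pi_(quotient_topology {eq_quot gen_eq}) x)%qT.

End GeneratedQuotient.

Definition contractible (R : realType) (T : topologicalType) : Prop :=
  exists (x0 : T) (H : T * R -> T),
    [/\ {within [set: T] `*` `[0, 1], continuous H},
        forall x, H (x, 0) = x
      & forall x, H (x, 1) = x0].

Record matroid (E : finType) := Matroid {
  indep : {set E} -> bool;
  indep0 : indep finset.set0;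
  indepS : forall I J : {set E}, I \subset J -> indep J -> indep I;
  indep_aug : forall I J : {set E}, indep I -> indep J -> (#|I| < #|J|)%N ->
    exists2 e, e \in (J :\: I)%SET & indep (e |: I)%SET }.

Section Matroids.
Variables (E : finType) (M : matroid E).

Definition circuit (C : {set E}) : bool := minset (fun S => ~~ indep M S) C.

Definition simple_matroid : Prop :=
  forall C, circuit C -> #|C| != 1%N /\ #|C| != 2%N.

Definition coloop (e : E) : Prop := forall C, circuit C -> e \notin C.

Definition matroid_rank : nat := \max_(S : {set E} | indep M S) #|S|.

End Matroids.

(* The ground set labels the columns, so repeated columns are dependent. *)
Definition represents (F : fieldType) (d n : nat) (A : 'M[F]_(d, n))
    (M : matroid 'I_n) : Prop :=
  forall C : {set 'I_n}, circuit M C =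
    minset (fun S : {set 'I_n} => ~~ free [seq col j A | j in S]) C.

Definition regular (n : nat) (M : matroid 'I_n) : Prop :=
  forall F : fieldType, exists (d : nat) (A : 'M[F]_(d, n)), represents A M.

Definition totally_unimodular (R : pzRingType) (m n : nat) (A : 'M[R]_(m, n)) :
    Prop :=
  forall (k : nat) (f : 'I_k -> 'I_m) (h : 'I_k -> 'I_n),
    {homo f : i j / (i < j)%N} -> {homo h : i j / (i < j)%N} ->
    [\/ \det (mxsub f h A) = -1, \det (mxsub f h A) = 0
      | \det (mxsub f h A) = 1].

Section Cones.
Variable R : realType.

Definition nonneg_span (V : lmodType R) (S : set V) : set V :=
  [set X | exists (n : nat) (c : 'I_n -> R) (Y : 'I_n -> V),
    [/\ forall i, 0 <= c i, forall i, S (Y i) & X = \sum_(i < n) c i *: Y i]].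

Definition is_face (V : lmodType R) (F s : set V) : Prop :=
  exists l : {scalar V},
    (forall X, s X -> 0 <= l X) /\ F = [set X | s X /\ l X = 0].

Variable g : nat.

Definition real_of_int m n (A : 'M[int]_(m, n)) : 'M[R]_(m, n) :=
  map_mx intr A.

Definition act (h : 'M[int]_g) (Q : 'M[R]_g) : 'M[R]_g :=
  real_of_int h *m Q *m (real_of_int h)^T.

Definition qform (Q : 'M[R]_g) (v : 'cV[R]_g) : R := (v^T *m Q *m v) 0 0.

Definition posdef (Q : 'M[R]_g) : Prop :=
  Q^T = Q /\ forall v : 'cV[R]_g, v != 0 -> 0 < qform Q v.

Definition min_vectors (Q : 'M[R]_g) : set 'cV[int]_g :=
  [set v | v != 0 /\ forall w : 'cV[int]_g, w != 0 ->
    qform Q (real_of_int v) <= qform Q (real_of_int w)].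

Definition perfect_cone (Q : 'M[R]_g) : set 'M[R]_g :=
  nonneg_span [set real_of_int v *m (real_of_int v)^T | v in min_vectors Q].

Definition perfect_decomposition : set (set 'M[R]_g) :=
  [set s | s = [set 0] \/ exists2 Q, posdef Q & s = perfect_cone Q].

Definition same_ray (s : set 'M[R]_g) (x y : s `\` [set 0]) : Prop :=
  exists2 c : R, 0 < c & set_val y = c *: set_val x.

Definition cone_link (s : set 'M[R]_g) : topologicalType :=
  gen_quotient (@same_ray s).

Definition ray (s : set 'M[R]_g) (x : s `\` [set 0]) : cone_link s :=
  gen_class (@same_ray s) x.

Definition all_links : topologicalType :=
  {s : perfect_decomposition & cone_link (set_val s)}.

(* The graph of the arrow  L s -> L t  attached to [h] in GL_g(Z) such that
   h s h^t is a face of t. *)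
Inductive link_arrow : all_links -> all_links -> Prop :=
  LinkArrow (s t : perfect_decomposition) (h : 'M[int]_g)
      (x : set_val s `\` [set 0]) (y : set_val t `\` [set 0]) of
    h \in unitmx & is_face (act h @` set_val s) (set_val t)
    & set_val y = act h (set_val x) :
    link_arrow (existT _ s (ray x)) (existT _ t (ray y)).

Definition LAtrop : topologicalType := gen_quotient link_arrow.

Definition link_map (s : perfect_decomposition) (p : cone_link (set_val s)) :
  LAtrop := gen_class link_arrow (existT _ s p).

Definition matroid_cone n (A : 'M[R]_(g, n)) : set 'M[R]_g :=
  nonneg_span (range (fun j => col j A *m (col j A)^T)).

Definition matroidal_cone n (M : matroid 'I_n) (s : set 'M[R]_g) : Prop :=
  [/\ simple_matroid M, regular M, (matroid_rank M <= g)%N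
    & exists (A : 'M[R]_(g, n)) (h : 'M[int]_g),
        [/\ totally_unimodular A, represents A M, h \in unitmx
          & s = act h @` matroid_cone A]].

Definition cone_rank (s : set 'M[R]_g) : nat :=
  \max_(k < g.+1 | `[< exists2 X, s X & \rank X = k >]) k.

Definition coloop_cone (s : set 'M[R]_g) : Prop :=
  exists (n : nat) (M : matroid 'I_n), matroidal_cone M s /\
    ((cone_rank s < g)%N \/ cone_rank s = g /\ exists e, coloop M e).

Definition coloop_subcomplex : set LAtrop :=
  \bigcup_(s in [set s : perfect_decomposition |
                  coloop_cone (set_val s) /\ set_val s <> [set 0]])
    range (@link_map s).

End Cones.

Arguments coloop_subcomplex : clear implicits.

(* Main.v *)
(* A point of the coloop subcomplex is the class of a form [\sum_k a_k v_k v_k^T]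
   with [a_k >= 0], where the [v_k] are the columns of a unimodular integer
   matrix of rank [g] with a coloop: a matroid of rank less than [g] is completed
   by coloops of weight [0].  Let [N] be the largest weight, let [B] be a basis of
   columns of maximal weight, and for [e] in [B] let [tau_e] be the largest weight
   of another column whose expansion in [B] involves [e].  At time [u] replace
   each [a_k] by [((1 - u) a_k - u N)^+], and add [(u N - (1 - u) tau_e)^+] to the
   weight of each [e] in [B]: up to rescaling, all weights decrease at unit speed
   until an element of [B] becomes a coloop, which is then fed at unit speed.  A
   coloop of the system keeps the form nonzero, and at [u = 1] it is
   [N \sum_(e in B) v_e v_e^T], whose class does not depend on any choice.  At
   intermediate times the class does not depend on [B]: two bases of maximal
   weight are joined by exchanges of columns of equal weight, and each exchange
   is realized by an element of GL_g(Z) fixing all heavier columns.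

   The cones involved are perfect.  For a unimodular system of rank [g], rounding
   [p / 2] gives for every parity class [p] an integral functional [l_p] in that
   class with values in {-1, 0, 1} on the columns.  For a primitive integral
   vector [w] the sum of the [l_p(w)^2] is at least the number [2 ^ (g - 1)] of
   classes that are odd on [w], with equality when [w] is a column; after
   averaging over all choices of the [l_p] equality holds only for the columns.

   An identification in the colimit carries the smallest face containing a point
   to the smallest face containing its image, together with the classes of all
   points of that face.  Since a perfect cone has finitely many faces, the
   subspace topology of the coloop subcomplex is the final one for its cones, and
   joint continuity of the contraction follows from the tube lemma. *)

Require Import Defs.
From Stdlib Require Import Relation_Operators Eqdep.
From HB Require Import structures.
From mathcomp Require Import all_boot all_order all_algebra perm.
From mathcomp Require Import all_classical all_reals all_analysis.
From mathcomp Require Import ring lra zify.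

Set Implicit Arguments.
Unset Strict Implicit.
Unset Printing Implicit Defensive.

Import Order.TTheory GRing.Theory Num.Theory.
Import numFieldNormedType.Exports.

Local Open Scope classical_set_scope.
Local Open Scope ring_scope.

Local Notation full m := ([set: 'I_m]%SET).
Local Notation sgn_eq u v := (u = v \/ u = - v).

(** The obstacle is that the flow leaves the smallest face of its starting point, since it feeds
    basis columns whose weight may be 0, while an identification in the colimit controls that face
    only: the element of GL_g(Z) behind it matches the columns of nonzero weight of two systems and
    says nothing about the others. So it cannot simply be applied to the flow; it has to be modified
    off the columns of nonzero weight until it respects dominant bases. What makes this possible is
    that the weights in the flow depend only on the given weights and on which coordinates in a
    dominant basis are nonzero.

    Total unimodularity is not invariant under GL_g(Z). The cones are therefore studied through
    [unimod], which is, and total unimodularity occurs only where matroids are turned into systems.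
    Minimal forms serve twice: they make the cones perfect, and the comparison of the minimal forms
    of a system and of a spanning part of it yields faces and coordinates. *)

(** * Rounding with respect to a unimodular system *)

Lemma real_of_int_inj (R : realType) p q : injective (@real_of_int R p q).
Proof.
move=> M N /matrixP e; apply/matrixP => i j; have := e i j.
by rewrite !mxE => /intr_inj.
Qed.

Section Rounding.
Variables (R : realType) (g : nat).

Definition dot (y : 'rV[R]_g) (v : 'cV[int]_g) : R := (y *m real_of_int R v) 0 0.
Definition idot (y : 'rV[int]_g) (v : 'cV[int]_g) : int := (y *m v) 0 0.

Lemma dotDl y z v : dot (y + z) v = dot y v + dot z v.
Proof. by rewrite /dot mulmxDl mxE. Qed.
Lemma dotZl c y v : dot (c *: y) v = c * dot y v.
Proof. by rewrite /dot -scalemxAl mxE. Qed.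
Lemma dotNl y v : dot (- y) v = - dot y v.
Proof. by rewrite /dot mulNmx mxE. Qed.
Lemma dot0l v : dot 0 v = 0.
Proof. by rewrite /dot mul0mx mxE. Qed.
Lemma dotNr y v : dot y (- v) = - dot y v.
Proof. by rewrite /dot /real_of_int map_mxN mulmxN mxE. Qed.
Lemma dotDr y v w : dot y (v + w) = dot y v + dot y w.
Proof. by rewrite /dot /real_of_int map_mxD mulmxDr mxE. Qed.
Lemma dot_int y v : dot (real_of_int R y) v = (idot y v)%:~R.
Proof. by rewrite /dot /idot /real_of_int -map_mxM mxE. Qed.

Variable m : nat.
Implicit Types (A : 'M[int]_(g, m)) (S : {set 'I_m}).

Definition spans A S : Prop :=
  forall z : 'rV[R]_g, (forall k, k \in S -> dot z (col k A) = 0) -> z = 0.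

(** Dual form of a lattice statement: every spanning set of columns generates [Z^g], because the
    dual of the lattice it generates is integral. *)
Definition unimod A : Prop := forall S (y : 'rV[R]_g), spans A S ->
  (forall k, k \in S -> dot y (col k A) \is a Num.int) ->
  exists y' : 'rV[int]_g, y = real_of_int R y'.

(* Move [y] in a direction that does not decrease [w] and fixes the integral
   values [y . A_k], until another value becomes integral. *)
Lemma integral_rounding A (y : 'rV[R]_g) (w : 'cV[int]_g) :
  spans A [set: 'I_m]%SET -> unimod A ->
  exists X : 'rV[int]_g,
    [/\ forall k (n : int), n%:~R <= dot y (col k A) -> n <= idot X (col k A),
        forall k (n : int), dot y (col k A) <= n%:~R -> idot X (col k A) <= n
      & dot y w <= (idot X w)%:~R].
Proof.
move=> spA uA.
have [c] := ubnP #|[set k | dot y (col k A) \isn't a Num.int]%SET|.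
elim: c y => // c IH y; rewrite ltnS => le_c.
have : (exists z, [/\ z != 0,
    forall k, dot y (col k A) \is a Num.int -> dot z (col k A) = 0 & 0 <= dot z w])
  \/ spans A [set k | dot y (col k A) \is a Num.int]%SET.
  have [sp|/existsNP[z /not_implyP[zT z0]]] :=
    pselect (spans A [set k | dot y (col k A) \is a Num.int]%SET); first by right.
  left; have zT' k : dot y (col k A) \is a Num.int -> dot z (col k A) = 0.
    by move=> h; apply: zT; rewrite inE.
  have [zw|zw] := leP 0 (dot z w).
    by exists z; split=> //; apply/eqP.
  exists (- z); split.
  - by rewrite oppr_eq0; apply/eqP.
  - by move=> k /zT' zk; rewrite dotNl zk oppr0.
  - by rewrite dotNl oppr_ge0 ltW.
case=> [[z [z0 zT zw]]|sp].
- have [k1 zk1] : exists k, dot z (col k A) != 0.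
    apply: contrapT => /forallNP h; case/eqP: z0; apply: spA => k _.
    by apply/eqP/negPn/negP/h.
  pose fl k : R := (Num.floor (dot y (col k A)))%:~R.
  pose ce k : R := (Num.ceil (dot y (col k A)))%:~R.
  have flP k : fl k <= dot y (col k A) by rewrite /fl floor_le.
  have ceP k : dot y (col k A) <= ce k by rewrite /ce ceil_ge.
  (* [s k] is the time at which the value on column [k], moving along [z], reaches the next integer.
     Stopping at the first such time keeps every value between its floor and its ceiling. *)
  pose s k := ((if 0 < dot z (col k A) then ce k else fl k) - dot y (col k A))
     / dot z (col k A).
  have s_ge0 k : 0 <= s k.
    rewrite /s; case: ltrP => h; last by rewrite mulr_le0 // ?invr_le0 // subr_le0.
    by rewrite divr_ge0 ?subr_ge0 // ltW.
  pose k0 := [arg min_(k < k1 | dot z (col k A) != 0) s k]%O.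
  have [zk0 k0min] : dot z (col k0 A) != 0 /\
      forall k, dot z (col k A) != 0 -> s k0 <= s k.
    by rewrite /k0; case: arg_minP.
  pose y' := y + s k0 *: z.
  have y'E k : dot y' (col k A) = dot y (col k A) + s k0 * dot z (col k A).
    by rewrite dotDl dotZl.
  have y'P k : fl k <= dot y' (col k A) <= ce k.
    rewrite y'E; have [zk|zk|->] := ltrgtP (dot z (col k A)) 0.
    - apply/andP; split; last first.
        by rewrite -[leRHS]addr0 lerD // mulr_ge0_le0 // ltW.
      have := k0min k; rewrite lt_eqF // => /(_ isT).
      rewrite {2}/s ltNge (ltW zk) /= ler_ndivlMr // => h.
      by rewrite -lerBlDl.
    - apply/andP; split.
        by rewrite -[leLHS]addr0 lerD // mulr_ge0 // ltW.
      have := k0min k; rewrite gt_eqF // => /(_ isT).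
      by rewrite {2}/s zk ler_pdivlMr // => h; rewrite -lerBrDl.
    - by rewrite mulr0 addr0 flP ceP.
  have tight k : dot y (col k A) \is a Num.int -> dot y' (col k A) \is a Num.int.
    by move=> h; rewrite y'E zT // mulr0 addr0.
  have tk0 : dot y' (col k0 A) \is a Num.int.
    rewrite y'E /s divfK // addrC subrK; case: ifP => _; exact: intr_int.
  have nk0 : dot y (col k0 A) \isn't a Num.int.
    by apply: contra zk0 => h; rewrite zT.
  have [|X [X1 X2 X3]] := IH y'.
    apply: leq_trans le_c; apply: proper_card; apply/properP; split.
      by apply/fintype.subsetP => k; rewrite !inE; apply: contra => /tight.
    by exists k0; rewrite !inE // tk0.
  exists X; split.
  - move=> k n h; apply: X1; have /andP[h1 _] := y'P k; apply: le_trans h1.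
    by rewrite ler_int floor_ge_int.
  - move=> k n h; apply: X2; have /andP[_ h1] := y'P k; apply: le_trans h1 _.
    by rewrite ler_int ceil_le_int.
  - by apply: le_trans X3; rewrite dotDl dotZl lerDl mulr_ge0.
- have [|X yX] := uA _ y sp; first by move=> k; rewrite inE.
  by exists X; split => [k n|k n|]; rewrite yX dot_int ?ler_int.
Qed.

End Rounding.

Lemma absz_diff_le1 (a x z : int) :
  a <= x -> x <= a + 1 -> a <= z -> z <= a + 1 -> `|x - z| <= 1.
Proof. lia. Qed.

Section RoundingFunctionals.
Variables (R : realType) (g : nat).

Lemma small_step (T : eqType) (s : seq T) (a b : T -> R) :
  (forall j, 0 < a j) -> exists2 t : R, 0 < t & forall j, j \in s -> t * b j < a j.
Proof.
move=> a0; elim: s => [|i s [t t0 tP]]; first by exists 1.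
have d0 : 0 < `|b i| + 1 by rewrite ltr_wpDl.
exists (Num.min t (a i / (`|b i| + 1))) => [|j]; last rewrite inE => /predU1P[->|js].
- by rewrite lt_min t0 divr_gt0.
- have [b0|b0] := ltP 0 (b i); last first.
    apply: le_lt_trans (a0 i); rewrite mulr_ge0_le0 // le_min (ltW t0).
    by rewrite divr_ge0 // ltW.
  apply: (@le_lt_trans _ _ (a i / (`|b i| + 1) * b i)).
    by rewrite ler_pM2r // ge_min lexx orbT.
  rewrite mulrAC ltr_pdivrMr // ltr_pM2l //.
  by rewrite (le_lt_trans (ler_norm _)) // ltrDl.
- have [b0|b0] := ltP 0 (b j); last first.
    apply: le_lt_trans (a0 j); rewrite mulr_ge0_le0 // le_min (ltW t0).
    by rewrite divr_ge0 // ltW.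
  by apply: le_lt_trans (tP j js); rewrite ler_pM2r // ge_min lexx.
Qed.

Lemma parallel_of_annihilator (v w : 'cV[int]_g) : w != 0 ->
  (forall y : 'rV[R]_g, dot y w = 0 -> dot y v = 0) ->
  exists c : R, real_of_int R v = c *: real_of_int R w.
Proof.
move=> w0 h.
have [i wi] : exists i, w i 0 != 0.
  apply: contrapT => /forallNP h0; case/eqP: w0; apply/colP => i.
  by rewrite mxE; apply/eqP/negPn/negP/h0.
have wiR : (w i 0)%:~R != 0 :> R by rewrite intr_eq0.
exists ((v i 0)%:~R / (w i 0)%:~R); apply/colP => j; rewrite !mxE.
(* [y] kills [w], and its value on [v] is, up to sign, the minor of [v] and [w] on rows [i] and
   [j]. *)
pose y : 'rV[R]_g := (w i 0)%:~R *: delta_mx 0 j - (w j 0)%:~R *: delta_mx 0 i.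
have yE u : dot y u = (w i 0)%:~R * (u j 0)%:~R - (w j 0)%:~R * (u i 0)%:~R.
  rewrite /y dotDl dotNl !dotZl /dot -!rowE !mxE //.
have hv : (w i 0)%:~R * (v j 0)%:~R = (w j 0)%:~R * (v i 0)%:~R :> R.
  by apply/eqP; rewrite -subr_eq0 -yE h // yE mulrC subrr.
by apply: (mulfI wiR); rewrite hv mulrA mulrCA mulfV // mulr1 mulrC.
Qed.

Variables (m : nat) (A : 'M[int]_(g, m)).

Definition primitive_cols := forall k, exists y : 'rV[int]_g, idot y (col k A) = 1.
Definition distinct_cols :=
  forall k l, k != l -> col k A <> col l A /\ col k A <> - col l A.

Hypothesis spA : spans R A [set: 'I_m]%SET.
Hypothesis uA : unimod R A.
Hypothesis pA : primitive_cols.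

Definition narrow (l : 'rV[int]_g) := forall k, `|idot l (col k A)| <= 1.

Lemma idotBl (x y : 'rV[int]_g) v : idot (x - y) v = idot x v - idot y v.
Proof. by rewrite /idot mulmxBl !mxE. Qed.
Lemma idotDl (x y : 'rV[int]_g) v : idot (x + y) v = idot x v + idot y v.
Proof. by rewrite /idot mulmxDl !mxE. Qed.
Lemma idotZr (x : 'rV[int]_g) c v : idot x (c *: v) = c * idot x v.
Proof. by rewrite /idot -scalemxAr !mxE. Qed.

Definition bits (p : {ffun 'I_g -> bool}) : 'rV[int]_g := \row_i (p i : nat)%:Z.

(* If [X] rounds [p / 2] then [p - 2 X] has values in {-1, 0, 1} on the columns. *)
Lemma narrow_parity (p : {ffun 'I_g -> bool}) :
  exists2 l, narrow l & exists X, l = bits p - (X + X).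
Proof.
have [X [X1 X2 _]] := integral_rounding (2^-1 *: real_of_int R (bits p)) 0 spA uA.
exists (bits p - (X + X)); last by exists X.
move=> k; move: {X1 X2}(X1 k) (X2 k); rewrite dotZl dot_int idotBl idotDl.
set n := idot (bits p) _; set x := idot X _ => X1 X2.
pose q := (n %/ 2)%Z; pose r := (n %% 2)%Z.
have nE : n = q * 2 + r by rewrite /q /r -divz_eq.
have r0 : 0 <= r by rewrite /r modz_ge0.
have r2 : r < 2 by rewrite /r ltz_pmod.
have nER : n%:~R = q%:~R * 2 + r%:~R :> R by rewrite nE intrD intrM.
have rR0 : 0 <= r%:~R :> R by rewrite ler0z.
have h1 : q <= x by apply: X1; rewrite nER; lra.
have h2 : x <= q + r by apply: X2; rewrite intrD nER; lra.
by rewrite nE; lia.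
Qed.

Lemma odd_idot_parity (l : 'rV[int]_g) p v X : l = bits p - (X + X) ->
  odd `|idot l v| = odd `|idot (bits p) v|.
Proof. by move=> ->; rewrite idotBl idotDl; lia. Qed.

(** A primitive vector is nonzero modulo 2; this is why exactly half of the parity classes are odd
    on it ([sum_oddval]). *)
Lemma odd_entry (v : 'cV[int]_g) (y : 'rV[int]_g) : idot y v = 1 ->
  exists i, odd `|v i 0|.
Proof.
move=> h; apply: contrapT => /forallNP hv.
suff : odd `|idot y v| = false by rewrite h.
have hv' i : (2 %| v i 0%R)%Z by rewrite dvdzE dvdn2; apply/negP/hv.
have : (2 %| idot y v)%Z.
  by rewrite /idot mxE; apply: rpred_sum => i _; rewrite dvdz_mull.
by rewrite dvdzE dvdn2 => /negbTE.
Qed.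

Lemma idot_bits_single (i : 'I_g) (v : 'cV[int]_g) :
  idot (bits [ffun j => j == i]) v = v i 0.
Proof.
rewrite /idot mxE (bigD1 i) //= big1 => [|j /negbTE ji].
  by rewrite !mxE ffunE eqxx mul1r addr0.
by rewrite !mxE ffunE ji mul0r.
Qed.

(** The hyperplane orthogonal to [w] is not a finite union of proper subspaces: columns are treated
    one at a time, by perturbations too small to destroy the values already nonzero. *)
Lemma generic_functional (w : 'cV[int]_g) (s : seq 'I_m) :
  (forall k, exists2 y : 'rV[R]_g, dot y w = 0 & dot y (col k A) != 0) ->
  exists2 y : 'rV[R]_g, dot y w = 0 & forall k, k \in s -> dot y (col k A) != 0.
Proof.
move=> h; elim: s => [|k s [y yw ys]]; first by exists 0; rewrite ?dot0l.
have [yk|yk] := eqVneq (dot y (col k A)) 0; last first.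
  by exists y => // j; rewrite inE => /predU1P[->//|/ys].
have [y' y'w y'k] := h k.
(* The value 1 is a filler, since [small_step] asks for a positive bound at every column. *)
pose a j := if dot y (col j A) == 0 then 1 else `|dot y (col j A)|.
have [|t t0 ht] := @small_step _ s a (fun j => `|dot y' (col j A)|).
  by move=> j; rewrite /a; case: eqP => // /eqP; rewrite normr_gt0.
exists (y + t *: y'); first by rewrite dotDl dotZl yw y'w mulr0 addr0.
move=> j; rewrite inE => /predU1P[->|js]; rewrite dotDl dotZl.
  by rewrite yk add0r mulf_neq0 // gt_eqF.
have := ht j js; rewrite /a (negbTE (ys j js)) => hj.
apply/negP; rewrite addr_eq0 => /eqP e; move: hj.
by rewrite e normrN normrM gtr0_norm // ltxx.
Qed.

(* On the hyperplane [w^perp] choose [y] off the walls [A_k^perp] and round small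
   points on either side of it: the two results lie in the same cell of the
   arrangement, and [w] has opposite signs on them. *)
Lemma wide_functional_nonparallel (w : 'cV[int]_g) :
  w != 0 ->
  (forall k, exists2 y : 'rV[R]_g, dot y w = 0 & dot y (col k A) != 0) ->
  exists2 l, narrow l & 2 <= `|idot l w|.
Proof.
move=> w0 /(generic_functional (enum 'I_m)) [y yw ys].
have {}ys k : dot y (col k A) != 0.
  by apply: ys; rewrite mem_enum.
pose weights : 'rV[R]_g := (real_of_int R w)^T.
have ww : 0 < dot weights w.
  rewrite /dot mxE lt_def sumr_ge0 ?andbT; last by move=> i _; rewrite !mxE -expr2 sqr_ge0.
  apply: contra w0; rewrite psumr_eq0; last by move=> i _; rewrite !mxE -expr2 sqr_ge0.
  move=> /allP h; apply/eqP/colP => i; have := h i (mem_index_enum i).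
  by rewrite !mxE mulf_eq0 orbb intr_eq0 => /eqP.
(* [d] keeps [y + d weights] and [y - d weights] on the same side of every wall as [y]; [e] then
   brings their values on the columns into [-1, 1]. *)
have [|d d0 dP] := @small_step _ (enum 'I_m) (fun k => `|dot y (col k A)|)
  (fun k => `|dot weights (col k A)|); first by move=> k; rewrite normr_gt0.
have {}dP k : d * `|dot weights (col k A)| < `|dot y (col k A)|.
  by apply: dP; rewrite mem_enum.
have [|e e0 eP] := @small_step _ (enum 'I_m) (fun=> 1)
  (fun k => `|dot y (col k A)| + d * `|dot weights (col k A)|); first by [].
have {}eP k : e * (`|dot y (col k A)| + d * `|dot weights (col k A)|) < 1.
  by apply: eP; rewrite mem_enum.
have [X [X1 X2 X3]] := integral_rounding (e *: (y + d *: weights)) w spA uA.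
have [Y [Y1 Y2 Y3]] := integral_rounding (e *: (y - d *: weights)) (- w) spA uA.
(* On each column both roundings lie between the same two consecutive integers, whereas on [w] the
   first is at least 1 and the second at most -1. *)
exists (X - Y); last first.
  have hX : 0 < idot X w.
    rewrite -(@ltr0z R); apply: lt_le_trans X3.
    by rewrite dotZl dotDl dotZl yw add0r !mulr_gt0.
  have hY : 0 < - idot Y w.
    rewrite -(@ltr0z R) intrN; have: dot (e *: (y - d *: weights)) (-w) <= - (idot Y w)%:~R.
      by apply: le_trans Y3 _; rewrite /idot mulmxN mxE intrN.
    apply: lt_le_trans; rewrite dotNr dotZl dotDl dotNl dotZl yw add0r mulrN opprK.
    by rewrite !mulr_gt0.
  by rewrite idotBl; lia.
move=> k; have := dP k; have := eP k; have := ys k.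
have := X1 k; have := X2 k; have := Y1 k; have := Y2 k; rewrite idotBl.
rewrite !dotZl !dotDl dotNl !dotZl.
set u := dot y _; set v := dot weights _; set x := idot X _; set z := idot Y _.
move=> {}Y2 {}Y1 {}X2 {}X1 u0 {}eP {}dP.
have [v1 v2] : d * v <= d * `|v| /\ - (d * `|v|) <= d * v.
  by rewrite -mulrN !ler_pM2l // ler_norm lerNl -normrN ler_norm.
have [uneg|upos|/eqP] := ltrgtP u 0; last by rewrite (negbTE u0).
- rewrite (ltr0_norm uneg) in dP eP.
  have b1 : e * (u + d * v) <= 0 by rewrite mulr_ge0_le0 ?ltW //; lra.
  have b2 : e * (u - d * v) <= 0 by rewrite mulr_ge0_le0 ?ltW //; lra.
  have b3 : -1 <= e * (u + d * v).
    have : e * - (u + d * v) <= e * (- u + d * `|v|) by rewrite ler_pM2l //; lra.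
    by rewrite mulrN; lra.
  have b4 : -1 <= e * (u - d * v).
    have : e * - (u - d * v) <= e * (- u + d * `|v|) by rewrite ler_pM2l //; lra.
    by rewrite mulrN; lra.
  exact: (absz_diff_le1 (X1 (-1) b3) (X2 0 b1) (Y1 (-1) b4) (Y2 0 b2)).
- rewrite (gtr0_norm upos) in dP eP.
  have b1 : 0 <= e * (u + d * v) by rewrite mulr_ge0 ?ltW //; lra.
  have b2 : 0 <= e * (u - d * v) by rewrite mulr_ge0 ?ltW //; lra.
  have b3 : e * (u + d * v) <= 1.
    have : e * (u + d * v) <= e * (u + d * `|v|) by rewrite ler_pM2l //; lra.
    lra.
  have b4 : e * (u - d * v) <= 1.
    have : e * (u - d * v) <= e * (u + d * `|v|) by rewrite ler_pM2l //; lra.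
    lra.
  exact: (absz_diff_le1 (X1 0 b1) (X2 1 b3) (Y1 0 b2) (Y2 1 b4)).
Qed.

(** The hyperplane argument fails only if some column is parallel to [w]. Then [w] is an integral
    multiple of this primitive column by a factor other than 0, 1 and -1, and a narrow functional
    that is odd on the column is wide on [w]. *)
Lemma wide_functional (w : 'cV[int]_g) : w != 0 ->
  (forall k, w <> col k A /\ w <> - col k A) ->
  exists2 l, narrow l & 2 <= `|idot l w|.
Proof.
move=> w0 hw.
have [h|/existsNP[k /forall2NP h]] := pselect (forall k,
    exists2 y : 'rV[R]_g, dot y w = 0 & dot y (col k A) != 0).
  exact: wide_functional_nonparallel.
have [|c cE] := @parallel_of_annihilator (col k A) w w0.
  by move=> y yw; case: (h y) => // /negP; rewrite negbK => /eqP.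
have [y yk] := pA k.
have yE : 1 = c * (idot y w)%:~R.
  have : dot (real_of_int R y) (col k A) = 1 by rewrite dot_int yk.
  by rewrite /dot cE -scalemxAr mxE -/(dot _ _) dot_int => ->.
have wE : w = idot y w *: col k A.
  apply: (@real_of_int_inj R).
  rewrite /real_of_int map_mxZ -/(real_of_int R (col k A)) cE scalerA mulrC -yE scale1r //.
have [i ki] := odd_entry yk.
have [l lU [X lE]] := narrow_parity [ffun j => j == i].
have lk : odd `|idot l (col k A)|.
  by rewrite (odd_idot_parity _ lE) idot_bits_single.
exists l => //; rewrite wE idotZr normrM.
have [h0 h1 h2] : [/\ idot y w != 0, idot y w != 1 & idot y w != -1].
  split; apply/eqP => e; move: wE; rewrite e.
  - by rewrite scale0r => /eqP; rewrite (negbTE w0).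
  - by rewrite scale1r; case: (hw k).
  - by rewrite scaleN1r; case: (hw k).
have : 1 <= `|idot l (col k A)| by lia.
have : 2 <= `|idot y w| by lia.
move=> a b; rewrite -[2]mulr1; exact: ler_pM.
Qed.

End RoundingFunctionals.

Lemma even_half (x : int) : ~~ odd `|x| -> x = (x %/ 2)%Z + (x %/ 2)%Z.
Proof. lia. Qed.

Lemma absz_double (x : int) : x != 0 -> (absz x < absz (x + x)%R)%N.
Proof. lia. Qed.

(** * A form whose minimal vectors are the columns, up to sign *)

Section KeyForm.
Variables (R : realType) (g : nat).

Lemma qformD (P Q : 'M[R]_g) v : qform (P + Q) v = qform P v + qform Q v.
Proof. by rewrite /qform mulmxDr mulmxDl mxE. Qed.
Lemma qformZ c (Q : 'M[R]_g) v : qform (c *: Q) v = c * qform Q v.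
Proof. by rewrite /qform -scalemxAr -scalemxAl mxE. Qed.
Lemma qform0 v : qform (0 : 'M[R]_g) v = 0.
Proof. by rewrite /qform mulmx0 mul0mx mxE. Qed.
Lemma qform_sum (I : Type) (r : seq I) (P : pred I) (F : I -> 'M[R]_g) v :
  qform (\sum_(i <- r | P i) F i) v = \sum_(i <- r | P i) qform (F i) v.
Proof.
exact: (big_morph (fun Q => qform Q v) (fun P Q => qformD P Q v) (qform0 v)).
Qed.
Lemma qform_sqr (l : 'rV[R]_g) v : qform (l^T *m l) v = ((l *m v) 0 0) ^+ 2.
Proof.
rewrite /qform !mulmxA -mulmxA -trmx_mul mxE big_ord1 mxE expr2 //.
Qed.

Variables (m : nat) (A : 'M[int]_(g, m)).
Hypothesis spA : spans R A [set: 'I_m]%SET.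
Hypothesis uA : unimod R A.
Hypothesis pA : primitive_cols A.

(** Narrow functionals congruent to the unit vectors modulo 2 form a matrix that is the identity
    modulo 2, so its determinant is odd and hence nonzero. *)
Lemma narrow_spans (v : 'cV[R]_g) :
  (forall l, narrow A l -> (real_of_int R l *m v) 0 0 = 0) -> v = 0.
Proof.
move=> h.
have /choice[l lP] i : exists l, narrow A l /\
    exists X, l = bits [ffun j => j == i] - (X + X).
  by have [l ? ?] := narrow_parity spA uA [ffun j => j == i]; exists l.
pose L := \matrix_(i, j) l i 0 j.
have : map_mx intr L = 1%:M :> 'M['F_2]_g.
  apply/matrixP => i j; have [_ [X]] := lP i => /rowP/(_ j).
  rewrite !mxE ffunE => ->; rewrite intrB intrD -mulr2n -mulr_natr.
  have -> : 2%:R = 0 :> 'F_2 by apply/val_inj.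
  by rewrite mulr0 subr0 eq_sym; case: eqP.
move/(congr1 determinant); rewrite det_map_mx det1 => dL.
have dL0 : \det L != 0.
  by apply/eqP => e; move: dL; rewrite e => /eqP; rewrite eq_sym oner_eq0.
have uL : real_of_int R L \in unitmx.
  by rewrite unitmxE det_map_mx unitfE intr_eq0.
rewrite -[v](mulKmx uL); suff -> : real_of_int R L *m v = 0 by rewrite mulmx0.
apply/colP => i; rewrite [RHS]mxE -(h (l i)); last by case: (lP i).
by rewrite !mxE; apply: eq_bigr => j _; rewrite !mxE.
Qed.

(* A narrow functional is determined by its values on the columns, shifted here
   from {-1, 0, 1} to {0, 1, 2}. *)
Definition pattern (l : 'rV[int]_g) : {ffun 'I_m -> 'I_3} :=
  [ffun k => inord `|idot l (col k A) + 1|].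

Lemma pattern_inj l l' : narrow A l -> narrow A l' -> pattern l = pattern l' ->
  l = l'.
Proof.
move=> hl hl' /ffunP e.
have {}e k : idot l (col k A) = idot l' (col k A).
  have := e k; rewrite !ffunE => /(congr1 val) /=.
  have := hl k; have := hl' k => h1 h2.
  rewrite !inordK; lia.
apply: (@real_of_int_inj R).
apply/eqP; rewrite -subr_eq0; apply/eqP/spA => k _.
by rewrite dotDl dotNl !dot_int e subrr.
Qed.

(** An unrealized pattern receives an arbitrary narrow functional, so a functional may have several
    indices; [minimal_form] accordingly normalizes by the number of indices in a parity class. *)
Lemma narrow_finite : exists L : {ffun 'I_m -> 'I_3} -> 'rV[int]_g,
  (forall q, narrow A (L q)) /\ forall l, narrow A l -> exists q, L q = l.
Proof.
have /choice[L LP] q : exists l, narrow A l /\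
    ((exists2 l', narrow A l' & pattern l' = q) -> pattern l = q).
  have [[l ? ?]|h] := pselect (exists2 l', narrow A l' & pattern l' = q).
    by exists l.
  by exists 0; split => // k; rewrite /idot mul0mx mxE.
exists L; split => [q|l hl]; first by case: (LP q).
exists (pattern l); have [h1 h2] := LP (pattern l).
by apply: pattern_inj => //; apply: h2; exists l.
Qed.

Definition parity (l : 'rV[int]_g) : {ffun 'I_g -> bool} :=
  [ffun i => odd `|l 0 i|].

Lemma odd_absz_sum (I : finType) (F : I -> int) :
  odd `|\sum_i F i| = \big[addb/false]_i odd `|F i|.
Proof.
by apply: (big_morph (fun z : int => odd `|z|)) => // x y; lia.
Qed.

Lemma odd_idot l v :
  odd `|idot l v| = \big[addb/false]_i (parity l i && odd `|v i 0|).
Proof.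
rewrite /idot mxE odd_absz_sum; apply: eq_bigr => i _.
by rewrite ffunE abszM oddM.
Qed.

(** By [odd_idot], this is the parity on [v] of every functional in the class [p]. *)
Definition oddval (p : {ffun 'I_g -> bool}) (v : 'cV[int]_g) : bool :=
  \big[addb/false]_i (p i && odd `|v i 0|).

Lemma sum_oddval (v : 'cV[int]_g) i : odd `|v i 0| ->
  \sum_p (oddval p v)%:R = #|{: {ffun 'I_g -> bool}}|%:R / 2 :> R.
Proof.
move=> vi.
(* Toggling bit [i] exchanges the classes that are odd on [v] with those that are even, because
   [v i] is odd. *)
pose flip (p : {ffun 'I_g -> bool}) := [ffun j => p j (+) (j == i)].
have flipK : involutive flip.
  by move=> p; apply/ffunP => j; rewrite !ffunE -addbA addbb addbF.
have flipE p : oddval (flip p) v = ~~ oddval p v.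
  rewrite /oddval (bigD1 i) //= [in RHS](bigD1 i) //= !ffunE eqxx addbT vi !andbT.
  under eq_bigr => j ji do rewrite ffunE (negbTE ji) addbF.
  by rewrite addNb.
have h : \sum_p (oddval p v)%:R = \sum_p (1 - (oddval p v)%:R) :> R.
  rewrite [LHS](reindex_inj (inv_inj flipK)); apply: eq_bigr => p _.
  by rewrite flipE; case: oddval; rewrite ?subr0 ?subrr.
move: h; rewrite sumrB sumr_const => h.
by apply: (mulIf (_ : 2 != 0 :> R)); rewrite ?divfK //; lra.
Qed.

(* [kappa] is [2 ^ (g - 1)], and [lam] averages over the narrow functionals of
   each parity class. *)
Lemma minimal_form : exists (Q : 'M[R]_g) (kappa : R),
  [/\ posdef Q, forall k, qform Q (real_of_int R (col k A)) = kappa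
    & forall w : 'cV[int]_g, w != 0 ->
      (forall k, w <> col k A /\ w <> - col k A) ->
      kappa < qform Q (real_of_int R w)].
Proof.
have [L [L1 L2]] := narrow_finite.
pose N (p : {ffun 'I_g -> bool}) : R := \sum_(q | parity (L q) == p) 1.
have parL p : exists q, parity (L q) == p.
  have [l /L2[q lq] [X lE]] := narrow_parity spA uA p.
  exists q; apply/eqP/ffunP => i; rewrite ffunE lq lE !mxE; case: (p i); lia.
have N0 p : 0 < N p.
  have [q qp] := parL p; rewrite /N (bigD1 q) //= ltr_wpDr // sumr_ge0 //.
pose lam q := (N (parity (L q)))^-1.
have lam0 q : 0 < lam q by rewrite invr_gt0.
pose Q : 'M[R]_g := \sum_q lam q *: ((real_of_int R (L q))^T *m real_of_int R (L q)).
have QE v : qform Q v = \sum_q lam q * ((real_of_int R (L q) *m v) 0 0) ^+ 2.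
  by rewrite qform_sum; apply: eq_bigr => q _; rewrite qformZ qform_sqr.
have QEi v : qform Q (real_of_int R v) = \sum_q lam q * ((idot (L q) v) ^+ 2)%:~R.
  by rewrite QE; apply: eq_bigr => q _; rewrite -/(dot _ _) dot_int rmorphXn.
pose kappa : R := #|{: {ffun 'I_g -> bool}}|%:R / 2.
have kappa0 : 0 < kappa.
  by rewrite divr_gt0 // ltr0n; apply/card_gt0P; exists [ffun=> true].
(* The functionals of one class have total weight 1 in [lam], so the sum counts the classes that are
   odd on [v]. *)
have kE (v : 'cV[int]_g) i : odd `|v i 0| ->
    \sum_q lam q * (oddval (parity (L q)) v)%:R = kappa.
  move=> /sum_oddval; rewrite -/kappa => <-.
  rewrite (partition_big (fun q => parity (L q)) predT) //=.
  apply: eq_bigr => p _.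
  transitivity (\sum_(q | parity (L q) == p) (N p)^-1 * (oddval p v)%:R).
    by apply: eq_bigr => q /eqP qp; rewrite /lam qp.
  under eq_bigr => q _ do rewrite -[_ * _]mul1r.
  by rewrite -mulr_suml -/(N p) mulVKf // lt0r_neq0.
have le1 q (v : 'cV[int]_g) : (oddval (parity (L q)) v)%:R <= ((idot (L q) v) ^+ 2)%:~R :> R.
  rewrite -[(_ : bool)%:R]/((nat_of_bool _)%:Z%:~R) ler_int /oddval -odd_idot.
  by rewrite expr2; nia.
have Qodd (v : 'cV[int]_g) i : odd `|v i 0| -> kappa <= qform Q (real_of_int R v).
  move=> vi; rewrite -(kE v i vi) QEi; apply: ler_sum => q _.
  by rewrite ler_pM2l.
(* A vector with even entries is halved, which divides the form by 4; the induction is on the size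
   of one nonzero entry. *)
have Qle (v : 'cV[int]_g) : v != 0 -> kappa <= qform Q (real_of_int R v) /\
    ((forall i, ~~ odd `|v i 0|) -> kappa < qform Q (real_of_int R v)).
  move=> v0; have [i vi] : exists i, v i 0 != 0.
    apply: contrapT => /forallNP h0; case/eqP: v0; apply/colP => i.
    by rewrite mxE; apply/eqP/negPn/negP/h0.
  have [n] := ubnP (absz (v i 0)); elim: n v v0 vi => // n IH v v0 vi; rewrite ltnS => le_n.
  have [[j vj]|/forallNP ev] := pselect (exists j, odd `|v j 0|).
    by split => [|/(_ j)]; [exact: Qodd vj|rewrite vj].
  pose v' : 'cV[int]_g := \col_j (v j 0%R %/ 2)%Z.
  have vE : v = v' + v'.
    by apply/colP => j; rewrite !mxE; apply: even_half; apply/negP/ev.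
  have v'i : v' i 0 != 0 by apply: contra vi => /eqP h; rewrite vE mxE h.
  have v'0 : v' != 0 by apply: contra v'i => /eqP ->; rewrite mxE.
  have e : v i 0 = v' i 0 + v' i 0 by rewrite [in LHS]vE mxE.
  have [|h _] := IH v' v'0 v'i.
    by apply: leq_trans le_n; rewrite e; exact: absz_double.
  have -> : qform Q (real_of_int R v) = 4 * qform Q (real_of_int R v').
    rewrite !QEi mulr_sumr; apply: eq_bigr => q _; rewrite mulrCA; congr (_ * _).
    have e2 : idot (L q) v = 2 * idot (L q) v'.
      by rewrite [in LHS]vE /idot mulmxDr mxE mulr_natl mulr2n.
    by rewrite e2 exprMn intrM.
  by split=> [|_]; lra.
exists Q, kappa; split.
- split.
    rewrite /Q linear_sum; apply: eq_bigr => q _.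
    by rewrite linearZ /= trmx_mul trmxK.
  move=> v v0; rewrite lt_def QE sumr_ge0 ?andbT; last first.
    by move=> q _; rewrite mulr_ge0 ?sqr_ge0 // ltW.
  apply: contra v0; rewrite psumr_eq0; last first.
    by move=> q _; rewrite mulr_ge0 ?sqr_ge0 // ltW.
  move=> /allP h; apply/eqP/narrow_spans => l /L2[q <-].
  have := h q (mem_index_enum q).
  by rewrite mulf_eq0 gt_eqF //= expf_eq0 /= => /eqP.
- move=> k; have [y yk] := pA k; have [i ki] := odd_entry yk.
  rewrite QEi -(kE _ _ ki); apply: eq_bigr => q _; congr (_ * _).
  rewrite -[(_ : bool)%:R]/((nat_of_bool _)%:Z%:~R) /oddval -odd_idot.
  congr (_ %:~R); have := L1 q k; rewrite expr2 => h.
  have : [|| idot (L q) (col k A) == 0, idot (L q) (col k A) == 1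
    | idot (L q) (col k A) == -1] by lia.
  by case/or3P => /eqP ->.
- move=> w w0 hw.
  have [[i wi]|/forallNP ev] := pselect (exists i, odd `|w i 0|); last first.
    by case: (Qle w w0) => _; apply => i; apply/negP/ev.
  (* Strictness comes from one wide functional: its square is at least 4, while its parity
     contributes at most 1. *)
  have [l /L2[q <-] lw] := wide_functional spA uA pA w0 hw.
  rewrite -(kE w i wi) QEi (bigD1 q) //= [ltRHS](bigD1 q) //= ltr_leD //.
    rewrite ltr_pM2l // -[(_ : bool)%:R]/((nat_of_bool _)%:Z%:~R) ltr_int.
    by rewrite expr2; case: oddval; nia.
  by apply: ler_sum => q' _; rewrite ler_pM2l.
Qed.

End KeyForm.

(** * Unimodular systems and their cones *)

(** Collecting the terms with the same generator bounds the length of the combinations, so one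
    weight per index describes all points. *)
Lemma nonneg_span_finite (R : realType) (V : lmodType R) (I : finType)
    (P : pred I) (f : I -> V) :
  nonneg_span [set f k | k in [set k | P k]] =
  [set X | exists2 a : I -> R, (forall k, 0 <= a k) & X = \sum_(k | P k) a k *: f k].
Proof.
apply/seteqP; split=> X /=.
- move=> [n [c [Y [c0 fY ->]]]].
  have /choice[j jP] i : exists k, P k /\ f k = Y i.
    by have [k /= Pk fk] := fY i; exists k.
  exists (fun k => \sum_(i | j i == k) c i) => [k|]; first exact: sumr_ge0.
  rewrite (partition_big j P) => [|i _]; last by case: (jP i).
  apply: eq_bigr => k _; rewrite scaler_suml; apply: eq_bigr => i /eqP <-.
  by case: (jP i) => _ ->.
- move=> [a a0 ->].
  exists #|P|, (fun i => a (enum_val i)), (fun i => f (enum_val i)); split => //.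
    by move=> i; exists (enum_val i) => //; exact: (enum_valP i).
  by rewrite (big_enum_val (fun k => a k *: f k)).
Qed.

Section Systems.
Variables (R : realType) (g : nat).

Definition sq (v : 'cV[int]_g) : 'M[R]_g := real_of_int R v *m (real_of_int R v)^T.

Lemma sqN v : sq (- v) = sq v.
Proof. by rewrite /sq /real_of_int map_mxN mulNmx linearN mulmxN opprK. Qed.

Lemma qformN (Q : 'M[R]_g) v : qform Q (real_of_int R (- v)) = qform Q (real_of_int R v).
Proof.
by rewrite /qform /real_of_int map_mxN [(- _)^T]linearN /= !mulNmx mulmxN opprK.
Qed.

Lemma actD h (X Y : 'M[R]_g) : act h (X + Y) = act h X + act h Y.
Proof. by rewrite /act mulmxDr mulmxDl. Qed.
Lemma actZ h c (X : 'M[R]_g) : act h (c *: X) = c *: act h X.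
Proof. by rewrite /act -scalemxAr -scalemxAl. Qed.
Lemma act0 h : act h (0 : 'M[R]_g) = 0.
Proof. by rewrite /act mulmx0 mul0mx. Qed.
Lemma act_sum h (I : Type) (r : seq I) (P : pred I) (F : I -> 'M[R]_g) :
  act h (\sum_(i <- r | P i) F i) = \sum_(i <- r | P i) act h (F i).
Proof. exact: (big_morph (act h) (actD h) (act0 h)). Qed.
Lemma act_sq h v : act h (sq v) = sq (h *m v).
Proof. by rewrite /act /sq /real_of_int map_mxM trmx_mul !mulmxA. Qed.
Lemma actM h k (X : 'M[R]_g) : act h (act k X) = act (h *m k) X.
Proof. by rewrite /act /real_of_int map_mxM trmx_mul !mulmxA. Qed.
Lemma act1 (X : 'M[R]_g) : act 1%:M X = X.
Proof. by rewrite /act /real_of_int map_mx1 trmx1 mulmx1 mul1mx. Qed.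
Lemma actK h : h \in unitmx -> cancel (act h) (act (invmx h) : 'M[R]_g -> 'M[R]_g).
Proof. by move=> uh X; rewrite actM mulVmx // act1. Qed.

(** Trace pairing: on the square of [v] it takes the value of [Q] at [v] ([trform_sq]), so forms
    supply the functionals that cut out faces and coordinates. *)
Definition trform (Q : 'M[R]_g) : {scalar 'M[R]_g} := mxtrace \o mulmx Q.

Lemma trform_sq Q v : trform Q (sq v) = qform Q (real_of_int R v).
Proof.
rewrite /trform /= /sq mulmxA mxtrace_mulC mulmxA /qform.
by rewrite /mxtrace big_ord1.
Qed.

Lemma trform_wsum Q (I : finType) (P : pred I) (a : I -> R) v :
  trform Q (\sum_(k | P k) a k *: sq (v k)) =
  \sum_(k | P k) a k * qform Q (real_of_int R (v k)).
Proof. by rewrite linear_sum; apply: eq_bigr => k _; rewrite linearZ trform_sq. Qed.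

Section Cone.
Variables (m : nat) (A : 'M[int]_(g, m)).

Definition wform (a : 'I_m -> R) : 'M[R]_g := \sum_k a k *: sq (col k A).

Definition cone (S : {set 'I_m}) : set 'M[R]_g :=
  [set X | exists2 a : 'I_m -> R, (forall k, 0 <= a k) &
    X = \sum_(k in S) a k *: sq (col k A)].

Lemma coneE S : cone S = nonneg_span [set sq (col k A) | k in [set k | k \in S]].
Proof. by rewrite nonneg_span_finite. Qed.

Lemma coneP S X : cone S X <-> exists a : 'I_m -> R,
  [/\ forall k, 0 <= a k, forall k, k \notin S -> a k = 0 & X = wform a].
Proof.
split=> [[a a0 ->]|[a [a0 aS ->]]].
  exists (fun k => if k \in S then a k else 0); split => [k|k|].
  - by case: ifP.
  - by case: ifP.
  - rewrite /wform big_mkcond; apply: eq_bigr => k _.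
    by case: ifP; rewrite ?scale0r.
exists a => //; rewrite /wform [in RHS]big_mkcond; apply: eq_bigr => k _.
by case: ifPn => // /aS ->; rewrite scale0r.
Qed.

Lemma coneT X : cone [set: 'I_m]%SET X <->
  exists2 a : 'I_m -> R, (forall k, 0 <= a k) & X = wform a.
Proof.
split=> [/coneP[a [? _ ?]]|[a ? ?]]; first by exists a.
by apply/coneP; exists a; split => // k; rewrite inE.
Qed.

Lemma cone_face_of_form (S T : {set 'I_m}) (Q : 'M[R]_g) : S \subset T ->
  (forall k, k \in S -> qform Q (real_of_int R (col k A)) = 0) ->
  (forall k, k \in T -> k \notin S -> 0 < qform Q (real_of_int R (col k A))) ->
  is_face (cone S) (cone T).
Proof.
move=> sST QS QT.
have Q0 k : k \in T -> 0 <= qform Q (real_of_int R (col k A)).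
  by move=> kT; have [/QS->//|/(QT k kT)/ltW] := boolP (k \in S).
have trE a : trform Q (\sum_(k in T) a k *: sq (col k A)) =
    \sum_(k in T) a k * qform Q (real_of_int R (col k A)).
  exact: trform_wsum.
exists (trform Q); split=> [X [a a0 ->]|].
  by rewrite trE sumr_ge0 // => k kT; rewrite mulr_ge0 ?Q0.
apply/seteqP; split=> X.
- move=> [a a0 ->]; split.
    apply/coneP; exists (fun k => if k \in S then a k else 0); split=> [k|k|].
    + by case: ifP.
    + by move=> kT; case: ifP => // /(fintype.subsetP sST); rewrite (negbTE kT).
    + rewrite /wform big_mkcond; apply: eq_bigr => k _.
      by case: ifP; rewrite ?scale0r.
  by rewrite trform_wsum big1 // => k kS; rewrite QS // mulr0.
- move=> [[a a0 ->]]; rewrite trE => /eqP; rewrite psumr_eq0; last first.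
    by move=> k kT; rewrite mulr_ge0 ?Q0.
  move=> /allP h; exists a => //.
  rewrite (big_setID S) /= (finset.setIidPr sST) [X in _ + X]big1 ?addr0 // => k.
  rewrite inE => /andP[kS kT]; have := h k (mem_index_enum k); rewrite kT /=.
  by rewrite mulf_eq0 (gt_eqF (QT k kT kS)) orbF => /eqP ->; rewrite scale0r.
Qed.

(** These properties are preserved by GL_g(Z) ([system_act]), and the cones are studied through them
    alone. *)
Record unimodular_system : Prop := UnimodularSystem {
  sys_spans : spans R A [set: 'I_m]%SET;
  sys_unimod : unimod R A;
  sys_primitive : primitive_cols A;
  sys_distinct : distinct_cols A }.

End Cone.

Lemma spans_colsub m (A : 'M[int]_(g, m)) (S : {set 'I_m}) :
  spans R A S -> spans R (colsub (@enum_val _ (mem S)) A) [set: 'I_#|S|]%SET.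
Proof.
move=> sp z h; apply: sp => k kS.
have := h (enum_rank_in kS k) (finset.in_setT _).
by rewrite col_colsub enum_rankK_in.
Qed.

Lemma unimod_colsub m n (A : 'M[int]_(g, m)) (f : 'I_n -> 'I_m) :
  unimod R A -> unimod R (colsub f A).
Proof.
move=> uA S y sp yS; apply: (uA [set f k | k in S]%SET).
  move=> z h; apply: sp => k kS; rewrite col_colsub; apply: h; exact: imset_f.
by move=> _ /imsetP[k kS ->]; rewrite -col_colsub; exact: yS.
Qed.

Section SystemTheory.
Variables (m : nat) (A : 'M[int]_(g, m)).
Hypothesis sysA : unimodular_system A.

(** A spanning set of columns is a unimodular system in its own right and has its own minimal
    form. *)
Lemma minimal_form_sub (S : {set 'I_m}) : spans R A S ->
  exists (Q : 'M[R]_g) (kappa : R),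
  [/\ posdef Q, forall k, k \in S -> qform Q (real_of_int R (col k A)) = kappa
    & forall w : 'cV[int]_g, w != 0 ->
      (forall k, k \in S -> w <> col k A /\ w <> - col k A) ->
      kappa < qform Q (real_of_int R w)].
Proof.
move=> sp; have [|Q [kappa [pQ Qk Qlt]]] :=
  minimal_form (spans_colsub sp) (unimod_colsub (sys_unimod sysA)).
  by move=> k; rewrite col_colsub; exact: sys_primitive.
exists Q, kappa; split => //.
  by move=> k kS; have := Qk (enum_rank_in kS k); rewrite col_colsub enum_rankK_in.
move=> w w0 wS; apply: Qlt => // k; rewrite col_colsub; apply: wS.
exact: enum_valP.
Qed.

Lemma col_neq0 k : col k A != 0.
Proof.
have [y] := sys_primitive sysA k; apply: contra_eq_neq => ->.
by rewrite /idot mulmx0 mxE.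
Qed.

Lemma spans_nonempty (S : {set 'I_m}) : (0 < g)%N -> spans R A S -> exists k, k \in S.
Proof.
move=> g0 sp; have [S0|[k kS]] := set_0Vmem S; last by exists k.
have : (const_mx 1 : 'rV[R]_g) = 0 by apply: sp => k; rewrite S0 inE.
move=> /rowP/(_ (Ordinal g0))/eqP; by rewrite !mxE oner_eq0.
Qed.

(** The minimal vectors of the form attached to [S] are the columns in [S] and their negatives, and
    a vector and its negative have the same square. *)
Lemma cone_perfect (S : {set 'I_m}) : (0 < g)%N -> spans R A S ->
  perfect_decomposition (cone A S).
Proof.
move=> g0 sp; right; have [Q [kappa [pQ Qk Qlt]]] := minimal_form_sub sp.
exists Q => //; rewrite coneE /perfect_cone; congr nonneg_span.
have [k0 k0S] := spans_nonempty g0 sp.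
have minE v : min_vectors Q v <-> exists2 k, k \in S & v = col k A \/ v = - col k A.
  split=> [[v0 vmin]|[k kS vE]].
    apply: contrapT => h; have := vmin _ (col_neq0 k0); rewrite Qk // leNgt.
    rewrite Qlt // => k kS; split=> e; apply: h; exists k => //; by [left|right].
  have vk : qform Q (real_of_int R v) = kappa.
    rewrite -(Qk k kS); case: vE => -> //.
    exact: qformN.
  split; first by case: vE => ->; rewrite ?oppr_eq0 col_neq0.
  move=> w w0; rewrite vk; have [[j jS wE]|h] := pselect (exists2 k, k \in S &
      w = col k A \/ w = - col k A).
    suff -> : qform Q (real_of_int R w) = kappa by [].
    rewrite -(Qk j jS); case: wE => -> //.
    exact: qformN.
  apply/ltW/Qlt => // j jS; split=> e; apply: h; exists j => //; by [left|right].
apply/seteqP; split=> X [].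
  by move=> k /= kS <-; exists (col k A) => //; apply/minE; exists k => //; left.
by move=> v /minE[k kS [->|->]] <-; exists k => //; rewrite -/(sq _) sqN.
Qed.

Lemma cone_face (S T : {set 'I_m}) : S \subset T -> spans R A S ->
  is_face (cone A S) (cone A T).
Proof.
move=> sST spS.
have spT : spans R A T.
  by move=> z h; apply: spS => k kS; apply: h; exact: (fintype.subsetP sST).
have [Q [kQ [_ QS Qlt]]] := minimal_form_sub spS.
have [P [kP [[_ pP] PT _]]] := minimal_form_sub spT.
have qN (Q1 : 'M[R]_g) v : qform (- Q1) v = - qform Q1 v.
  by rewrite -scaleN1r qformZ mulN1r.
(* Rescaled to a common minimum, the minimal forms of [S] and [T] agree on [S], and on the rest of
   [T] the first exceeds the second. *)
apply: (@cone_face_of_form _ _ _ _ (kP *: Q - kQ *: P)) => // k kS.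
  rewrite qformD qN !qformZ QS // PT; last exact: (fintype.subsetP sST).
  by rewrite mulrC subrr.
move=> kS'; rewrite qformD qN !qformZ PT // mulrC -mulrBl mulr_gt0 //.
  rewrite subr_gt0; apply: Qlt; first exact: col_neq0.
  move=> j jS; apply: (sys_distinct sysA); apply: contraNneq kS' => -> //.
rewrite -(PT k kS); apply: pP.
by rewrite -(map_mx0 intr) (inj_eq (@real_of_int_inj R _ _)) col_neq0.
Qed.

End SystemTheory.
End Systems.

(** * Coordinates on the cone of a system, and maps between two such cones *)

Section Coordinates.
Variables (R : realType) (g : nat).

Lemma dot_mul (z : 'rV[R]_g) (h : 'M[int]_g) v :
  dot z (h *m v) = dot (z *m real_of_int R h) v.
Proof. by rewrite /dot /real_of_int map_mxM mulmxA. Qed.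

Lemma idot_mul (z : 'rV[int]_g) (h : 'M[int]_g) v : idot z (h *m v) = idot (z *m h) v.
Proof. by rewrite /idot mulmxA. Qed.

Lemma real_of_int_unit (h : 'M[int]_g) : h \in unitmx -> real_of_int R h \in unitmx.
Proof. by rewrite !unitmxE /real_of_int det_map_mx; apply: rmorph_unit. Qed.

Lemma primitive_neq0 (v : 'cV[int]_g) (y : 'rV[int]_g) : idot y v = 1 -> v != 0.
Proof. by apply: contra_eq_neq => ->; rewrite /idot mulmx0 mxE. Qed.

Section System.
Variables (m : nat) (A : 'M[int]_(g, m)).
Hypothesis sysA : unimodular_system R A.

(** If the other columns still span, the minimal form without column [k] and the one with it are
    rescaled and subtracted; otherwise the square of a functional killing the other columns works.
    In particular the squares of the columns are linearly independent. *)
Lemma coordinate_forms : exists Q : 'I_m -> 'M[R]_g,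
  forall k j, qform (Q k) (real_of_int R (col j A)) = (j == k)%:R.
Proof.
suff /choice[Q QP] k : exists Q : 'M[R]_g,
    forall j, qform Q (real_of_int R (col j A)) = (j == k)%:R by exists Q.
suff [Q Q0 Qk] : exists2 Q : 'M[R]_g,
    forall j, j != k -> qform Q (real_of_int R (col j A)) = 0
    & 0 < qform Q (real_of_int R (col k A)).
  exists ((qform Q (real_of_int R (col k A)))^-1 *: Q) => j; rewrite qformZ.
  have [->|jk] := eqVneq j k; first by rewrite mulVf // gt_eqF.
  by rewrite (Q0 j) // mulr0.
have [sp|/existsNP[z /not_implyP[zA z0]]] := pselect (spans R A [set~ k]%SET).
  have [Q [kQ [_ QS Qlt]]] := minimal_form_sub sysA sp.
  have [P [kP [[_ pP] PT _]]] := minimal_form_sub sysA (sys_spans sysA).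
  have qN (Q1 : 'M[R]_g) v : qform (- Q1) v = - qform Q1 v.
    by rewrite -scaleN1r qformZ mulN1r.
  exists (kP *: Q - kQ *: P) => [j jk|].
    rewrite qformD qN !qformZ QS ?finset.in_setC1 // PT ?finset.in_setT //.
    by rewrite mulrC subrr.
  rewrite qformD qN !qformZ PT ?finset.in_setT // mulrC -mulrBl mulr_gt0 //.
    rewrite subr_gt0; apply: Qlt; first exact: (col_neq0 sysA).
    move=> j; rewrite finset.in_setC1 => jk.
    by apply: (sys_distinct sysA); rewrite eq_sym.
  rewrite -(PT k (finset.in_setT _)); apply: pP.
  by rewrite -(map_mx0 intr) (inj_eq (@real_of_int_inj R _ _)) (col_neq0 sysA).
exists (z^T *m z) => [j jk|]; rewrite qform_sqr -/(dot _ _).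
  by rewrite zA ?expr0n // finset.in_setC1.
rewrite lt_def sqr_ge0 andbT sqrf_eq0; apply/eqP => zk; apply: z0.
apply: (sys_spans sysA) => j _; have [->//|jk] := eqVneq j k.
by apply: zA; rewrite finset.in_setC1.
Qed.

Definition coord : 'I_m -> 'M[R]_g := projT1 (cid coordinate_forms).

Lemma coord_wsum (b : 'I_m -> R) k : trform (coord k) (wform A b) = b k.
Proof.
rewrite trform_wsum (bigD1 k) //= big1 ?addr0 => [|j jk].
  by rewrite (projT2 (cid coordinate_forms)) eqxx mulr1.
by rewrite (projT2 (cid coordinate_forms)) (negbTE jk) mulr0.
Qed.

Lemma wform_inj (a b : 'I_m -> R) : wform A a = wform A b -> a = b.
Proof. by move=> e; apply/funext => k; rewrite -coord_wsum e coord_wsum. Qed.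

Lemma cone_memE S X : cone A S X <->
  [/\ X = wform A (fun k => trform (coord k) X),
      forall k, 0 <= trform (coord k) X
    & forall k, k \notin S -> trform (coord k) X = 0].
Proof.
split=> [/coneP[a [a0 aS ->]]|[XE X0 XS]].
  split=> [|k|k]; rewrite ?coord_wsum //; last exact: aS.
  by congr wform; apply/funext => k; rewrite coord_wsum.
by apply/coneP; exists (fun k => trform (coord k) X).
Qed.

End System.

(* For a closed polyhedral cone [s] this is the smallest face containing [x]. *)
Definition gen_face (s : set 'M[R]_g) (x : 'M[R]_g) : set 'M[R]_g :=
  [set z | s z /\ exists2 e : R, 0 < e & s (x - e *: z)].

Definition supp m (a : 'I_m -> R) : {set 'I_m} := [set k | a k != 0]%SET.

Lemma wformD m (A : 'M[int]_(g, m)) (a b : 'I_m -> R) :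
  wform A a + wform A b = wform A (fun k => a k + b k).
Proof. by rewrite -big_split; apply: eq_bigr => k _; rewrite scalerDl. Qed.
Lemma wformZ m (A : 'M[int]_(g, m)) c (a : 'I_m -> R) :
  c *: wform A a = wform A (fun k => c * a k).
Proof. by rewrite scaler_sumr; apply: eq_bigr => k _; rewrite scalerA. Qed.

(** The cone is simplicial, so the support of the weights determines the smallest face. *)
Lemma gen_face_cone m (A : 'M[int]_(g, m)) (a : 'I_m -> R) :
  unimodular_system R A -> (forall k, 0 <= a k) ->
  gen_face (cone A [set: 'I_m]%SET) (wform A a) = cone A (supp a).
Proof.
move=> sysA a0; apply/seteqP; split=> z.
  move=> [/coneT[b b0 ->] [e e0 /coneT[c c0 ce]]].
  apply/coneP; exists b; split=> // k; rewrite inE negbK => /eqP ak.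
  have : wform A a = wform A (fun k => e * b k + c k).
    by rewrite -wformD -ce -wformZ addrC subrK.
  move=> /(wform_inj sysA)/(congr1 (@^~ k)) /esym/eqP; rewrite ak.
  by rewrite paddr_eq0 ?mulr_ge0 ?(ltW e0) // mulf_eq0 gt_eqF //= => /andP[/eqP].
move=> /coneP[b [b0 bS ->]]; split; first by apply/coneT; exists b.
pose a' k := if a k == 0 then 1 else a k.
have [|t t0 ht] := @small_step R _ (enum 'I_m) a' b.
  by move=> k; rewrite /a'; case: eqP => // /eqP h; rewrite lt_def h a0.
exists t => //; apply/coneT; exists (fun k => a k - t * b k).
  move=> k; rewrite subr_ge0; have [ak|ak] := eqVneq (a k) 0.
    by rewrite bS ?inE ?ak ?eqxx // mulr0.
  by have := ht k; rewrite mem_enum /a' (negbTE ak) => /(_ isT)/ltW.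
rewrite -scaleNr wformZ wformD; congr wform; apply/funext => k.
by rewrite mulNr.
Qed.

(** The square of [v] spans an extreme ray. If [z] kills [v], pairing with the square of [z] shows
    that [z] kills every column of nonzero weight; such a column is parallel to [v], and primitivity
    of both turns the factor into a sign. *)
Lemma cone_ray_match n (B : 'M[int]_(g, n)) (S : {set 'I_n}) v (y : 'rV[int]_g) :
  unimodular_system R B -> idot y v = 1 -> cone B S (sq R v) ->
  exists2 j, j \in S & v = col j B \/ v = - col j B.
Proof.
move=> sysB yv [b b0 vE].
have [[j [jS bj]]|/forallNP h] := pselect (exists j, j \in S /\ b j != 0); last first.
  have : qform ((real_of_int R y)^T *m real_of_int R y) (real_of_int R v) = 1.
    by rewrite qform_sqr -/(dot _ _) dot_int yv expr1n.
  rewrite -trform_sq vE trform_wsum big1 => [/eqP|k kS].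
    by rewrite eq_sym oner_eq0.
  suff -> : b k = 0 by rewrite mul0r.
  by apply/eqP/negPn/negP => bk; apply: (h k).
have [|c cE] := @parallel_of_annihilator R g (col j B) v (primitive_neq0 yv).
  move=> z zv.
  have : trform (z^T *m z) (sq R v) = 0.
    by rewrite trform_sq qform_sqr -/(dot _ _) zv expr0n.
  rewrite vE trform_wsum => /eqP; rewrite psumr_eq0; last first.
    by move=> k _; rewrite mulr_ge0 // qform_sqr sqr_ge0.
  move=> /allP /(_ j (mem_index_enum j)); rewrite jS /= qform_sqr -/(dot _ _).
  by rewrite mulf_eq0 (negbTE bj) sqrf_eq0 => /eqP.
have [y' y'j] := sys_primitive sysB j.
have cz : c = (idot y (col j B))%:~R.
  have : dot (real_of_int R y) (col j B) = c.
    by rewrite /dot cE -scalemxAr mxE -/(dot _ _) dot_int yv mulr1.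
  by rewrite dot_int.
have jE : col j B = idot y (col j B) *: v.
  by apply: (@real_of_int_inj R); rewrite cE cz /real_of_int map_mxZ.
have : idot y (col j B) * idot y' v = 1 by rewrite -idotZr -jE.
move: jE; set t := idot y _ => jE /eqP tt.
exists j => //; have : (t == 1) || (t == -1).
  have : (absz t * absz (idot y' v) == 1)%N by rewrite -abszM (eqP tt).
  by rewrite muln_eq1 => /andP[]; lia.
case/orP => /eqP te; move: jE; rewrite te ?scale1r ?scaleN1r => ->; first by left.
by right; rewrite opprK.
Qed.

(** A bijection between the two faces permutes their rays, by [cone_ray_match] for [h] and for its
    inverse. Reading a coordinate of the image of the form then identifies the weights. *)
Lemma cone_match m n (A : 'M[int]_(g, m)) (B : 'M[int]_(g, n)) h
    (a : 'I_m -> R) (b : 'I_n -> R) :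
  unimodular_system R A -> unimodular_system R B -> h \in unitmx ->
  act h @` cone (R := R) A (supp a) = cone B (supp b) ->
  act h (wform A a) = wform B b ->
  (forall k, k \in supp a -> exists j, [/\ j \in supp b, b j = a k
     & h *m col k A = col j B \/ h *m col k A = - col j B]) /\
  (forall j, j \in supp b -> exists k, [/\ k \in supp a, b j = a k
     & h *m col k A = col j B \/ h *m col k A = - col j B]).
Proof.
move=> sysA sysB uh hAB hab.
have sq_mem l (C : 'M[int]_(g, l)) (S : {set 'I_l}) k :
    k \in S -> cone C S (sq R (col k C)).
  move=> kS; exists (fun j => (j == k)%:R) => [j|]; first by rewrite ler0n.
  rewrite (bigD1 k) //= eqxx scale1r big1 ?addr0 // => j /andP[_ /negbTE ->].
  by rewrite scale0r.
have mA k : k \in supp a -> exists2 j, j \in supp b &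
    h *m col k A = col j B \/ h *m col k A = - col j B.
  move=> kS; have [y yk] := sys_primitive sysA k.
  apply: (cone_ray_match (y := y *m invmx h)) => //.
    by rewrite idot_mul mulmxKV.
  by rewrite -act_sq -hAB; exists (sq R (col k A)) => //; exact: sq_mem.
have mB j : j \in supp b -> exists2 k, k \in supp a &
    invmx h *m col j B = col k A \/ invmx h *m col j B = - col k A.
  move=> jS; have [y yj] := sys_primitive sysB j.
  apply: (cone_ray_match (y := y *m h)) => //.
    by rewrite idot_mul mulmxK.
  have := sq_mem _ B _ _ jS; rewrite -hAB => -[X cX XE].
  by rewrite -act_sq -XE actK.
have weights k j : k \in supp a -> j \in supp b ->
    h *m col k A = col j B \/ h *m col k A = - col j B -> b j = a k.
  move=> kS jS kj.
  (* Off the support [j] is a default target, harmless because the weight there is 0. *)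
  have /choice[p pP] i : exists l, i \in supp a -> l \in supp b /\
      (h *m col i A = col l B \/ h *m col i A = - col l B).
    have [/mA[l ? ?]|_] := boolP (i \in supp a); first by exists l.
    by exists j.
  have p_inj i : i \in supp a -> p i = j -> i = k.
    move=> iS pij; apply: contrapT => /eqP/(sys_distinct sysA)[n1 n2].
    have [_] := pP i iS; rewrite pij => hi.
    have hinj (x y : 'cV[int]_g) : h *m x = h *m y -> x = y.
      by move=> /(congr1 (mulmx (invmx h))); rewrite !mulKmx.
    have hN (x : 'cV[int]_g) : h *m (- x) = - (h *m x) by rewrite mulmxN.
    case: hi kj => ei [] ek.
    - by apply: n1; apply: hinj; rewrite ei ek.
    - by apply: n2; apply: hinj; rewrite hN ei ek opprK.
    - by apply: n2; apply: hinj; rewrite hN ei ek.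
    - by apply: n1; apply: hinj; rewrite ei ek.
  have pk : p k = j.
    apply: contrapT => /eqP/(sys_distinct sysB)[n1 n2].
    have [_] := pP k kS; case: kj => -> [] e.
    - by apply: n1.
    - by apply: n2; rewrite e opprK.
    - by apply: n2; rewrite e.
    - by apply: n1; apply: oppr_inj.
  rewrite -(coord_wsum sysB b j) -hab act_sum.
  transitivity (trform (coord sysB j) (\sum_i a i *: sq R (col (p i) B))).
    congr (trform _ _); apply: eq_bigr => i _; rewrite actZ act_sq.
    have [iS|] := boolP (i \in supp a); last first.
      by rewrite inE negbK => /eqP ->; rewrite !scale0r.
    by have [_ [->|->]] := pP i iS; rewrite ?sqN.
  rewrite trform_wsum (bigD1 k) //= pk (projT2 (cid (coordinate_forms sysB))).
  rewrite eqxx mulr1 big1 ?addr0 // => i ik.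
  have [iS|] := boolP (i \in supp a); last first.
    by rewrite inE negbK => /eqP ->; rewrite mul0r.
  rewrite (projT2 (cid (coordinate_forms sysB))); have [/p_inj e|_] := eqVneq (p i) j.
    by move: ik; rewrite e // eqxx.
  by rewrite mulr0.
split=> [k kS|j jS].
  have [j jS kj] := mA k kS; exists j; split=> //; exact: weights.
have [k kS jk] := mB j jS; exists k.
have kj : h *m col k A = col j B \/ h *m col k A = - col j B.
  case: jk => /(congr1 (mulmx h)); rewrite mulKVmx // => ->; first by left.
  by right; rewrite mulmxN opprK.
by split=> //; exact: weights.
Qed.

End Coordinates.

(** * Points of the colimit and their transport *)

Lemma gen_classP (T : topologicalType) (r : T -> T -> Prop) (x y : T) :
  gen_class r x = gen_class r y <-> clos_refl_sym_trans T r x y.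
Proof.
split=> [|h]; first by move=> /eqmodP/asboolP.
by apply/eqmodP/asboolP.
Qed.

Lemma gen_class_surj (T : topologicalType) (r : T -> T -> Prop)
  (p : gen_quotient r) : exists x, p = gen_class r x.
Proof. by exists (repr p); rewrite /gen_class reprK. Qed.

Lemma gen_quotient_openP (T : topologicalType) (r : T -> T -> Prop)
  (U : set (gen_quotient r)) : open U <-> open (gen_class r @^-1` U).
Proof. by []. Qed.

Lemma set_type_openP (T : topologicalType) (A : set T) (U : set (set_type A)) :
  open U <-> exists2 B, open B & set_val @^-1` B = U.
Proof. by []. Qed.

Section Points.
Variables (R : realType) (g : nat).
Notation decomp := (@perfect_decomposition R g).

Definition valid (s : set 'M[R]_g) x := [/\ decomp s, s x & x <> 0].

Definition set_type_elt T (A : set T) x (Ax : A x) : set_type A := exist _ x (mem_set Ax).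

Definition links_point s x (v : valid s x) : all_links R g :=
  let: And3 Ds sx x0 := v in
  existT (fun s : decomp => cone_link (set_val s)) (set_type_elt Ds)
    (ray (set_type_elt (conj sx x0 : ((s `\` [set 0]) x)))).

Lemma links_point_surj (p : all_links R g) : exists s x (v : valid s x), p = links_point v.
Proof.
case: p => -[s Ds] q; have [[x xs] ->] := gen_class_surj q.
have Ds' := set_mem Ds; have [sx x0] := set_mem xs.
exists s, x, (And3 Ds' sx x0); rewrite /links_point /set_type_elt /ray /=.
by rewrite (bool_irrelevance (mem_set Ds') Ds) (bool_irrelevance (mem_set (conj _ _)) xs).
Qed.

Lemma same_ray_equiv (s : set 'M[R]_g) (x y : s `\` [set 0]) :
  clos_refl_sym_trans _ (@same_ray R g s) x y -> same_ray x y.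
Proof.
elim=> {x y} [x y //|x|x y _ [c c0 e]|x y z _ [c c0 e] _ [d d0 f]].
- by exists 1; rewrite ?scale1r.
- by exists c^-1; rewrite ?invr_gt0 // e scalerA mulVf ?scale1r // gt_eqF.
- by exists (d * c); rewrite ?mulr_gt0 // f e scalerA.
Qed.

Lemma links_point_inj s x (v : valid s x) t y (w : valid t y) : links_point v = links_point w ->
  s = t /\ exists2 c : R, 0 < c & y = c *: x.
Proof.
case: v => Ds sx x0; case: w => Dt ty y0 /= e.
have st : s = t by have := congr1 (fun p => set_val (projT1 p)) e.
split=> //; move: Dt ty e; rewrite -{t}st => Dt ty.
rewrite (Prop_irrelevance Dt Ds) => e; have {}e := inj_pair2 _ _ _ _ _ e.
by have [c c0 h] := same_ray_equiv (proj1 (gen_classP _ _ _) e); exists c.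
Qed.

Lemma links_point_scale s x (v : valid s x) c (w : valid s (c *: x)) : 0 < c ->
  links_point w = links_point v.
Proof.
case: v w => Ds sx x0 [Ds' sx' x0'] c0 /=; rewrite (Prop_irrelevance Ds' Ds).
congr existT; apply: (proj2 (gen_classP _ _ _)).
by apply/rst_sym/rst_step; exists c.
Qed.

Lemma links_point_arrow s x (v : valid s x) t h (w : valid t (act h x)) :
  h \in unitmx -> is_face (act h @` s) t -> link_arrow (links_point v) (links_point w).
Proof.
case: v w => Ds sx x0 [Dt tx y0] uh fc /=.
exact: (LinkArrow uh).
Qed.

Lemma link_arrowP p q : @link_arrow R g p q -> exists s x (v : valid s x) t h
  (w : valid t (act h x)), [/\ p = links_point v, q = links_point w, h \in unitmx
    & is_face (act h @` s) t].
Proof.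
case=> -[s Ds] [t Dt] h [x xs] [y ys] uh fc /= yE.
have Ds' := set_mem Ds; have [sx x0] := set_mem xs.
have Dt' := set_mem Dt; have [sy y0] := set_mem ys.
exists s, x, (And3 Ds' sx x0), t, h.
have {}yE : y = act h x := yE.
rewrite {}yE {y} in ys sy y0 *.
exists (And3 Dt' sy y0); split => //; rewrite /links_point /set_type_elt /ray /=.
  by rewrite (bool_irrelevance (mem_set Ds') Ds)
     (bool_irrelevance (mem_set (conj _ _)) xs).
by rewrite (bool_irrelevance (mem_set Dt') Dt)
     (bool_irrelevance (mem_set (conj _ _)) ys).
Qed.

Variable xi0 : LAtrop R g.
Implicit Types (s t u : set 'M[R]_g) (x y z : 'M[R]_g).

(* [xi0] is a junk value for pairs [s], [x] that are not valid. *)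
Definition link_point s x : LAtrop R g :=
  if pselect (valid s x) is left v then gen_class _ (links_point v) else xi0.

Lemma link_pointE s x (v : valid s x) : link_point s x = gen_class _ (links_point v).
Proof.
by rewrite /link_point; case: pselect => // v'; rewrite (Prop_irrelevance v' v).
Qed.

Lemma decomp_scale s x (c : R) : decomp s -> s x -> 0 <= c -> s (c *: x).
Proof.
move=> [->|[Q _ ->]] /=; first by move=> ->; rewrite scaler0.
move=> [n [d [Y [d0 YP ->]]]] c0; exists n, (fun i => c * d i), Y; split => //.
  by move=> i; rewrite mulr_ge0.
by rewrite scaler_sumr; apply: eq_bigr => i _; rewrite scalerA.
Qed.

Lemma valid_scale s x (c : R) : valid s x -> 0 < c -> valid s (c *: x).
Proof.
move=> [Ds sx x0] c0; split => //; first by apply: decomp_scale => //; apply: ltW.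
by move=> /eqP; rewrite scaler_eq0 gt_eqF //= => /eqP.
Qed.

Lemma link_point_scale s x (c : R) : valid s x -> 0 < c -> link_point s (c *: x) = link_point s x.
Proof.
by move=> v c0; rewrite (link_pointE v) (link_pointE (valid_scale v c0)) (links_point_scale v).
Qed.

Lemma act_neq0 h (x : 'M[R]_g) : h \in unitmx -> x <> 0 -> act h x <> 0.
Proof. by move=> uh x0 hx; apply: x0; rewrite -(actK uh x) hx act0. Qed.

Lemma valid_act s x t (h : 'M[int]_g) : valid s x -> decomp t -> h \in unitmx ->
  is_face (act h @` s) t -> valid t (act h x).
Proof.
move=> [Ds sx x0] Dt uh [l [_ e]]; split => //; last exact: act_neq0.
have : (act h @` s) (act h x) by exists x.
by rewrite e => -[].
Qed.

Lemma link_point_arrow s x t (h : 'M[int]_g) : valid s x -> decomp t -> h \in unitmx ->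
  is_face (act h @` s) t -> link_point s x = link_point t (act h x).
Proof.
move=> v Dt uh fc; rewrite (link_pointE v) (link_pointE (valid_act v Dt uh fc)).
by apply/gen_classP/rst_step/links_point_arrow.
Qed.

(** A face contains the summands of its elements: [l] is nonnegative on [y] and on [act h x - e y]
    and vanishes on [act h x], so it vanishes on [y]. Hence the smallest face does not change when a
    cone is embedded as a face. *)
Lemma gen_face_act s t (h : 'M[int]_g) x : h \in unitmx -> is_face (act h @` s) t -> s x ->
  act h @` gen_face s x = gen_face t (act h x).
Proof.
move=> uh [l [l0 fE]] sx.
have fs z : s z -> t (act h z) /\ l (act h z) = 0.
  by move=> sz; have : (act h @` s) (act h z) by [exists z]; rewrite fE.
apply/seteqP; split => y.
  move=> [z [sz [e e0 sxz]] <-]; split; first by case: (fs z sz).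
  by exists e => //; case: (fs _ sxz); rewrite actD -scaleNr actZ scaleNr.
move=> [ty [e e0 txy]].
have ly0 : l y = 0.
  have := l0 _ txy; rewrite linearB linearZ /= (fs x sx).2 sub0r oppr_ge0.
  by rewrite pmulr_rle0 // => h1; apply/eqP; rewrite eq_le h1 l0.
have [z sz zy] : (act h @` s) y by rewrite fE.
exists z => //; split => //; exists e => //.
have [w sw we] : (act h @` s) (act h x - e *: y).
  by rewrite fE; split => //; rewrite linearB linearZ /= ly0 (fs x sx).2 mulr0 subr0.
suff <- : w = x - e *: z by [].
by rewrite -(actK uh w) we actD -scaleNr actZ actK // -zy actK // scaleNr.
Qed.

(** The scalar [c] appears because classes see only rays. The last clause concerns the whole face
    and not [x] alone: [charts_final] uses it to move nearby points of the face into a chart. *)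
Definition transported s x t y := exists (h : 'M[int]_g) (c : R), [/\ h \in unitmx, 0 < c,
  c *: y = act h x, act h @` gen_face s x = gen_face t y
  & forall z, gen_face s x z -> z <> 0 -> link_point s z = link_point t (act h z)].

Lemma gen_face_scale s x (c : R) : decomp s -> 0 < c -> gen_face s (c *: x) = gen_face s x.
Proof.
move=> Ds; suff H y d : 0 < d -> gen_face s y `<=` gen_face s (d *: y).
  move=> c0; apply/seteqP; split; last exact: H.
  rewrite -{2}[x](scale1r) -(mulVf (lt0r_neq0 c0)) -scalerA; apply: H.
  by rewrite invr_gt0.
move=> d0 z [sz [e e0 h]]; split => //; exists (d * e); first exact: mulr_gt0.
by rewrite -scalerA -scalerBr; apply: decomp_scale => //; apply: ltW.
Qed.

Lemma transported_scale s x (c : R) : valid s x -> 0 < c ->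
  transported s x s (c *: x).
Proof.
move=> [Ds sx x0] c0; exists 1%:M, c^-1; split => //.
- exact: unitmx1.
- by rewrite invr_gt0.
- by rewrite act1 scalerA mulVf ?scale1r // gt_eqF.
- rewrite gen_face_scale //; apply/seteqP; split=> z; last by exists z; rewrite ?act1.
  by move=> [w ? <-]; rewrite act1.
- by move=> z _ _; rewrite act1.
Qed.

Lemma transported_sym s x t y : transported s x t y -> transported t y s x.
Proof.
move=> [h [c [uh c0 e f p]]]; exists (invmx h), c^-1; split => //.
- by rewrite unitmx_inv.
- by rewrite invr_gt0.
- rewrite -[act _ y](scale1r) -(mulVf (lt0r_neq0 c0)) -scalerA -actZ e actK //.
- rewrite -f; apply/seteqP; split=> z; last first.
    by move=> sz; exists (act h z); [exists z|rewrite actK].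
  by move=> [w [v ? <-] <-]; rewrite actK.
- move=> z; rewrite -f => -[w sw <-] hw; rewrite actK // p //.
  by move=> w0; apply: hw; rewrite w0 act0.
Qed.

Lemma transported_trans s x t y u z : transported s x t y ->
  transported t y u z -> transported s x u z.
Proof.
move=> [h [c [uh c0 e f p]]] [k [d [uk d0 e' f' p']]].
exists (k *m h), (c * d); split.
- by rewrite unitmx_mul uk.
- exact: mulr_gt0.
- by rewrite -scalerA e' -actZ e actM.
- rewrite -f' -f; apply/seteqP; split=> w.
    by move=> [v ? <-]; exists (act h v); [exists v|rewrite actM].
  by move=> [_ [v ? <-] <-]; exists v => //; rewrite actM.
- move=> w sw w0; rewrite p // p' ?actM //; last exact: act_neq0.
  by rewrite -f; exists w.
Qed.

Lemma transported_arrow s x t (h : 'M[int]_g) : valid s x -> decomp t -> h \in unitmx ->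
  is_face (act h @` s) t -> transported s x t (act h x).
Proof.
move=> [Ds sx x0] Dt uh fc; exists h, 1; split => //.
- by rewrite scale1r.
- exact: gen_face_act.
- move=> z [sz _] z0; exact: link_point_arrow.
Qed.

(** A zigzag of arrows may pass through arbitrary cones of the decomposition; since every arrow
    preserves smallest faces, it still composes to a single element of GL_g(Z). *)
Lemma link_point_transported s x t y : valid s x -> valid t y -> link_point s x = link_point t y ->
  transported s x t y.
Proof.
move=> v w; rewrite (link_pointE v) (link_pointE w) => /gen_classP.
suff H p q : clos_refl_sym_trans _ (@link_arrow R g) p q ->
    forall s x (v : valid s x) t y (w : valid t y),
    p = links_point v -> q = links_point w -> transported s x t y by move=> /H; apply.
elim=> {p q s x t y v w} [p q pq|p|p q _ IH|p q r _ IH1 _ IH2] s x v t y w pE qE.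
- have [s' [x' [v' [t' [h [w' [e1 e2 uh fc]]]]]]] := link_arrowP pq.
  have [ss [c c0 xx]] := links_point_inj (etrans (esym e1) pE).
  have [tt [d d0 yy]] := links_point_inj (etrans (esym e2) qE).
  subst s' t'; rewrite xx yy.
  apply: transported_trans (transported_sym (transported_scale v' c0)) _.
  apply: transported_trans (transported_scale w' d0).
  by apply: transported_arrow => //; have [] := w'.
- have [st [c c0 ->]] := links_point_inj (etrans (esym pE) qE); subst t.
  exact: transported_scale.
- by apply: transported_sym; apply: IH.
- have [u [z [v' e]]] := links_point_surj q.
  by apply: (transported_trans (IH1 _ _ v _ _ v' pE e)); apply: IH2.
Qed.

(** The two quotients and the disjoint union unfold to one condition per cone, with neighbourhoods
    taken in the space of all matrices. *)
Lemma LAtrop_openP (U : set (LAtrop R g)) : open U <->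
  forall s x, valid s x -> U (link_point s x) ->
    \forall y \near x, valid s y -> U (link_point s y).
Proof.
split=> [/gen_quotient_openP/sigT_openP oU s x v|h].
  have [Ds sx x0] := v.
  have /gen_quotient_openP/set_type_openP[B oB BE] := oU (set_type_elt Ds).
  have BP y (w : valid s y) : B y = U (link_point s y).
    rewrite (link_pointE w); case: w => Ds' sy y0 /=; rewrite (Prop_irrelevance Ds' Ds).
    by have := congr1 (@^~ (set_type_elt (conj sy y0 : ((s `\` [set 0]) y)))) BE.
  rewrite -BP // => Bx; have := open_nbhs_nbhs (conj oB Bx).
  by apply: filterS => y By w; rewrite -BP.
apply/gen_quotient_openP/sigT_openP => -[s Ds]; apply/gen_quotient_openP.
apply/set_type_openP => /=.
have Ds' := set_mem Ds.
(* The interior is an open set of matrices whose trace on the cone is the required preimage. *)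
exists [set x | \forall y \near x, valid s y -> U (link_point s y)]°; first exact: open_interior.
apply/seteqP; split=> -[x xs] /=.
  move=> /interior_subset/nbhs_singleton; have [sx x0] := set_mem xs.
  have v : valid s x by [].
  move=> /(_ v); rewrite (link_pointE v) /links_point; case: v => ? ? ? /=; rewrite /set_type_elt.
  by rewrite (bool_irrelevance (mem_set _) Ds) (bool_irrelevance (mem_set (conj _ _)) xs).
have [sx x0] := set_mem xs; have v : valid s x by [].
move=> Ux; apply: nbhs_interior; apply: h => //; move: Ux.
rewrite (link_pointE v) /links_point; case: v => ? ? ? /=; rewrite /set_type_elt.
by rewrite (bool_irrelevance (mem_set _) Ds) (bool_irrelevance (mem_set (conj _ _)) xs).
Qed.

End Points.

(** * Bases of a unimodular system *)

Section ConeClosure.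
Variables (R : realType) (g m : nat) (A : 'M[int]_(g, m)) (S : {set 'I_m}).

Lemma cone0 : cone (R := R) A S 0.
Proof. by exists (fun=> 0) => //; rewrite big1 // => k _; rewrite scale0r. Qed.
Lemma coneD (X Y : 'M[R]_g) : cone A S X -> cone A S Y -> cone A S (X + Y).
Proof.
move=> [a a0 ->] [b b0 ->]; exists (fun k => a k + b k).
  by move=> k; rewrite addr_ge0.
by rewrite -big_split; apply: eq_bigr => k _; rewrite scalerDl.
Qed.
Lemma coneZ c (X : 'M[R]_g) : 0 <= c -> cone A S X -> cone A S (c *: X).
Proof.
move=> c0 [a a0 ->]; exists (fun k => c * a k) => [k|]; first by rewrite mulr_ge0.
by rewrite scaler_sumr; apply: eq_bigr => k _; rewrite scalerA.
Qed.
Lemma cone_sum (I : Type) (r : seq I) (P : pred I) (F : I -> 'M[R]_g) :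
  (forall i, P i -> cone A S (F i)) -> cone A S (\sum_(i <- r | P i) F i).
Proof. by move=> h; apply: big_ind => //; [exact: cone0|exact: coneD]. Qed.
Lemma cone_sq k : k \in S -> cone A S (sq R (col k A)).
Proof.
move=> kS; exists (fun j => (j == k)%:R) => [j|]; first by rewrite ler0n.
rewrite (bigD1 k) //= eqxx scale1r big1 ?addr0 // => j /andP[_ /negbTE ->].
by rewrite scale0r.
Qed.
End ConeClosure.

Lemma dotZr (R : realType) g (y : 'rV[R]_g) c v : dot y (c *: v) = c%:~R * dot y v.
Proof. by rewrite /dot /real_of_int map_mxZ -scalemxAr mxE. Qed.
Lemma dot0r (R : realType) g (y : 'rV[R]_g) : dot y 0 = 0.
Proof. by rewrite /dot /real_of_int map_mx0 mulmx0 mxE. Qed.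
Lemma dot_col (R : realType) g n (y : 'rV[R]_g) (M : 'M[int]_(g, n)) j :
  dot y (col j M) = (y *m real_of_int R M) 0 j.
Proof. by rewrite /dot /real_of_int map_col colE mulmxA -colE mxE. Qed.

Section Transport.
Variables (R : realType) (g : nat) (xi0 : LAtrop R g).
Hypothesis g0 : (0 < g)%N.
Local Notation link_point := (@link_point R g xi0).

Lemma sq_sgn (u v : 'cV[int]_g) : sgn_eq u v -> sq R u = sq R v.
Proof. by case=> ->; rewrite ?sqN. Qed.

Lemma dot_sgn (z : 'rV[R]_g) u v : sgn_eq u v -> dot z u = 0 -> dot z v = 0.
Proof. by case=> -> //; rewrite dotNr => /eqP; rewrite oppr_eq0 => /eqP. Qed.

Lemma sgn_sym (u v : 'cV[int]_g) : sgn_eq u v -> sgn_eq v u.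
Proof. by case=> ->; [left|right; rewrite opprK]. Qed.

Lemma sgn_trans (u v w : 'cV[int]_g) : sgn_eq u v -> sgn_eq v w -> sgn_eq u w.
Proof. by case=> -> [] ->; rewrite ?opprK; [left|right|right|left]. Qed.

(** Since [S] spans, its cone belongs to the decomposition; it is a face of the cone of [A] and,
    moved by [G], of the cone of [B]. Thus [G] is constrained only on the columns in [S]. *)
Lemma link_point_cone_transport m n (A : 'M[int]_(g, m)) (B : 'M[int]_(g, n)) (S : {set 'I_m})
    (G : 'M[int]_g) x :
  unimodular_system R A -> unimodular_system R B -> spans R A S -> G \in unitmx ->
  (forall k, k \in S -> exists j, sgn_eq (G *m col k A) (col j B)) ->
  cone A S x -> x <> 0 ->
  link_point (cone A (full m)) x = link_point (cone B (full n)) (act G x).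
Proof.
move=> sysA sysB spS uG GS xS x0.
pose S' := [set j | `[< exists2 k, k \in S & sgn_eq (G *m col k A) (col j B) >]]%SET.
have SS' k j : k \in S -> sgn_eq (G *m col k A) (col j B) -> j \in S'.
  by move=> kS kj; rewrite inE; apply/asboolP; exists k.
have S'S j : j \in S' -> exists2 k, k \in S & sgn_eq (G *m col k A) (col j B).
  by rewrite inE => /asboolP.
have spS' : spans R B S'.
  move=> z zS'; suff : z *m real_of_int R G = 0.
    move=> /(congr1 (mulmx^~ (invmx (real_of_int R G)))).
    by rewrite mul0mx mulmxK // real_of_int_unit.
  apply: spS => k kS; rewrite -dot_mul; have [j kj] := GS k kS.
  by apply: dot_sgn (sgn_sym kj) _; apply: zS'; exact: SS' kj.
have GE : act G @` cone A S = cone (R := R) B S'.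
  apply/seteqP; split=> y.
    move=> [_ [a a_ge0 ->] <-]; rewrite act_sum; apply: cone_sum => k kS.
    rewrite actZ; apply: coneZ => //; rewrite act_sq.
    by have [j kj] := GS k kS; rewrite (sq_sgn kj); apply: cone_sq; exact: SS' kj.
  move=> [b b_ge0 ->].
  have /choice[f fP] j : exists X, j \in S' -> cone A S X /\ act G X = sq R (col j B).
    have [/S'S[k kS kj]|_] := boolP (j \in S'); last by exists 0.
    exists (sq R (col k A)) => _; rewrite act_sq (sq_sgn kj); split=> //.
    exact: cone_sq.
  exists (\sum_(j in S') b j *: f j).
    by apply: cone_sum => j /fP[? _]; apply: coneZ.
  by rewrite act_sum; apply: eq_bigr => j /fP[_ e]; rewrite actZ e.
have v : valid (cone A S) x by split=> //; exact: cone_perfect.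
have dT l (C : 'M[int]_(g, l)) : unimodular_system R C ->
    perfect_decomposition (cone (R := R) C (full l)).
  by move=> sysC; apply: cone_perfect => //; exact: sys_spans.
rewrite -(@link_point_arrow _ _ xi0 (cone A S) x _ G) ?GE //; [|exact: dT|]; last first.
  by apply: cone_face => //; exact: finset.subsetT.
rewrite (@link_point_arrow _ _ xi0 (cone A S) x (cone A (full m)) 1%:M) ?act1 //.
- exact: dT.
- exact: unitmx1.
- have -> : act 1%:M @` cone A S = cone (R := R) A S.
    apply/seteqP; split=> y; first by move=> [z ? <-]; rewrite act1.
    by exists y; rewrite ?act1.
  by apply: cone_face => //; exact: finset.subsetT.
Qed.

End Transport.

Section Bases.
Variables (R : realType) (g m : nat) (A : 'M[int]_(g, m)).
Hypothesis sysA : unimodular_system R A.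

Definition basis (beta : 'I_g -> 'I_m) : bool := colsub beta A \in unitmx.

Definition coords (beta : 'I_g -> 'I_m) : 'M[int]_(g, m) :=
  invmx (colsub beta A) *m A.

(** The rows of the real inverse take the values 0 and 1 on the columns of [M], which are columns of
    [A] up to sign, so [unimod] makes the inverse integral. *)
Lemma unit_of_spans (M : 'M[int]_g) :
  (forall z : 'rV[R]_g, (forall i, dot z (col i M) = 0) -> z = 0) ->
  (forall i, exists j, col i M = col j A \/ col i M = - col j A) ->
  M \in unitmx.
Proof.
move=> Msp MA.
have uM : real_of_int R M \in unitmx.
  rewrite -row_free_unit -kermx_eq0; apply/eqP/row_matrixP => i; rewrite row0.
  by apply: Msp => j; rewrite dot_col -row_mul mulmx_ker row0 mxE.
pose S := [set j | `[< exists i, col i M = col j A \/ col i M = - col j A >]]%SET.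
have spS : spans R A S.
  move=> z zS; apply: Msp => i; have [j ij] := MA i.
  have jS : j \in S by rewrite inE; apply/asboolP; exists i.
  by case: ij => ->; rewrite ?dotNr zS ?oppr0.
have /choice[N NP] i : exists y : 'rV[int]_g,
    row i (invmx (real_of_int R M)) = real_of_int R y.
  apply: (sys_unimod sysA spS) => j; rewrite inE => /asboolP[k kj].
  have h : dot (row i (invmx (real_of_int R M))) (col k M) = (i == k)%:R.
    by rewrite dot_col -row_mul mulVmx // !mxE.
  have hint : dot (row i (invmx (real_of_int R M))) (col k M) \is a Num.int.
    by rewrite h; case: (i == k).
  case: kj => kj; move: hint; rewrite kj // dotNr.
  by rewrite -[X in _ -> X \is a _]opprK => /rpredNr.
pose N' := \matrix_(i, j) N i 0 j.
suff : N' *m M = 1%:M by move/mulmx1_unit => [].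
apply: (@real_of_int_inj R); rewrite /real_of_int map_mxM map_mx1.
suff -> : map_mx intr N' = invmx (real_of_int R M) by rewrite mulVmx.
by apply/row_matrixP => i; rewrite NP; apply/rowP => j; rewrite !mxE.
Qed.

Lemma coordsP beta : basis beta -> colsub beta A *m coords beta = A.
Proof. by move=> ub; rewrite /coords mulKVmx. Qed.

Lemma col_expand beta k : basis beta ->
  col k A = \sum_i coords beta i k *: col (beta i) A.
Proof.
move=> ub; rewrite -[in LHS](coordsP ub); apply/colP => j; rewrite summxE !mxE.
by apply: eq_bigr => i _; rewrite !mxE mulrC.
Qed.

Lemma dot_expand beta (z : 'rV[R]_g) k : basis beta ->
  dot z (col k A) = \sum_i (coords beta i k)%:~R * dot z (col (beta i) A).
Proof.
move=> ub; rewrite (col_expand k ub) (big_morph _ (dotDr z) (dot0r z)).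
by apply: eq_bigr => i _; rewrite dotZr.
Qed.

Lemma coords_basis beta i j : basis beta -> coords beta i (beta j) = (i == j)%:R.
Proof.
move=> ub; have : invmx (colsub beta A) *m colsub beta A = 1%:M by rewrite mulVmx.
move/matrixP/(_ i j); rewrite [RHS]mxE => <-.
by rewrite !mxE; apply: eq_bigr => k _; rewrite !mxE.
Qed.

Lemma basis_inj beta : basis beta -> injective beta.
Proof.
move=> ub i j ij; have := coords_basis i j ub.
by rewrite -ij coords_basis // eqxx; case: eqP.
Qed.

Lemma coords_change beta gamma i k : basis beta ->
  coords gamma i k = \sum_j coords gamma i (beta j) * coords beta j k.
Proof.
move=> ub; rewrite {1}/coords -[X in _ *m X](coordsP ub) mulmxA mxE.
apply: eq_bigr => j _; congr (_ * _); rewrite !mxE.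
by apply: eq_bigr => l _; rewrite !mxE.
Qed.

Lemma basis_spans beta (z : 'rV[R]_g) : basis beta ->
  (forall i, dot z (col (beta i) A) = 0) -> z = 0.
Proof.
move=> ub h; apply: (sys_spans sysA) => k _; rewrite (dot_expand z k ub).
by rewrite big1 // => i _; rewrite h mulr0.
Qed.

Lemma basis_of_spans beta :
  (forall z : 'rV[R]_g, (forall i, dot z (col (beta i) A) = 0) -> z = 0) ->
  basis beta.
Proof.
move=> h; apply: unit_of_spans => [z hz|i].
  by apply: h => i; rewrite -col_colsub.
by exists (beta i); left; rewrite col_colsub.
Qed.

Lemma basis_exists : exists beta, basis beta.
Proof.
have fA : row_full (real_of_int R A)^T.
  rewrite /row_full mxrank_tr -/(row_free _) -kermx_eq0.
  apply/eqP/row_matrixP => i; rewrite row0; apply: (sys_spans sysA) => k _.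
  by rewrite dot_col -row_mul mulmx_ker row0 mxE.
exists (fullrankfun fA); apply: basis_of_spans => z hz.
have uF : rowsub (fullrankfun fA) (real_of_int R A)^T \in unitmx.
  by rewrite -row_full_unit; exact: fullrowsub_full.
have : z *m (rowsub (fullrankfun fA) (real_of_int R A)^T)^T = 0.
  apply/rowP => i; rewrite [RHS]mxE -(hz i) /dot !mxE.
  by apply: eq_bigr => j _; rewrite !mxE.
move=> /(congr1 (mulmx^~ (invmx (rowsub (fullrankfun fA) (real_of_int R A)^T)^T))).
by rewrite mul0mx mulmxK // unitmx_tr.
Qed.

Definition exchange (beta : 'I_g -> 'I_m) i k : 'I_g -> 'I_m :=
  fun j => if j == i then k else beta j.

Lemma basis_exchange beta i k : basis beta -> coords beta i k != 0 ->
  basis (exchange beta i k).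
Proof.
move=> ub ik; apply: basis_of_spans => z hz; apply: (basis_spans ub) => j.
have zb l : l != i -> dot z (col (beta l) A) = 0.
  by move=> li; have := hz l; rewrite /exchange (negbTE li).
have [->|/zb//] := eqVneq j i.
have := hz i; rewrite /exchange eqxx (dot_expand z k ub) (bigD1 i) //= big1.
  by move=> /eqP; rewrite addr0 mulf_eq0 intr_eq0 (negbTE ik) => /eqP.
by move=> l /zb ->; rewrite mulr0.
Qed.

(* The exchange characterization of a basis of maximal weight. *)
Definition dominant (beta : 'I_g -> 'I_m) (a : 'I_m -> R) : Prop :=
  forall i k, coords beta i k != 0 -> a k <= a (beta i).

(** Take a basis of maximal total weight: if the expansion of [k] involves [beta i], exchanging the
    two gives a basis, so [k] is not heavier. *)
Lemma dominant_basis_exists (a : 'I_m -> R) :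
  exists beta : {ffun 'I_g -> 'I_m}, basis beta /\ dominant beta a.
Proof.
have [b0 ub0] := basis_exists.
have ub1 : basis (finfun b0).
  suff -> : (finfun b0 : 'I_g -> 'I_m) = b0 by [].
  by apply/funext => i; rewrite ffunE.
pose F (b : {ffun 'I_g -> 'I_m}) := \sum_i a (b i).
pose b := [arg max_(b > finfun b0 | basis (b : {ffun 'I_g -> 'I_m})) F b]%O.
have [ub bmax] : basis b /\ forall c : {ffun 'I_g -> 'I_m}, basis c -> F c <= F b.
  by rewrite /b; case: arg_maxP.
exists b; split => // i k ik.
have uc : basis (finfun (exchange b i k)).
  suff -> : (finfun (exchange b i k) : 'I_g -> 'I_m) = exchange b i k.
    exact: basis_exchange.
  by apply/funext => j; rewrite ffunE.
have := bmax _ uc; rewrite /F (bigD1 i) //= [leRHS](bigD1 i) //= ffunE /exchange eqxx.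
rewrite (eq_bigr (fun j => a (b j))) ?lerD2r // => j /negbTE ji.
by rewrite ffunE ji.
Qed.

End Bases.

(** * The contraction on one cone *)

Lemma bigmax_ge0 (R : realType) (I : finType) (P : pred I) (F : I -> R) :
  0 <= \big[Num.max/0]_(i | P i) F i.
Proof. exact: bigmax_ge_id. Qed.

Section State.
Variables (R : realType) (g : nat).

Definition pos_part (r : R) : R := Num.max r 0.

Lemma pos_part_ge0 r : 0 <= pos_part r. Proof. by rewrite le_max lexx orbT. Qed.
Lemma pos_part_id r : 0 <= r -> pos_part r = r. Proof. by move=> h; rewrite /pos_part max_l. Qed.
Lemma pos_part_eq0 r : r <= 0 -> pos_part r = 0. Proof. by move=> h; rewrite /pos_part max_r. Qed.

Section Def.
Variables (m : nat) (A : 'M[int]_(g, m)).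

Definition max_weight (a : 'I_m -> R) : R := \big[Num.max/0]_k a k.

(* When [beta] is a basis of maximal weight, [e = beta i] is a coloop among the
   columns of weight greater than [t] as soon as [t >= bottleneck beta a i]. *)
Definition bottleneck (beta : 'I_g -> 'I_m) (a : 'I_m -> R) (i : 'I_g) : R :=
  \big[Num.max/0]_(k | (k != beta i) && (coords A beta i k != 0)) a k.

(** For [u < 1], dividing by [1 - u] gives the flow at threshold [u / (1 - u)] times the maximal
    weight; undivided, the formula stays continuous up to [u = 1]. *)
Definition flow (beta : 'I_g -> 'I_m) (a : 'I_m -> R) (u : R) : 'M[R]_g :=
  wform A (fun k => pos_part ((1 - u) * a k - u * max_weight a)) +
  \sum_i pos_part (u * max_weight a - (1 - u) * bottleneck beta a i) *: sq R (col (beta i) A).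

(** A coloop in dual form: the other columns lie in a hyperplane that misses [e]. *)
Definition coloop_witness (e : 'I_m) (z : 'rV[R]_g) :=
  dot z (col e A) != 0 /\ forall k, k != e -> dot z (col k A) = 0.

End Def.

Section One.
Variables (m : nat) (A : 'M[int]_(g, m)) (xi0 : LAtrop R g).
Hypothesis g0 : (0 < g)%N.
Hypothesis sysA : unimodular_system R A.
Variables (a : 'I_m -> R) (u : R).
Hypothesis a0 : forall k, 0 <= a k.
Hypothesis u01 : 0 <= u <= 1.
Local Notation link_point := (@link_point R g xi0).
Local Notation basis := (basis A).
Local Notation dominant := (dominant A).
Local Notation coords := (coords A).

Lemma bottleneck_ge0 beta i : 0 <= bottleneck A beta a i.
Proof. exact: bigmax_ge0. Qed.

Lemma le_bottleneck beta i k : k != beta i -> coords beta i k != 0 ->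
  a k <= bottleneck A beta a i.
Proof. by move=> h1 h2; apply: le_bigmax_cond; rewrite h1. Qed.

Lemma bottleneck_le beta i c : 0 <= c ->
  (forall k, k != beta i -> coords beta i k != 0 -> a k <= c) ->
  bottleneck A beta a i <= c.
Proof. by move=> c0 h; apply: bigmax_le => // k /andP[]; exact: h. Qed.

Lemma bottleneck_le_dominant beta i : dominant beta a ->
  bottleneck A beta a i <= a (beta i).
Proof. by move=> dom; apply: bottleneck_le => // k _; exact: dom. Qed.

Lemma sum_neq0 (J : finType) (P : pred J) (F : J -> int) :
  \sum_(j | P j) F j != 0 -> exists2 j, P j & F j != 0.
Proof.
move=> h; apply: contrapT => hn; move: h; rewrite big1 ?eqxx // => j Pj.
by apply/eqP/negPn/negP => Fj; apply: hn; exists j.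
Qed.

(** If [k] involves the common column in [beta] but not in [gamma], its coefficient is cancelled in
    the change of basis by some [beta l] that occurs in [k] and itself involves the column in
    [gamma]; dominance makes [beta l] at least as heavy as [k]. *)
Lemma bottleneck_le_basis beta gamma i j : basis beta -> basis gamma ->
  dominant beta a -> beta i = gamma j ->
  bottleneck A beta a i <= bottleneck A gamma a j.
Proof.
move=> ub ug dom e; apply: bottleneck_le => [|k kb ik]; first exact: bottleneck_ge0.
have [jk|] := eqVneq (coords gamma j k) 0; last first.
  by move=> jk; apply: le_bottleneck => //; rewrite -e.
have := coords_change gamma j k ub; rewrite jk (bigD1 i) //= e coords_basis //.
rewrite eqxx mul1r => /esym/eqP; rewrite addrC addr_eq0 => /eqP h.
have [|l li] := @sum_neq0 _ (fun l => l != i)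
    (fun l => coords gamma j (beta l) * coords beta l k).
  by rewrite h oppr_eq0.
rewrite mulf_eq0 negb_or => /andP[jl lk]; apply: le_trans (dom l k lk) _.
by apply: le_bottleneck => //; rewrite -e (inj_eq (basis_inj ub)).
Qed.

Lemma flow_cone beta : cone A (full m) (flow A beta a u).
Proof.
apply: coneD.
  apply/coneT; exists (fun k => pos_part ((1 - u) * a k - u * max_weight a)) => // k.
  exact: pos_part_ge0.
apply: cone_sum => i _; apply: coneZ; first exact: pos_part_ge0.
by apply: cone_sq; rewrite finset.in_setT.
Qed.

(** Expanding through [beta] the coordinate 1 of [gamma j] on itself gives an [i] such that
    [gamma j] involves [beta i] in [beta] and [beta i] involves [gamma j] in [gamma]. The two
    dominances force equal weights. *)
Lemma exchange_step beta gamma j : basis beta -> basis gamma ->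
  dominant beta a -> dominant gamma a -> (forall i, beta i != gamma j) ->
  exists i, [/\ coords beta i (gamma j) != 0, a (beta i) = a (gamma j),
    (forall l, gamma l != beta i) & dominant (exchange beta i (gamma j)) a].
Proof.
move=> ub ug db dg nj.
have := coords_basis j j ug; rewrite eqxx (coords_change gamma j (gamma j) ub) => h.
have [|i _] := @sum_neq0 _ predT (fun l => coords gamma j (beta l) * coords beta l (gamma j)).
  by rewrite h oner_eq0.
rewrite mulf_eq0 negb_or => /andP[ji ij].
have tie : a (beta i) = a (gamma j).
  by apply/eqP; rewrite eq_le (dg _ _ ji) (db _ _ ij).
exists i; split=> //.
  move=> l; apply/negP => /eqP lb; have lj : l = j.
    apply/eqP/negPn/negP => lj; case/eqP: ji; rewrite -lb coords_basis //.
    by rewrite eq_sym (negbTE lj).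
  by have := nj i; rewrite -lb lj eqxx.
have ue := basis_exchange sysA ub ij.
(* Old coordinates through the new ones. If [k] gains a nonzero coordinate at some [l] other than
   [i], then [k] involves [beta i], so it is no heavier than [gamma j], which is no heavier than
   [beta l]. *)
have chg l k : coords beta l k = (l != i)%:R * coords (exchange beta i (gamma j)) l k +
    coords beta l (gamma j) * coords (exchange beta i (gamma j)) i k.
  rewrite (coords_change beta l k ue) (bigD1 i) //= {1}/exchange eqxx addrC; congr (_ + _).
  rewrite (eq_bigr (fun j0 => (l == j0)%:R * coords (exchange beta i (gamma j)) j0 k)); last first.
    by move=> j0 /negbTE ni; rewrite {1}/exchange ni coords_basis.
  have [->|li] := eqVneq l i.
    rewrite mul0r big1 // => j0; rewrite eq_sym => /negbTE ->; exact: mul0r.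
  rewrite (bigD1 l) //= eqxx big1 ?addr0 // => j0 /andP[_].
  by rewrite eq_sym => /negbTE ->; rewrite mul0r.
move=> l k; rewrite {2}/exchange; have [->|li] := eqVneq l i => h1.
  rewrite -tie; apply: db; rewrite chg eqxx mul0r add0r.
  by rewrite mulf_neq0.
have [/eqP lk|/db//] := boolP (coords beta l k == 0).
have := chg l k; rewrite li mul1r lk => /esym/eqP; rewrite addr_eq0 => /eqP h2.
have : coords beta l (gamma j) * coords (exchange beta i (gamma j)) i k != 0.
  by rewrite -oppr_eq0 -h2.
rewrite mulf_eq0 negb_or => /andP[lj ik].
apply: le_trans (_ : a (gamma j) <= _); last exact: db.
rewrite -tie; apply: db; rewrite chg eqxx mul0r add0r.
by rewrite mulf_neq0.
Qed.

Lemma mul_basis_col n (B : 'M[int]_(g, n)) beta (gamma : 'I_g -> 'I_n) (e : 'I_g -> int) k :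
  basis beta ->
  (colsub gamma B *m diag_mx (\row_i e i) *m invmx (colsub beta A)) *m col k A =
  \sum_i (coords beta i k * e i) *: col (gamma i) B.
Proof.
move=> ub; rewrite -mulmxA.
have -> : invmx (colsub beta A) *m col k A = col k (coords beta).
  by rewrite /coords !colE mulmxA.
apply/colP => l; rewrite summxE mxE; apply: eq_bigr => i _; rewrite !mxE.
rewrite (bigD1 i) //= !mxE eqxx big1 ?addr0 => [|j /negbTE ji].
  by rewrite mulr1n; ring.
by rewrite !mxE ji mulr0n mulr0.
Qed.

Lemma mul_basis_self n (B : 'M[int]_(g, n)) beta (gamma : 'I_g -> 'I_n) (e : 'I_g -> int) i :
  basis beta ->
  (colsub gamma B *m diag_mx (\row_i e i) *m invmx (colsub beta A)) *m col (beta i) A =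
  e i *: col (gamma i) B.
Proof.
move=> ub; rewrite mul_basis_col // (bigD1 i) //= coords_basis // eqxx mul1r.
rewrite big1 ?addr0 // => j /negbTE ji; rewrite coords_basis // ji mul0r scale0r.
by [].
Qed.

(** The exchanged columns are tied and involve each other, so both have their common weight as
    bottleneck. While the threshold is at most this weight, neither is fed and the two flows
    coincide. Later, every column still above the threshold is heavier than [beta i], hence does not
    involve it, and is fixed by the change of basis [G], which carries one flow to the other. *)
Lemma flow_exchange beta gamma j i : basis beta -> basis gamma ->
  dominant beta a -> dominant gamma a -> (forall i, beta i != gamma j) ->
  coords beta i (gamma j) != 0 -> a (beta i) = a (gamma j) ->
  dominant (exchange beta i (gamma j)) a ->
  flow A beta a u <> 0 ->
  link_point (cone A (full m)) (flow A beta a u) =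
  link_point (cone A (full m)) (flow A (exchange beta i (gamma j)) a u).
Proof.
move=> ub ug db dg nj ij tie de st0; set f := gamma j in ij tie de *.
set b1 := exchange beta i f in de *.
have ub1 : basis b1 := basis_exchange sysA ub ij.
have bott l : l != i -> bottleneck A beta a l = bottleneck A b1 a l.
  move=> li; have e : beta l = b1 l by rewrite /b1 /exchange (negbTE li).
  by apply/eqP; rewrite eq_le; apply/andP; split; apply: bottleneck_le_basis.
have b1l l : l != i -> b1 l = beta l by move=> /negbTE h; rewrite /b1 /exchange h.
have b1i : b1 i = f by rewrite /b1 /exchange eqxx.
have botti : bottleneck A beta a i = a (beta i).
  apply/eqP; rewrite eq_le bottleneck_le_dominant //= tie le_bottleneck // eq_sym.
  exact: nj.
have botti1 : bottleneck A b1 a i = a (beta i).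
  apply/eqP; rewrite eq_le; apply/andP; split.
    by have := bottleneck_le_dominant i de; rewrite b1i tie.
  apply: le_bottleneck; first by rewrite b1i nj.
  have := coords_basis i i ub; rewrite eqxx (coords_change beta i (beta i) ub1) => h.
  have [|l _] := @sum_neq0 _ predT (fun l => coords beta i (b1 l) * coords b1 l (beta i)).
    by rewrite h oner_eq0.
  have [->|li] := eqVneq l i; first by rewrite mulf_eq0 negb_or => /andP[].
  by rewrite b1l // coords_basis // (eq_sym i) (negbTE li) mul0r eqxx.
have [small|big] := leP (u * max_weight a) ((1 - u) * a (beta i)).
  congr link_point; rewrite /flow; congr (_ + _); apply: eq_bigr => l _.
  have [->|li] := eqVneq l i; last by rewrite bott // b1l.
  by rewrite botti botti1 !pos_part_eq0 ?scale0r // subr_le0.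
pose one := fun _ : 'I_g => (1 : int).
pose G := colsub b1 A *m diag_mx (\row_i one i) *m invmx (colsub beta A).
have uG : G \in unitmx.
  rewrite !unitmx_mul unitmx_inv -andbA; apply/and3P; split=> //.
  have -> : diag_mx (\row_i one i) = 1%:M.
    by apply/matrixP => x y; rewrite !mxE.
  exact: unitmx1.
pose S := [set k | (u * max_weight a < (1 - u) * a k) || [exists l, k == beta l]]%SET.
have Gb l : G *m col (beta l) A = col (b1 l) A.
  by rewrite /G (mul_basis_self A b1 one) // scale1r.
have Gk k : u * max_weight a < (1 - u) * a k -> G *m col k A = col k A.
  move=> hk; rewrite /G (mul_basis_col A b1 one) // (col_expand k ub).
  apply: eq_bigr => l _; rewrite mulr1; have [->|li] := eqVneq l i; last first.
    by rewrite b1l.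
  have [->|ik] := eqVneq (coords beta i k) 0; first by rewrite !scale0r.
  have := lt_trans big hk; rewrite ltNge ler_wpM2l ?db //.
  by rewrite subr_ge0; case/andP: u01.
have SG k : k \in S -> exists j, sgn_eq (G *m col k A) (col j A).
  rewrite inE => /orP[/Gk ->|/existsP[l /eqP ->]]; first by exists k; left.
  by exists (b1 l); rewrite Gb; left.
have spS : spans R A S.
  move=> z zS; apply: (basis_spans sysA ub) => l; apply: zS; rewrite inE.
  by apply/orP; right; apply/existsP; exists l.
have posk k : ~~ (u * max_weight a < (1 - u) * a k) ->
    pos_part ((1 - u) * a k - u * max_weight a) = 0.
  by rewrite -leNgt => h; rewrite pos_part_eq0 // subr_le0.
have stS : cone A S (flow A beta a u).
  apply: coneD.
    apply/coneP; exists (fun k => pos_part ((1 - u) * a k - u * max_weight a)); split=> //.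
      by move=> k; exact: pos_part_ge0.
    by move=> k; rewrite inE negb_or => /andP[/posk].
  apply: cone_sum => l _; apply: coneZ; first exact: pos_part_ge0.
  apply: cone_sq; rewrite inE; apply/orP; right; apply/existsP; by exists l.
rewrite (link_point_cone_transport xi0 g0 sysA sysA spS uG SG stS st0); congr link_point.
rewrite /flow actD !act_sum; congr (_ + _).
  rewrite /wform; apply: eq_bigr => k _; rewrite actZ act_sq.
  by have [/Gk ->//|/posk ->] := boolP (u * max_weight a < (1 - u) * a k); rewrite !scale0r.
apply: eq_bigr => l _; rewrite actZ act_sq Gb.
have [->|li] := eqVneq l i; last by rewrite bott.
by rewrite botti botti1.
Qed.

(** Induction on the number of columns of [gamma] missing from [beta]; if none is missing, the two
    bases differ by a permutation. *)
Lemma flow_basis_indep beta gamma : basis beta -> basis gamma ->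
  dominant beta a -> dominant gamma a ->
  (forall beta, basis beta -> flow A beta a u <> 0) ->
  link_point (cone A (full m)) (flow A beta a u) = link_point (cone A (full m)) (flow A gamma a u).
Proof.
move=> ub ug db dg st0.
have [n] := ubnP #|[set j | [forall i, beta i != gamma j]]%SET|.
elim: n beta ub db => // n IH beta ub db; rewrite ltnS => le_n.
have [[j nj]|/forallNP h] := pselect (exists j, forall i, beta i != gamma j).
  have [i [ij tie gi de]] := exchange_step ub ug db dg nj.
  rewrite (flow_exchange ub ug db dg nj ij tie de (st0 _ ub)).
  have ue : basis (exchange beta i (gamma j)) := basis_exchange sysA ub ij.
  apply: IH => //; apply: leq_trans le_n; apply: proper_card; apply/properP; split.
    apply/fintype.subsetP => l; rewrite !inE => /forallP h; apply/forallP => k.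
    have [->|ki] := eqVneq k i; first by rewrite eq_sym gi.
    by have := h k; rewrite /exchange (negbTE ki).
  exists j; first by rewrite inE; apply/forallP.
  by rewrite inE; apply/negP => /forallP/(_ i); rewrite /exchange eqxx eqxx.
have /choice[s sP] j : exists i, gamma j = beta i.
  have /existsNP[i /negP] := h j; rewrite negbK => /eqP e; by exists i.
have s_inj : injective s.
  by move=> x y e; apply: (basis_inj ug); rewrite !sP e.
congr link_point; rewrite /flow; congr (_ + _).
rewrite (reindex_inj s_inj); apply: eq_bigr => j _; rewrite -sP.
suff -> : bottleneck A beta a (s j) = bottleneck A gamma a j by [].
by apply/eqP; rewrite eq_le; apply/andP; split; apply: bottleneck_le_basis.
Qed.

(** The coloop lies in every basis and has bottleneck 0, so for [u > 0] it is fed [u] times the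
    maximal weight, which the square of [z] detects. *)
Lemma flow_neq0 e z beta : coloop_witness A e z -> basis beta ->
  (exists k, a k != 0) -> flow A beta a u <> 0.
Proof.
move=> [ze zk] ub [k0 ak0]; have [u0|un0] := eqVneq u 0.
  rewrite /flow u0 subr0 mul0r => st.
  have : wform A a = wform A (fun=> 0).
    rewrite /wform [RHS]big1 => [|k _]; last by rewrite scale0r.
    rewrite -[RHS]st [X in _ = _ + X]big1 ?addr0 => [|i _].
      by apply: eq_bigr => k _; rewrite mul1r subr0 pos_part_id.
    by rewrite pos_part_eq0 ?scale0r // sub0r mul1r oppr_le0 bottleneck_ge0.
  by move=> /(wform_inj sysA)/(congr1 (@^~ k0))/eqP; rewrite (negbTE ak0).
have top0 : 0 < max_weight a.
  apply: (@lt_le_trans _ _ (a k0)); first by rewrite lt_def ak0 a0.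
  exact: le_bigmax_cond.
have [i ib] : exists i, beta i = e.
  apply: contrapT => /forallNP h; case/eqP: ze.
  suff -> : z = 0 by rewrite dot0l.
  by apply: (basis_spans sysA ub) => i; apply: zk; apply/eqP/h.
move=> /(congr1 (trform (z^T *m z))).
have q0 v : 0 <= qform (z^T *m z) (real_of_int R v).
  by rewrite qform_sqr sqr_ge0.
rewrite linear0 linearD /wform !trform_wsum => /eqP; rewrite paddr_eq0; last first.
- by apply: sumr_ge0 => j _; rewrite mulr_ge0 ?pos_part_ge0.
- by apply: sumr_ge0 => j _; rewrite mulr_ge0 ?pos_part_ge0.
move=> /andP[_]; rewrite psumr_eq0 => [|j _]; last by rewrite mulr_ge0 ?pos_part_ge0.
move=> /allP/(_ i (mem_index_enum i)) /=.
rewrite ib qform_sqr -/(dot _ _) mulf_eq0 sqrf_eq0 (negbTE ze) orbF.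
have -> : bottleneck A beta a i = 0.
  apply/eqP; rewrite eq_le bottleneck_ge0 andbT; apply: bottleneck_le => // k.
  rewrite ib => ke; have := zk k ke; rewrite (dot_expand z k ub) (bigD1 i) //= big1.
    by rewrite addr0 ib => /eqP; rewrite mulf_eq0 (negbTE ze) orbF intr_eq0 => ->.
  by move=> l li; rewrite zk ?mulr0 // -ib (inj_eq (basis_inj ub)).
rewrite mulr0 subr0 pos_part_id ?mulr_ge0 ?(ltW top0) //; last by case/andP: u01.
by rewrite mulf_eq0 (negbTE un0) gt_eqF.
Qed.

End One.
End State.

(* Some term of the Leibniz expansion is nonzero. *)
Lemma unitmx_perm (K : idomainType) n (X : 'M[K]_n) : \det X != 0 ->
  exists s : 'S_n, forall i, X (s i) i != 0.
Proof.
move=> dX; apply: contrapT => /forallNP h; case/eqP: dX.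
rewrite -det_tr /determinant big1 // => s _.
have /existsNP[i /negP] := h s; rewrite negbK => /eqP e.
by rewrite (bigD1 i) //= mxE e mul0r mulr0.
Qed.

Lemma oppr_mxE (K : zmodType) m n (M : 'M[K]_(m, n)) i j : (- M) i j = - M i j.
Proof. by rewrite mxE. Qed.

(** * Invariance of the flow under a matching of the columns of nonzero weight *)

Section Iso.
Variables (R : realType) (g : nat) (xi0 : LAtrop R g).
Hypothesis g0 : (0 < g)%N.
Local Notation link_point := (@link_point R g xi0).

Section Matching.
Variables (m n : nat) (A : 'M[int]_(g, m)) (B : 'M[int]_(g, n)) (h : 'M[int]_g).
Variables (a : 'I_m -> R) (b : 'I_n -> R).
Hypothesis sysA : unimodular_system R A.
Hypothesis sysB : unimodular_system R B.
Hypothesis uh : h \in unitmx.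
Hypothesis a0 : forall k, 0 <= a k.
Hypothesis b0 : forall k, 0 <= b k.
Hypothesis AB : forall k, k \in supp a -> exists j,
  [/\ j \in supp b, b j = a k & sgn_eq (h *m col k A) (col j B)].
Hypothesis BA : forall j, j \in supp b -> exists k,
  [/\ k \in supp a, b j = a k & sgn_eq (h *m col k A) (col j B)].

Lemma match_uniq_l k k' (v : 'cV[int]_g) : sgn_eq (h *m col k A) v ->
  sgn_eq (h *m col k' A) v -> k = k'.
Proof.
move=> e e'; apply: contrapT => /eqP/(sys_distinct sysA)[n1 n2].
have [f|f] := sgn_trans e (sgn_sym e').
  by apply: n1; rewrite -[LHS](mulKmx uh) f mulKmx.
by apply: n2; rewrite -[LHS](mulKmx uh) f mulmxN mulKmx.
Qed.

Lemma match_uniq_r j j' (v : 'cV[int]_g) : sgn_eq v (col j B) ->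
  sgn_eq v (col j' B) -> j = j'.
Proof.
move=> e e'; apply: contrapT => /eqP/(sys_distinct sysB)[n1 n2].
by have [f|f] := sgn_trans (sgn_sym e) e'; [apply: n1|apply: n2].
Qed.

Lemma notin_supp l (c : 'I_l -> R) k : k \notin supp c -> c k = 0.
Proof. by rewrite inE negbK => /eqP. Qed.

Lemma max_weight_le_match : max_weight a <= max_weight b.
Proof.
apply: bigmax_le => [|k _]; first exact: bigmax_ge_id.
have [kS|/notin_supp ->] := boolP (k \in supp a); last exact: bigmax_ge_id.
by have [j [_ <- _]] := AB kS; apply: le_bigmax_cond.
Qed.

Lemma act_wform_match (f : R -> R) : f 0 = 0 ->
  act h (wform A (fun k => f (a k))) = wform B (fun j => f (b j)).
Proof.
move=> f0.
have restrict l (C : 'M[int]_(g, l)) (c : 'I_l -> R) :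
    wform C (fun k => f (c k)) = \sum_(k in supp c) f (c k) *: sq R (col k C).
  rewrite [RHS]big_mkcond; apply: eq_bigr => k _; case: ifPn => // /notin_supp ->.
  by rewrite f0 scale0r.
rewrite !restrict act_sum; have [/eqP S0|[k0 k0S]] := set_0Vmem (supp a).
  rewrite big1 => [|k]; last by rewrite (eqP S0) inE.
  rewrite big1 // => j /BA[k]; rewrite (eqP S0) inE; by case.
have [j0 _] := AB k0S.
have /choice[p pP] k : exists j, k \in supp a ->
    [/\ j \in supp b, b j = a k & sgn_eq (h *m col k A) (col j B)].
  have [kS|_] := boolP (k \in supp a); last by exists j0.
  by have [j jP] := AB kS; exists j.
have p_inj : {in supp a &, injective p}.
  move=> k k' kS kS' e; have [_ _ h1] := pP k kS; have [_ _ h2] := pP k' kS'.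
  by apply: match_uniq_l h1 _; rewrite e.
have -> : supp b = [set p k | k in supp a]%SET.
  apply/setP => j; apply/idP/imsetP => [jS|[k kS ->]]; last by have [] := pP k kS.
  have [k [kS _ kj]] := BA jS; exists k => //.
  by have [_ _ h1] := pP k kS; apply: match_uniq_r kj h1.
rewrite big_imset //=; apply: eq_bigr => k kS; have [_ -> kj] := pP k kS.
by rewrite actZ act_sq (sq_sgn R kj).
Qed.

(** A nonzero entry means that [gamma j] occurs in the expansion of the image of [beta i], so
    dominance of [gamma] makes it at least as heavy. *)
Lemma match_support beta gamma : basis A beta -> basis B gamma ->
  dominant A beta a -> dominant B gamma b -> forall i j,
  a (beta i) != 0 ->
  (invmx (colsub gamma B) *m h *m colsub beta A) j i != 0 -> b (gamma j) != 0.
Proof.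
move=> ub ug da db i j ai.
have iS : beta i \in supp a by rewrite inE.
have [l [lS bl hl]] := AB iS.
have -> : (invmx (colsub gamma B) *m h *m colsub beta A) j i =
    (invmx (colsub gamma B) *m (h *m col (beta i) A)) j 0.
  by rewrite -col_colsub [col i (colsub _ _)]colE !mulmxA -colE [RHS]mxE.
have cE : (invmx (colsub gamma B) *m col l B) j 0 = coords B gamma j l.
  by rewrite /coords colE mulmxA -colE [LHS]mxE.
have : (invmx (colsub gamma B) *m (h *m col (beta i) A)) j 0 != 0 ->
    coords B gamma j l != 0.
  case: hl => ->; first by rewrite cE.
  by rewrite mulmxN oppr_mxE oppr_eq0 cE.
move=> H /H /db; rewrite bl => le; have : 0 < a (beta i) by rewrite lt_def ai a0.
by move=> /lt_le_trans /(_ le); rewrite lt_def => /andP[].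
Qed.

End Matching.

(** A dominant basis [delta] of [B] is built that extends the image of the part of [beta] of nonzero
    weight. The element [G] sends [beta] to [delta] up to signs and agrees with [h] on all columns
    of nonzero weight; [flow_basis_indep] then passes from [delta] to [gamma]. *)
Lemma flow_iso m n (A : 'M[int]_(g, m)) (B : 'M[int]_(g, n)) (h : 'M[int]_g)
    (a : 'I_m -> R) (b : 'I_n -> R) beta gamma u :
  unimodular_system R A -> unimodular_system R B -> h \in unitmx ->
  (forall k, 0 <= a k) -> (forall j, 0 <= b j) -> 0 <= u <= 1 ->
  act h @` cone (R := R) A (supp a) = cone B (supp b) ->
  act h (wform A a) = wform B b ->
  basis A beta -> basis B gamma -> dominant A beta a -> dominant B gamma b ->
  flow A beta a u <> 0 ->
  (forall gamma, basis B gamma -> flow B gamma b u <> 0) ->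
  link_point (cone A (full m)) (flow A beta a u) = link_point (cone B (full n)) (flow B gamma b u).
Proof.
move=> sysA sysB uh a0 b0 u01 hAB hab ub ug da db stA stB.
have [AB BA] := cone_match sysA sysB uh hAB hab.
have uh' : invmx h \in unitmx by rewrite unitmx_inv.
have inv_sgn k j : sgn_eq (h *m col k A) (col j B) ->
    sgn_eq (invmx h *m col j B) (col k A).
  by case=> e; [left|right]; rewrite -[col k A](mulKmx uh) e ?mulmxN ?opprK.
have AB' j : j \in supp b -> exists k,
    [/\ k \in supp a, a k = b j & sgn_eq (invmx h *m col j B) (col k A)].
  by move=> /BA[k [? ? /inv_sgn ?]]; exists k.
pose X := invmx (colsub gamma B) *m h *m colsub beta A.
pose Y := invmx (colsub beta A) *m invmx h *m colsub gamma B.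
have dX : \det X != 0.
  have : X \in unitmx by rewrite !unitmx_mul unitmx_inv uh -andbA; apply/and3P.
  by rewrite unitmxE; apply: contraTneq => ->; rewrite unitr0.
have dY : \det Y != 0.
  have : Y \in unitmx by rewrite !unitmx_mul !unitmx_inv uh -andbA; apply/and3P.
  by rewrite unitmxE; apply: contraTneq => ->; rewrite unitr0.
(* These permutations send basis elements of nonzero weight to such elements in either direction, so
   both bases contain equally many. *)
have [s sP] := unitmx_perm dX; have [t tP] := unitmx_perm dY.
pose I := [set i | a (beta i) != 0]%SET.
pose J := [set j | b (gamma j) != 0]%SET.
have sIJ i : i \in I -> s i \in J.
  by rewrite !inE => ai; apply: (match_support a0 AB ub ug da db ai (sP i)).
have tJI j : j \in J -> t j \in I.
  by rewrite !inE => bj; apply: (match_support b0 AB' ug ub db da bj (tP j)).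
have sI : [set s i | i in I]%SET = J.
  apply/eqP; rewrite eqEcard; apply/andP; split.
    by apply/fintype.subsetP => _ /imsetP[i iI ->]; exact: sIJ.
  rewrite card_imset; last exact: perm_inj.
  rewrite -(card_imset J (@perm_inj _ t)); apply: subset_leq_card.
  by apply/fintype.subsetP => _ /imsetP[j jJ ->]; exact: tJI.
have sNI j : j \notin J -> exists2 i, i \notin I & s i = j.
  move=> jJ; exists ((s^-1)%g j); last by rewrite permKV.
  by apply: contra jJ => /sIJ; rewrite permKV.
(* Where the weight is nonzero [delta] follows the matching; the other places receive the elements
   of [gamma] of weight 0, paired by [s]. *)
have /choice[delta dP] i : exists j, (i \in I -> [/\ j \in supp b, b j = a (beta i)
      & sgn_eq (h *m col (beta i) A) (col j B)]) /\ (i \notin I -> j = gamma (s i)).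
  have [iI|iI] := boolP (i \in I); last by exists (gamma (s i)).
  have [|j jP] := AB (beta i); first by rewrite inE in iI; rewrite inE.
  by exists j.
have dI i : i \in I -> [/\ delta i \in supp b, b (delta i) = a (beta i)
    & sgn_eq (h *m col (beta i) A) (col (delta i) B)] by have [] := dP i.
have dN i : i \notin I -> delta i = gamma (s i) by have [] := dP i.
have suppI k i : k \in supp a -> coords A beta i k != 0 -> i \in I.
  rewrite !inE => ak /da le; apply: contra_neq ak => ai.
  by apply/eqP; rewrite eq_le a0 -ai le.
(* A functional killing [delta] kills the images of all columns of nonzero weight, because these
   expand in basis elements of nonzero weight; hence it kills [gamma]. *)
have ud : basis B delta.
  apply: (basis_of_spans sysB) => z zd.
  have zI i : i \in I -> dot (z *m real_of_int R h) (col (beta i) A) = 0.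
    by move=> iI; rewrite -dot_mul; have [_ _ e] := dI i iI; apply: dot_sgn (sgn_sym e) _.
  have zS k : k \in supp a -> dot z (h *m col k A) = 0.
    move=> kS; rewrite dot_mul (dot_expand _ k ub) big1 // => i _.
    have [->|/(suppI _ _ kS)/zI ->] := eqVneq (coords A beta i k) 0.
      by rewrite mul0r.
    by rewrite mulr0.
  apply: (basis_spans sysB ug) => j; have [jJ|jJ] := boolP (j \in J).
    have [|k [kS _ e]] := BA (gamma j); first by rewrite inE in jJ; rewrite inE.
    by apply: dot_sgn e _; apply: zS.
  by have [i iI <-] := sNI j jJ; rewrite -dN.
have /choice[e eP] i : exists e : int, [/\ e = 1 \/ e = -1 &
    (i \in I -> h *m col (beta i) A = e *: col (delta i) B)].
  have [iI|iI] := boolP (i \in I); last by exists 1; split => //; left.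
  have [_ _ [->|->]] := dI i iI; first by exists 1; rewrite scale1r; split => //; left.
  by exists (-1); rewrite scaleN1r; split => //; right.
pose G := colsub delta B *m diag_mx (\row_i e i) *m invmx (colsub beta A).
have uG : G \in unitmx.
  rewrite !unitmx_mul unitmx_inv -andbA; apply/and3P; split=> //.
  rewrite unitmxE det_diag; apply: rpred_prod => i _; rewrite mxE.
  by have [[->|->] _] := eP i; rewrite ?unitrN unitr1.
have Gb i : sgn_eq (G *m col (beta i) A) (col (delta i) B).
  rewrite /G (mul_basis_self B delta e) //.
  by have [[->|->] _] := eP i; rewrite ?scale1r ?scaleN1r; [left|right].
have Gk k : k \in supp a -> G *m col k A = h *m col k A.
  move=> kS; rewrite /G (mul_basis_col B delta e) // (col_expand k ub) mulmx_sumr.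
  apply: eq_bigr => i _; rewrite -scalemxAr -scalerA.
  have [->|/(suppI _ _ kS) iI] := eqVneq (coords A beta i k) 0; first by rewrite !scale0r.
  by have [_ ->] := eP i.
have coordG i k j : k \in supp a -> sgn_eq (h *m col k A) (col j B) ->
    (coords B delta i j != 0) = (coords A beta i k != 0).
  move=> kS kj.
  have -> : coords B delta i j = (invmx (colsub delta B) *m col j B) i 0.
    by rewrite /coords colE mulmxA -colE [RHS]mxE.
  have : (invmx (colsub delta B) *m (h *m col k A)) i 0 = e i * coords A beta i k.
    rewrite -(Gk k kS) /G !mulmxA mulVmx // mul1mx -mulmxA.
    have -> : invmx (colsub beta A) *m col k A = col k (coords A beta).
      by rewrite /coords !colE mulmxA.
    by rewrite mul_diag_mx mxE [col _ _ _ _]mxE [(\row__ _) _ _]mxE.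
  have e0 : e i != 0 by have [[->|->] _] := eP i.
  case: kj => ->; first by move=> ->; rewrite mulf_eq0 (negbTE e0).
  rewrite mulmxN oppr_mxE => h1; by rewrite -oppr_eq0 h1 mulf_eq0 (negbTE e0).
have bdelta i : b (delta i) = a (beta i).
  have [iI|iI] := boolP (i \in I); first by have [] := dI i iI.
  have : s i \notin J.
    rewrite -sI; apply: contra iI => /imsetP[i' iI' /perm_inj ->] //.
  by rewrite dN //; move: iI; rewrite !inE !negbK => /eqP -> /eqP.
have dd : dominant B delta b.
  move=> i j ij; rewrite bdelta; have [/BA[k [kS -> kj]]|/notin_supp ->//] := boolP (j \in supp b).
  by apply: da; rewrite -(coordG i k j).
have botE i : bottleneck A beta a i = bottleneck B delta b i.
  apply/eqP; rewrite eq_le; apply/andP; split; apply: bigmax_le;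
    rewrite ?bigmax_ge_id // => k /andP[kb ik].
  - have [kS|/notin_supp ->] := boolP (k \in supp a); last exact: bigmax_ge_id.
    have [j [jS <- kj]] := AB k kS; apply: le_bottleneck; last by rewrite (coordG i k j).
    apply: contra kb => /eqP jd; apply/eqP; apply: (match_uniq_l sysA uh kj).
    by rewrite jd; have [_ _] := dI i (suppI _ _ kS ik).
  - have [kS|/notin_supp ->] := boolP (k \in supp b); last exact: bigmax_ge_id.
    have [l [lS -> lk]] := BA k kS; have il : coords A beta i l != 0.
      by rewrite -(coordG i l k).
    apply: le_bottleneck => //; apply: contra kb => /eqP lb; apply/eqP.
    have [_ _] := dI i (suppI _ _ lS il); rewrite -lb; exact: (match_uniq_r sysB lk).
have topE : max_weight a = max_weight b.
  apply/eqP; rewrite eq_le (max_weight_le_match AB)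
    (max_weight_le_match (h := invmx h) (B := A) AB').
  by [].
rewrite -(flow_basis_indep xi0 g0 sysB b0 u01 ud ug dd db stB).
pose S := [set k | (a k != 0) || [exists l, k == beta l]]%SET.
have Sb l : beta l \in S by rewrite inE; apply/orP; right; apply/existsP; exists l.
have SG k : k \in S -> exists j, sgn_eq (G *m col k A) (col j B).
  rewrite inE => /orP[ak|/existsP[l /eqP ->]]; last by exists (delta l).
  have kS : k \in supp a by rewrite inE.
  by have [j [_ _ kj]] := AB k kS; exists j; rewrite Gk.
have spS : spans R A S.
  by move=> z zS; apply: (basis_spans sysA ub) => l; apply: zS.
pose f r := pos_part ((1 - u) * r - u * max_weight a).
have f0 : f 0 = 0.
  rewrite /f mulr0 sub0r pos_part_eq0 // oppr_le0 mulr_ge0 ?bigmax_ge_id //.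
  by case/andP: u01.
have stS : cone A S (flow A beta a u).
  apply: coneD.
    apply/coneP; exists (fun k => f (a k)); split=> //.
      by move=> k; exact: pos_part_ge0.
    by move=> k; rewrite inE negb_or negbK => /andP[/eqP ->].
  by apply: cone_sum => l _; apply: coneZ; [exact: pos_part_ge0|exact: cone_sq].
rewrite (link_point_cone_transport xi0 g0 sysA sysB spS uG SG stS stA); congr link_point.
rewrite /flow actD -topE; congr (_ + _).
  rewrite -(act_wform_match sysA sysB uh AB BA f0) /wform !act_sum.
  apply: eq_bigr => k _; rewrite !actZ !act_sq.
  have [kS|/notin_supp ak] := boolP (k \in supp a); first by rewrite Gk.
  by rewrite ak -/(f 0) f0 !scale0r.
rewrite act_sum; apply: eq_bigr => i _.
by rewrite actZ act_sq (sq_sgn R (Gb i)) botE.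
Qed.

End Iso.

(** * Faces of a perfect cone *)

Lemma parallelogram_contra (R : realFieldType) (p q r : R) :
  0 < p -> p <= q -> p <= r -> p + p = 2 * r + 2 * q -> False.
Proof. lra. Qed.

Section FiniteCones.
Variables (R : realType) (g : nat).

(* The parallelogram law: two minimal vectors congruent modulo 2 are equal up
   to sign, so a perfect cone has at most [2 ^ g] generators. *)
Lemma min_vectors_parity (Q : 'M[R]_g) (v w : 'cV[int]_g) : posdef Q ->
  min_vectors Q v -> min_vectors Q w ->
  (forall i, odd `|v i 0| = odd `|w i 0|) -> v = w \/ v = - w.
Proof.
move=> [Qs Q0] [v0 vm] [w0 wm] vw.
(* Here [v = (w + z) + z] and [w = (w + z) - z]. If neither [z] nor [w + z] is 0, the right side of
   the parallelogram law is at least four times the minimum, the left side only twice. *)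
pose z : 'cV[int]_g := \col_i ((v i 0%R - w i 0%R) %/ 2)%Z.
have vE : v = w + (z + z).
  apply/colP => i; rewrite !mxE.
  have := @even_half (v i 0 - w i 0); have := vw i.
  by move=> h /(_ _) <-; [rewrite addrC subrK|lia].
have [z0|z0] := eqVneq z 0; first by left; rewrite vE z0 !addr0.
have [wz0|wz0] := eqVneq (w + z) 0.
  by right; rewrite vE addrA wz0 add0r; apply: (addrI w); rewrite wz0 subrr.
have kap0 : 0 < qform Q (real_of_int R v).
  by apply: Q0; rewrite -(map_mx0 intr) (inj_eq (@real_of_int_inj R _ _)).
have h1 := vm _ z0; have h2 := vm _ wz0.
have h3 : qform Q (real_of_int R w) = qform Q (real_of_int R v).
  by apply/eqP; rewrite eq_le wm // vm.
have par : qform Q (real_of_int R v) + qform Q (real_of_int R w) =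
    2 * qform Q (real_of_int R (w + z)) + 2 * qform Q (real_of_int R z).
  have add (x y : 'cV[R]_g) : qform Q (x + y) + qform Q (x - y) =
      2 * qform Q x + 2 * qform Q y.
    rewrite /qform !linearD linearN /= !(mulmxDl, mulmxDr, mulNmx, mulmxN) !mxE.
    lra.
  have -> : real_of_int R v = real_of_int R (w + z) + real_of_int R z.
    by rewrite /real_of_int -map_mxD -addrA -vE.
  have -> : real_of_int R w = real_of_int R (w + z) - real_of_int R z.
    by rewrite /real_of_int -map_mxB addrK.
  exact: add.
by case: (parallelogram_contra kap0 h1 h2); rewrite -{2}h3.
Qed.

Lemma perfect_cone_finite (Q : 'M[R]_g) : posdef Q ->
  exists (P : pred {ffun 'I_g -> bool}) (W : {ffun 'I_g -> bool} -> 'M[R]_g),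
  perfect_cone Q = [set X | exists2 a : {ffun 'I_g -> bool} -> R,
    (forall p, 0 <= a p) & X = \sum_(p | P p) a p *: W p].
Proof.
move=> pQ; pose par (v : 'cV[int]_g) := [ffun i => odd `|v i 0|].
pose P p := `[< exists2 v, min_vectors Q v & par v = p >].
have /choice[W WP] p : exists X, P p -> exists v, [/\ min_vectors Q v, par v = p & X = sq R v].
  have [/asboolP[v vm vp]|_] := boolP (P p); last by exists 0.
  by exists (sq R v) => _; exists v.
exists P, W; rewrite -nonneg_span_finite /perfect_cone; congr nonneg_span.
apply/seteqP; split=> X.
  move=> [v vm <-]; exists (par v) => /=; first by apply/asboolP; exists v.
  have [|w [wm wp ->]] := WP (par v); first by apply/asboolP; exists v.
  apply: sq_sgn; apply: min_vectors_parity pQ wm vm _ => i.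
  by have /ffunP/(_ i) := wp; rewrite !ffunE.
by move=> [p /= /WP[v [vm _ ->]] <-]; exists v.
Qed.

Section Faces.
Variables (I : finType) (P : pred I) (W : I -> 'M[R]_g).
Let s : set 'M[R]_g := [set X | exists2 a : I -> R,
    (forall p, 0 <= a p) & X = \sum_(p | P p) a p *: W p].

Lemma fin_coneD X Y : s X -> s Y -> s (X + Y).
Proof.
move=> [a a0 ->] [b b0 ->]; exists (fun p => a p + b p) => [p|].
  by rewrite addr_ge0.
by rewrite -big_split; apply: eq_bigr => p _; rewrite scalerDl.
Qed.
Lemma fin_coneZ c X : 0 <= c -> s X -> s (c *: X).
Proof.
move=> c0 [a a0 ->]; exists (fun p => c * a p) => [p|]; first by rewrite mulr_ge0.
by rewrite scaler_sumr; apply: eq_bigr => p _; rewrite scalerA.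
Qed.
Lemma fin_cone0 : s 0.
Proof. by exists (fun=> 0) => //; rewrite big1 // => p _; rewrite scale0r. Qed.

Lemma gen_face_refl x : s x -> gen_face s x x.
Proof.
by move=> sx; split=> //; exists 1 => //; rewrite scale1r subrr; exact: fin_cone0.
Qed.

Lemma gen_face_smaller x z e d : s x -> 0 < e -> 0 < d -> d <= e -> s (x - e *: z) ->
  s (x - d *: z).
Proof.
move=> sx e0 d0 de sz.
have -> : x - d *: z = (1 - d / e) *: x + (d / e) *: (x - e *: z).
  rewrite scalerBr scalerA divfK ?gt_eqF // addrA -scalerDl subrK scale1r //.
apply: fin_coneD; apply: fin_coneZ => //.
  by rewrite subr_ge0 ler_pdivrMr // mul1r.
by rewrite divr_ge0 // ltW.
Qed.

Lemma gen_faceD x y z : s x -> gen_face s x y -> gen_face s x z ->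
  gen_face s x (y + z).
Proof.
move=> sx [sy [e e0 hy]] [sz [d d0 hz]]; split; first exact: fin_coneD.
pose m := Num.min e d; have m0 : 0 < m by rewrite lt_min e0.
exists (m / 2); first by rewrite divr_gt0.
have -> : x - (m / 2) *: (y + z) = 2^-1 *: (x - m *: y) + 2^-1 *: (x - m *: z).
  by apply/matrixP => i j; rewrite !mxE; field.
by apply: fin_coneD; apply: fin_coneZ; rewrite ?invr_ge0 //;
  [apply: gen_face_smaller e0 _ _ hy|apply: gen_face_smaller d0 _ _ hz];
  rewrite // ge_min lexx ?orbT.
Qed.

Lemma gen_faceZ x z c : s x -> 0 <= c -> gen_face s x z -> gen_face s x (c *: z).
Proof.
move=> sx c0 [sz [e e0 hz]]; split; first exact: fin_coneZ.
move: c0; rewrite le_eqVlt => /predU1P[<-|c0].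
  by exists 1 => //; rewrite scale0r scaler0 subr0.
exists (e / c); first by rewrite divr_gt0.
by rewrite scalerA divfK // gt_eqF.
Qed.

Lemma gen_face0 x : s x -> gen_face s x 0.
Proof.
by move=> sx; split; [exact: fin_cone0|exists 1; rewrite // scaler0 subr0].
Qed.

(** A finite invariant that determines the smallest face ([gen_face_type]). *)
Definition face_type x : {set I} := [set p | `[< P p /\ gen_face s x (W p) >]]%SET.

(** The smallest face is spanned by the generators it contains, because a generator with positive
    coefficient in an element of the face lies in the face. *)
Lemma gen_face_type x y : s x -> s y -> face_type x = face_type y ->
  gen_face s x `<=` gen_face s y.
Proof.
move=> sx sy xy z [[a a0 zE] [e e0 xz]].
rewrite zE; apply: big_ind => [||p Pp]; first exact: gen_face0.
  by move=> ? ?; exact: gen_faceD.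
have := a0 p; rewrite le_eqVlt => /predU1P[<-|ap].
  by rewrite scale0r; exact: gen_face0.
apply: gen_faceZ => //; suff : p \in face_type y by rewrite inE => /asboolP[].
rewrite -xy inE; apply/asboolP; split=> //; split.
  exists (fun q => (q == p)%:R) => [q|]; first by rewrite ler0n.
  rewrite (bigD1 p) //= eqxx scale1r big1 ?addr0 // => q /andP[_ /negbTE ->].
  by rewrite scale0r.
exists (e * a p); first exact: mulr_gt0.
have -> : x - (e * a p) *: W p = (x - e *: z) + e *: (\sum_(q | P q && (q != p)) a q *: W q).
  rewrite zE (bigD1 p) //= scalerDr opprD addrA subrK scalerA //.
apply: fin_coneD => //; apply: fin_coneZ; first exact: ltW.
exists (fun q => if q == p then 0 else a q) => [q|]; first by case: ifP.
rewrite [RHS](bigD1 p) //= eqxx scale0r add0r; apply: eq_bigr => q /andP[_ /negbTE ->].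
by [].
Qed.

End Faces.
End FiniteCones.

(** * The topology of the link *)

Section Continuity.
Variable (R : realType).

Lemma cvg_mx (T : Type) (F : set_system T) m n (f : T -> 'M[R]_(m, n)) (M : 'M[R]_(m, n)) :
  Filter F -> (forall i j, f x i j @[x --> F] --> M i j) -> f @ F --> M.
Proof.
move=> FF h A [P MP PA]; rewrite /fmap /=.
have : \forall x \near F, forall i j, P i j (f x i j).
  by apply: filter_forall => i; apply: filter_forall => j; exact: (h i j _ (MP i j)).
by apply: filterS => x Px; apply: PA.
Qed.

Lemma continuous_maxr (T : topologicalType) (f g : T -> R) :
  continuous f -> continuous g -> continuous (fun x => Num.max (f x) (g x)).
Proof. by move=> cf cg x; apply: (@continuous_max R T f g x (cf x) (cg x)). Qed.

Lemma continuous_bigmaxr (T : topologicalType) (I : Type) (r : seq I) (P : pred I)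
    (f : I -> T -> R) :
  (forall i, P i -> continuous (f i)) ->
  continuous (fun x => \big[Num.max/0]_(i <- r | P i) f i x).
Proof.
move=> cf; apply: (@continuous_big R I Num.max 0 P) => //.
apply: continuous_maxr => -[x y]; [exact: cvg_fst|exact: cvg_snd].
Qed.

Lemma continuous_sumr (T : topologicalType) (I : Type) (r : seq I) (P : pred I)
    (f : I -> T -> R) :
  (forall i, P i -> continuous (f i)) ->
  continuous (fun x => \sum_(i <- r | P i) f i x).
Proof.
move=> cf; apply: (@continuous_big R I +%R 0 P) => //; exact: add_continuous.
Qed.

Lemma continuous_addr (T : topologicalType) (f g : T -> R) :
  continuous f -> continuous g -> continuous (fun x => f x + g x).
Proof. by move=> cf cg x; apply: cvgD; [exact: cf|exact: cg]. Qed.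
Lemma continuous_subr (T : topologicalType) (f g : T -> R) :
  continuous f -> continuous g -> continuous (fun x => f x - g x).
Proof. by move=> cf cg x; apply: cvgB; [exact: cf|exact: cg]. Qed.
Lemma continuous_mulr (T : topologicalType) (f g : T -> R) :
  continuous f -> continuous g -> continuous (fun x => f x * g x).
Proof. by move=> cf cg x; apply: cvgM; [exact: cf|exact: cg]. Qed.
Lemma continuous_cst (T U : topologicalType) (c : U) : continuous (fun _ : T => c).
Proof. by move=> x; exact: cvg_cst. Qed.

Lemma continuous_scalar n p (l : 'M[R]_(n, p) -> R) :
  (forall a y z, l (a *: y + z) = a * l y + l z) -> continuous l.
Proof.
move=> lin; have l0 : l 0 = 0.
  have := lin 1 0 0; rewrite scaler0 addr0 mul1r => h.
  by apply: (addrI (l 0)); rewrite addr0 -h.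
have lD y z : l (y + z) = l y + l z by have := lin 1 y z; rewrite scale1r mul1r.
have lZ a y : l (a *: y) = a * l y by have := lin a y 0; rewrite !addr0 l0 addr0.
have -> : l = fun y => \sum_i \sum_j y i j * l (delta_mx i j).
  apply/funext => y; rewrite {1}[y]matrix_sum_delta (big_morph l lD l0).
  apply: eq_bigr => i _; rewrite (big_morph l lD l0).
  by apply: eq_bigr => j _; rewrite lZ.
apply: continuous_sumr => i _; apply: continuous_sumr => j _.
apply: continuous_mulr; last exact: continuous_cst.
exact: coord_continuous.
Qed.

Lemma near_lt0 (T : topologicalType) (f : T -> R) x : continuous f -> f x < 0 ->
  \forall y \near x, f y < 0.
Proof. by move=> cf fx; exact: (@cvgr_lt R T (nbhs x) _ f (f x) (cf x) 0 fx). Qed.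

Lemma near_neq0 (T : topologicalType) (f : T -> R) x : continuous f -> f x != 0 ->
  \forall y \near x, f y != 0.
Proof.
move=> cf; rewrite neq_lt => /orP[fx|fx].
  by apply: filterS (@cvgr_lt R T (nbhs x) _ f (f x) (cf x) 0 fx) => y /ltr0_neq0.
by apply: filterS (@cvgr_gt R T (nbhs x) _ f (f x) (cf x) 0 fx) => y /lt0r_neq0.
Qed.

Definition weights m (a : 'rV[R]_m) : 'I_m -> R := fun k => a 0 k.

Lemma continuous_weights (T : topologicalType) m (f : T -> 'rV[R]_m) k :
  continuous f -> continuous (fun x => weights (f x) k).
Proof.
move=> cf x; apply: (@continuous_comp _ _ _ f (fun a : 'rV[R]_m => a 0 k)).
  exact: cf.
exact: coord_continuous.
Qed.

Lemma continuous_wform (T : topologicalType) g m (A : 'M[int]_(g, m)) (c : 'I_m -> T -> R) :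
  (forall k, continuous (c k)) -> forall i j, continuous (fun x => wform A (c^~ x) i j).
Proof.
move=> cc i j.
have -> : (fun x => wform A (c^~ x) i j) = fun x => \sum_k c k x * sq R (col k A) i j.
  by apply/funext => x; rewrite summxE; apply: eq_bigr => k _; rewrite !mxE.
apply: continuous_sumr => k _; apply: continuous_mulr => //; exact: continuous_cst.
Qed.

Lemma continuous_flow g m (A : 'M[int]_(g, m)) beta :
  continuous (fun p : 'rV[R]_m * R => flow A beta (weights p.1) p.2).
Proof.
have cw k : continuous (fun p : 'rV[R]_m * R => weights p.1 k).
  by apply: continuous_weights => p; exact: cvg_fst.
have c2 : continuous (fun p : 'rV[R]_m * R => p.2) by move=> p; exact: cvg_snd.
have ct : continuous (fun p : 'rV[R]_m * R => p.2 * max_weight (weights p.1)).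
  by apply: continuous_mulr => //; exact: continuous_bigmaxr.
have c1 : continuous (fun p : 'rV[R]_m * R => 1 - p.2).
  by apply: continuous_subr => //; exact: continuous_cst.
have cp (f : 'rV[R]_m * R -> R) : continuous f -> continuous (fun p => pos_part (f p)).
  by move=> cf; apply: continuous_maxr => //; exact: continuous_cst.
move=> p; apply: cvg_mx => i j.
have -> : (fun p : 'rV[R]_m * R => flow A beta (weights p.1) p.2 i j) = fun p =>
    wform A (fun k => pos_part ((1 - p.2) * weights p.1 k - p.2 * max_weight (weights p.1))) i j +
    \sum_l pos_part (p.2 * max_weight (weights p.1) - (1 - p.2) *
      bottleneck A beta (weights p.1) l) *
       sq R (col (beta l) A) i j.
  apply/funext => q; rewrite /flow mxE; congr (_ + _); rewrite summxE.
  by apply: eq_bigr => l _; rewrite mxE.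
rewrite [X in _ --> X](_ : _ = (fun p : 'rV[R]_m * R =>
    wform A (fun k => pos_part ((1 - p.2) * weights p.1 k - p.2 * max_weight (weights p.1))) i j +
    \sum_l pos_part (p.2 * max_weight (weights p.1) - (1 - p.2) *
      bottleneck A beta (weights p.1) l) *
       sq R (col (beta l) A) i j) p); last first.
  rewrite /flow mxE; congr (_ + _); rewrite summxE.
  by apply: eq_bigr => l _; rewrite mxE.
apply: continuous_addr.
  pose c k (q : 'rV[R]_m * R) :=
    pos_part ((1 - q.2) * weights q.1 k - q.2 * max_weight (weights q.1)).
  have cc k : continuous (c k).
    by apply: cp; apply: continuous_subr => //; exact: continuous_mulr.
  exact: (@continuous_wform _ g m A c cc i j).
apply: continuous_sumr => l _; apply: continuous_mulr; last exact: continuous_cst.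
apply: cp; apply: continuous_subr => //; apply: continuous_mulr => //.
exact: continuous_bigmaxr.
Qed.

End Continuity.

Section Charts.
Variables (R : realType) (g : nat) (xi0 : LAtrop R g).
Hypothesis g0 : (0 < g)%N.
Local Notation link_point := (@link_point R g xi0).
Local Notation X := (coloop_subcomplex R g).

(** The witness keeps the flow nonzero; the last clause places the cone in the coloop locus. *)
Definition coloop_system m (A : 'M[int]_(g, m)) : Prop :=
  [/\ unimodular_system R A, exists e z, coloop_witness (R := R) A e z
    & coloop_cone (cone (R := R) A (full m))].

Definition admissible m (a : 'rV[R]_m) : Prop :=
  (forall k, 0 <= weights a k) /\ exists k, weights a k != 0.

Definition chart m (A : 'M[int]_(g, m)) (a : 'rV[R]_m) : LAtrop R g :=
  link_point (cone A (full m)) (wform A (weights a)).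

Lemma mem_coloop_subcomplex m (A : 'M[int]_(g, m)) (y : 'M[R]_g) : coloop_system A ->
  valid (cone A (full m)) y -> X (link_point (cone A (full m)) y).
Proof.
move=> [_ _ cA] v; rewrite (link_pointE xi0 v); case: v => Ds sy y0 /=.
exists (set_type_elt Ds); last by eexists.
split=> //= e; have : [set 0] y by rewrite -e.
by [].
Qed.

Section Good.
Variables (m : nat) (A : 'M[int]_(g, m)).
Hypothesis gA : coloop_system A.

Lemma coloop_system_unimodular : unimodular_system R A. Proof. by case: gA. Qed.

Lemma coloop_system_valid (y : 'M[R]_g) : cone A (full m) y -> y <> 0 -> valid (cone A (full m)) y.
Proof.
move=> cy y0; split=> //; apply: (cone_perfect coloop_system_unimodular) => //.
exact: sys_spans coloop_system_unimodular.
Qed.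

Lemma chart_valid a : admissible a -> valid (cone A (full m)) (wform A (weights a)).
Proof.
move=> [a0 [k ak]]; apply: coloop_system_valid; first by apply/coneT; exists (weights a).
move=> h; have : wform A (weights a) = wform A (fun=> 0).
  by rewrite h /wform big1 // => j _; rewrite scale0r.
by move=> /(wform_inj coloop_system_unimodular)/(congr1 (@^~ k))/eqP; rewrite (negbTE ak).
Qed.

Lemma chart_mem a : admissible a -> X (chart A a).
Proof. by move=> /chart_valid; exact: mem_coloop_subcomplex. Qed.

Lemma flow_valid beta a u : admissible a -> basis A beta -> 0 <= u <= 1 ->
  valid (cone A (full m)) (flow A beta (weights a) u).
Proof.
move=> [a0 ak] ub u01; have [_ [e [z wit]] _] := gA.
apply: coloop_system_valid; first exact: flow_cone.
exact: (flow_neq0 coloop_system_unimodular a0 u01 wit ub ak).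
Qed.

Lemma flow_scale beta (a : 'I_m -> R) u (c : R) : 0 <= c ->
  flow A beta (fun k => c * a k) u = c *: flow A beta a u.
Proof.
move=> c0.
have maxZ x y : c * Num.max x y = Num.max (c * x) (c * y) by rewrite maxr_pMr.
have posZ r : pos_part (c * r) = c * pos_part r by rewrite /pos_part maxZ mulr0.
have bigZ (P : pred 'I_m) : \big[Num.max/0]_(k | P k) (c * a k) =
    c * \big[Num.max/0]_(k | P k) a k.
  by rewrite (big_morph (fun x => c * x) maxZ (mulr0 c)).
rewrite /flow scalerDr wformZ /max_weight /bottleneck !bigZ; congr (_ + _).
  by congr wform; apply/funext => k; rewrite -posZ mulrBr !(mulrCA c).
rewrite scaler_sumr; apply: eq_bigr => i _.
by rewrite bigZ scalerA -posZ mulrBr !(mulrCA c).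
Qed.

Lemma flow_start beta (a : 'I_m -> R) : (forall k, 0 <= a k) ->
  flow A beta a 0 = wform A a.
Proof.
move=> a0; rewrite /flow subr0 mul0r [X in _ + X]big1 ?addr0 => [|i _].
  by congr wform; apply/funext => k; rewrite mul1r subr0 pos_part_id.
by rewrite pos_part_eq0 ?scale0r // sub0r mul1r oppr_le0 bigmax_ge_id.
Qed.

Lemma flow_end beta (a : 'I_m -> R) :
  flow A beta a 1 = max_weight a *: \sum_i sq R (col (beta i) A).
Proof.
rewrite /flow subrr mul1r /wform big1 ?add0r => [|k _].
  rewrite scaler_sumr; apply: eq_bigr => i _; rewrite mul0r subr0 pos_part_id //.
  exact: bigmax_ge_id.
by rewrite mul0r sub0r pos_part_eq0 ?scale0r // oppr_le0 bigmax_ge_id.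
Qed.

End Good.

(** Equal classes match the weights only up to the scalar [c], which is absorbed by homogeneity of
    the flow. *)
Lemma chart_eq_flow m n (A : 'M[int]_(g, m)) (B : 'M[int]_(g, n)) a b beta gamma u :
  coloop_system A -> coloop_system B -> admissible a -> admissible b -> chart A a = chart B b ->
  basis A beta -> basis B gamma -> dominant A beta (weights a) -> dominant B gamma (weights b) ->
  0 <= u <= 1 ->
  link_point (cone A (full m)) (flow A beta (weights a) u) =
  link_point (cone B (full n)) (flow B gamma (weights b) u).
Proof.
move=> gA gB aa ab e ub ug da db u01; have [a0 ak] := aa; have [b0 bk] := ab.
have [h [c [uh c0 hw hf _]]] := link_point_transported (chart_valid gA aa) (chart_valid gB ab) e.
have sysA := coloop_system_unimodular gA; have sysB := coloop_system_unimodular gB.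
pose b' k := c * weights b k.
have b'0 k : 0 <= b' k by rewrite mulr_ge0 // ltW.
have suppb : supp b' = supp (weights b).
  by apply/setP => k; rewrite !inE mulf_eq0 gt_eqF.
have [_ [eB [zB witB]] _] := gB.
have bk' : exists k, b' k != 0.
  by have [k h0] := bk; exists k; rewrite mulf_neq0 // gt_eqF.
rewrite -(@link_point_scale _ _ xi0 _ (flow B gamma (weights b) u) c) //; last exact: flow_valid.
rewrite -flow_scale ?(ltW c0) //.
apply: (@flow_iso R g xi0 g0 m n A B h (weights a) b' beta gamma u sysA sysB uh a0 b'0 u01) => //.
- by rewrite suppb -!gen_face_cone.
- by rewrite -hw wformZ.
- by move=> i k ik; rewrite ler_wpM2l ?(ltW c0) // db.
- by have [] := flow_valid gA aa ub u01.
- by move=> gam ugam; apply: (flow_neq0 sysB b'0 u01 witB ugam bk').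
Qed.

(** Two integral bases differ by an element of GL_g(Z); hence the end point depends neither on the
    starting point nor on the system. *)
Lemma basis_center m n (A : 'M[int]_(g, m)) (B : 'M[int]_(g, n)) beta gamma :
  unimodular_system R A -> unimodular_system R B -> basis A beta -> basis B gamma ->
  \sum_i sq R (col (beta i) A) <> 0 ->
  link_point (cone A (full m)) (\sum_i sq R (col (beta i) A)) =
  link_point (cone B (full n)) (\sum_i sq R (col (gamma i) B)).
Proof.
move=> sysA sysB ub ug x0.
pose one := fun _ : 'I_g => (1 : int).
pose G := colsub gamma B *m diag_mx (\row_i one i) *m invmx (colsub beta A).
have uG : G \in unitmx.
  rewrite !unitmx_mul unitmx_inv -andbA; apply/and3P; split=> //.
  have -> : diag_mx (\row_i one i) = 1%:M.
    by apply/matrixP => x y; rewrite !mxE.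
  exact: unitmx1.
have Gb l : G *m col (beta l) A = col (gamma l) B.
  by rewrite /G (mul_basis_self B gamma one) // scale1r.
pose S := [set beta i | i in 'I_g]%SET.
have Sb i : beta i \in S by exact: imset_f.
rewrite (@link_point_cone_transport _ _ xi0 g0 _ _ A B S G) //.
- congr link_point; rewrite act_sum; apply: eq_bigr => i _; by rewrite act_sq Gb.
- by move=> z zS; apply: (basis_spans sysA ub) => i; apply: zS.
- by move=> _ /imsetP[i _ ->]; exists (gamma i); rewrite Gb; left.
- by apply: cone_sum => i _; exact: cone_sq.
Qed.

(** The cone is closed, being given by linear equations and weak inequalities ([cone_memE]). *)
Lemma near_cone m (A : 'M[int]_(g, m)) (S : {set 'I_m}) (h : 'M[int]_g) (x : 'M[R]_g) :
  unimodular_system R A -> ~ cone A S (act h x) ->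
  \forall y \near x, ~ cone A S (act h y).
Proof.
move=> sysA nx.
have lin_act (l : 'M[R]_g -> R) : (forall a y z, l (a *: y + z) = a * l y + l z) ->
    continuous (fun y => l (act h y)).
  move=> ll; apply: continuous_scalar => a y z.
  by rewrite actD actZ ll.
have lin_tr (Q : 'M[R]_g) : forall a y z, trform Q (a *: y + z) = a * trform Q y + trform Q z.
  by move=> a y z; rewrite linearP.
have [h1|n1] := pselect (act h x = wform A (fun k => trform (coord sysA k) (act h x))); last first.
  have [i [j ij]] : exists i j,
      (act h x - wform A (fun k => trform (coord sysA k) (act h x))) i j != 0.
    apply: contrapT => hn; apply: n1; apply/eqP; rewrite -subr_eq0; apply/eqP.
    apply/matrixP => i j; rewrite [RHS]mxE; apply/eqP/negPn/negP => ij.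
    by apply: hn; exists i, j.
  pose l (y : 'M[R]_g) := (y - wform A (fun k => trform (coord sysA k) y)) i j.
  have ll a y z : l (a *: y + z) = a * l y + l z.
    rewrite /l.
    have -> : wform A (fun k => trform (coord sysA k) (a *: y + z)) =
        a *: wform A (fun k => trform (coord sysA k) y) +
        wform A (fun k => trform (coord sysA k) z).
      by rewrite wformZ wformD; congr wform; apply/funext => k; rewrite lin_tr.
    by rewrite !mxE; ring.
  apply: filterS (near_neq0 (lin_act _ ll) ij) => y /eqP yn /(cone_memE sysA)[ye _ _].
  by apply: yn; rewrite /l -ye subrr mxE.
have [h2|/existsNP[k /negP]] := pselect (forall k, 0 <= trform (coord sysA k) (act h x)); last first.
  rewrite -ltNge => k0.
  apply: filterS (near_lt0 (lin_act (trform (coord sysA k)) (lin_tr (coord sysA k))) k0).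
  by move=> y yk /(cone_memE sysA)[_ /(_ k) + _]; rewrite leNgt yk.
have [k [kS k0]] : exists k, k \notin S /\ trform (coord sysA k) (act h x) != 0.
  apply: contrapT => hn; apply: nx; apply/(cone_memE sysA); split=> // k kS.
  by apply/eqP/negPn/negP => k0; apply: hn; exists k.
apply: filterS (near_neq0 (lin_act (trform (coord sysA k)) (lin_tr (coord sysA k))) k0).
by move=> y /eqP yk /(cone_memE sysA)[_ _ /(_ k kS)].
Qed.

Hypothesis charts_cover : forall xi, X xi ->
  exists m (A : 'M[int]_(g, m)) (a : 'rV[R]_m), [/\ coloop_system A, admissible a & xi = chart A a].

(* The coloop subcomplex carries the final topology of the charts: a perfect
   cone has finitely many faces, and the trace on a face of the preimage of a
   subset of [X] is the same whichever cone represents that face. *)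
Lemma charts_final (V : set (LAtrop R g)) : V `<=` X ->
  (forall m (A : 'M[int]_(g, m)) a, coloop_system A -> admissible a -> V (chart A a) ->
    \forall a' \near a, admissible a' -> V (chart A a')) ->
  exists2 O, open O & V = O `&` X.
Proof.
move=> VX Vnear; pose C := X `\` V; exists (~` C); last first.
  apply/seteqP; split=> xi; first by move=> Vx; split; [case|exact: VX].
  by move=> [nC Xx]; apply: contrapT => nV; apply: nC.
apply/(LAtrop_openP xi0) => s x v nCx.
have [Ds sx x0] := v.
have [[P [W sE]]|s0] : (exists (P : pred {ffun 'I_g -> bool}) (W : {ffun 'I_g -> bool} -> 'M[R]_g),
  s = [set X | exists2 a : {ffun 'I_g -> bool} -> R,
    (forall p, 0 <= a p) & X = \sum_(p | P p) a p *: W p]) \/ s = [set 0].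
- case: Ds => [->|[Q pQ ->]]; [by right|left].
  exact: perfect_cone_finite.
(* There are finitely many face types, so one neighbourhood per type is enough. *)
- suff H T : \forall y \near x, valid s y -> face_type P W y = T -> ~ C (link_point s y).
    have : \forall y \near x, forall T, valid s y -> face_type P W y = T -> ~ C (link_point s y).
      exact: (@filter_forall _ _ (fun T y => valid s y -> face_type P W y = T ->
        ~ C (link_point s y)) (nbhs x) _ H).
    by apply: filterS => y hy vy; apply: (hy (face_type P W y)).
  have [[y0 [vy0 ty0 Cy0]]|none] := pselect (exists y0, [/\ valid s y0,
      face_type P W y0 = T & C (link_point s y0)]); last first.
    by near=> y => vy ty Cy; apply: none; exists y.
  have [Xy0 _] := Cy0.
  have [m [A [a [gA aa ey]]]] := charts_cover Xy0.
  have sysA := coloop_system_unimodular gA.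
  (* A single point [y0] of type [T] with class outside [V] provides an [h] that takes its whole
     smallest face into one chart. *)
  have [h [c [uh c0 hw hf hp]]] := link_point_transported vy0 (chart_valid gA aa) ey.
  have [_ sy0 _] := vy0.
  have faceT y : valid s y -> face_type P W y = T -> gen_face s y0 y.
    move=> [_ sy _] ty; rewrite sE in sy sy0 *.
    apply: (gen_face_type sy sy0); first by rewrite ty ty0.
    exact: gen_face_refl.
  rewrite gen_face_cone in hf => //; last by case: aa.
  pose cf (y : 'M[R]_g) : 'rV[R]_m := \row_k trform (coord sysA k) (act h y).
  have cfE y : gen_face s y0 y -> y <> 0 -> admissible (cf y) /\ link_point s y = chart A (cf y).
    move=> fy y0'; have : cone A (supp (weights a)) (act h y) by rewrite -hf; exists y.
    move=> /(cone_memE sysA)[ye ye0 _].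
    have wE : wform A (weights (cf y)) = act h y.
      by rewrite [RHS]ye; congr wform; apply/funext => k; rewrite /weights mxE.
    split; last by rewrite hp // /chart wE.
    split=> [k|]; first by rewrite /weights mxE.
    apply: contrapT => /forallNP hn; apply: (act_neq0 uh y0').
    rewrite ye /wform big1 // => k _; have := hn k; rewrite /weights mxE => /negP.
    by rewrite negbK => /eqP ->; rewrite scale0r.
  (* If [x] is not on this face, neither are nearby points, as the face is closed; if it is, the
     hypothesis on [V] applies in the chart. *)
  have [cx|ncx] := pselect (cone A (supp (weights a)) (act h x)); last first.
    apply: filterS (near_cone sysA ncx) => y ny vy ty _.
    by apply: ny; rewrite -hf; exists y => //; exact: faceT.
  have fx : gen_face s y0 x.
    by move: cx; rewrite -hf => -[x' fx' /(congr1 (act (invmx h)))]; rewrite !actK // => <-.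
  have [ax ex] := cfE x fx x0.
  have Vx : V (chart A (cf x)).
    by rewrite -ex; apply: contrapT => nV; apply: nCx; split => //; rewrite ex; exact: chart_mem.
  have cfc : cf @ x --> cf x.
    apply: (@cvg_mx R _ (nbhs x) _ _ cf (cf x) _) => i j.
    have cl : continuous (fun y => trform (coord sysA j) (act h y)).
      by apply: continuous_scalar => r y z; rewrite actD actZ linearP.
    rewrite [X in _ --> X]mxE.
    have -> : (fun y => cf y i j) = fun y => trform (coord sysA j) (act h y).
      by apply/funext => y; rewrite mxE.
    exact: cl.
  have near_V := cfc _ (Vnear _ _ _ gA ax Vx).
  have {}near_V : \forall y \near x, admissible (cf y) -> V (chart A (cf y)) by exact: near_V.
  apply: filterS near_V => y Vy vy ty [_].
  have [_ _ yn0] := vy; have [ay ey'] := cfE y (faceT y vy ty) yn0.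
  by rewrite ey' => nV; apply: nV; exact: Vy.
- by move: sx; rewrite s0.
Unshelve. all: by end_near. Qed.

End Charts.

(** * Construction and continuity of the contraction *)

Section Contraction.
Variables (R : realType) (g : nat) (xi0 : LAtrop R g).
Hypothesis g0 : (0 < g)%N.
Local Notation link_point := (@link_point R g xi0).
Local Notation X := (coloop_subcomplex R g).
Local Notation chart := (chart xi0).

Hypothesis charts_cover : forall xi, X xi ->
  exists m (A : 'M[int]_(g, m)) (a : 'rV[R]_m),
    [/\ coloop_system R A, admissible a & xi = chart A a].

Lemma set_valE (x : set_type X) : X (set_val x).
Proof. by case: x => x xX /=; exact: set_mem. Qed.

Lemma set_val_inj (x y : set_type X) : set_val x = set_val y -> x = y.
Proof. by move=> e; apply: val_inj. Qed.

(** Required for all charts and all dominant bases, so that [H] may be computed with any of them;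
    nothing is prescribed outside [0, 1]. *)
Definition is_contraction (H : set_type X * R -> set_type X) := forall x u, 0 <= u <= 1 ->
  forall m (A : 'M[int]_(g, m)) a beta, coloop_system R A -> admissible a -> basis A beta ->
  dominant A beta (weights a) -> set_val x = chart A a ->
  set_val (H (x, u)) = link_point (cone A (full m)) (flow A beta (weights a) u).

Lemma contraction_exists : exists H, is_contraction H.
Proof.
suff /choice[H HP] (p : set_type X * R) : exists y : set_type X, 0 <= p.2 <= 1 ->
    forall m (A : 'M[int]_(g, m)) a beta, coloop_system R A -> admissible a -> basis A beta ->
    dominant A beta (weights a) -> set_val p.1 = chart A a ->
    set_val y = link_point (cone A (full m)) (flow A beta (weights a) p.2).
  by exists H => x u u01 m A a beta gA aa ub db e; rewrite (HP (x, u) u01 m A a beta).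
case: p => x u /=; have [u01|_] := boolP (0 <= u <= 1); last by exists x.
have [m [A [a [gA aa e]]]] := charts_cover (set_valE x).
have [beta [ub db]] := dominant_basis_exists (coloop_system_unimodular gA) (weights a).
exists (set_type_elt (mem_coloop_subcomplex xi0 gA (flow_valid g0 gA aa ub u01))).
move=> _ n B b gam gB ab ugam dgam e'.
by apply: (chart_eq_flow g0) => //; rewrite -e -e'.
Qed.

Lemma contraction_start H x : is_contraction H -> H (x, 0) = x.
Proof.
move=> HP; apply: set_val_inj.
have [m [A [a [gA aa e]]]] := charts_cover (set_valE x).
have [beta [ub db]] := dominant_basis_exists (coloop_system_unimodular gA) (weights a).
rewrite (HP _ _ _ m A a beta) //; last by rewrite lexx ler01.
by rewrite flow_start ?e //; case: aa.
Qed.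

Lemma max_weight_gt0 m (a : 'rV[R]_m) : admissible a -> 0 < max_weight (weights a).
Proof.
move=> [a0 [k ak]]; apply: lt_le_trans (le_bigmax_cond _ _ (erefl : predT k)).
by rewrite lt_def ak a0.
Qed.

Lemma contraction_end H x m (A : 'M[int]_(g, m)) beta : is_contraction H ->
  coloop_system R A -> basis A beta ->
  set_val (H (x, 1)) = link_point (cone A (full m)) (\sum_i sq R (col (beta i) A)).
Proof.
move=> HP gA ub.
have [n [B [b [gB ab e]]]] := charts_cover (set_valE x).
have [gam [ugam dgam]] := dominant_basis_exists (coloop_system_unimodular gB) (weights b).
have u01 : 0 <= (1 : R) <= (1 : R) by rewrite ler01 lexx.
rewrite (HP _ _ u01 n B b gam) //.
have v := flow_valid g0 gB ab ugam u01.
have t0 := max_weight_gt0 ab; rewrite flow_end in v *.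
have vs : valid (cone B (full n)) (\sum_i sq R (col (gam i) B)).
  rewrite -[\sum_i _](scale1r) -(mulVf (lt0r_neq0 t0)) -scalerA.
  by apply: valid_scale => //; rewrite invr_gt0.
rewrite link_point_scale //; apply: (basis_center xi0 g0
  (coloop_system_unimodular gB) (coloop_system_unimodular gA)) => //.
by case: vs.
Qed.

(** Dominance is a closed condition, so near [a] only bases dominant at [a] can be dominant. *)
Lemma near_dominant m (A : 'M[int]_(g, m)) beta (a : 'rV[R]_m) :
  ~ dominant A beta (weights a) -> \forall b \near a, ~ dominant A beta (weights b).
Proof.
move=> /existsNP[i /existsNP[k /not_implyP[ik /negP]]]; rewrite -ltNge => lt_a.
have c : continuous (fun b : 'rV[R]_m => weights b (beta i) - weights b k).
  by apply: continuous_subr; apply: continuous_weights => x; exact: cvg_id.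
have : weights a (beta i) - weights a k < 0 by rewrite subr_lt0.
move=> /(near_lt0 c); apply: filterS => b; rewrite subr_lt0 => lt_b dom.
by have := dom i k ik; rewrite leNgt lt_b.
Qed.

Lemma link_point_flow_near m (A : 'M[int]_(g, m)) beta (a : 'rV[R]_m) u (U : set (LAtrop R g)) :
  coloop_system R A -> admissible a -> basis A beta -> 0 <= u <= 1 -> open U ->
  U (link_point (cone A (full m)) (flow A beta (weights a) u)) ->
  \forall p \near (a, u), admissible p.1 -> 0 <= p.2 <= 1 ->
    U (link_point (cone A (full m)) (flow A beta (weights p.1) p.2)).
Proof.
move=> gA aa ub u01 oU Uu.
have h := (LAtrop_openP xi0 U).1 oU _ _ (flow_valid g0 gA aa ub u01) Uu.
have h2 : \forall p \near (a, u), valid (cone A (full m)) (flow A beta (weights p.1) p.2) ->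
    U (link_point (cone A (full m)) (flow A beta (weights p.1) p.2)).
  exact: (@continuous_flow R g m A beta (a, u) _ h).
by apply: filterS h2 => p Hp ap p01; apply: Hp; exact: flow_valid.
Qed.

(** [charts_final] concerns the subcomplex and not its product with the interval. So time is first
    confined to a compact interval [J], and the points whose path over all of [J] stays in [U] are
    shown to form an open set. *)
Lemma contraction_continuous H : is_contraction H ->
  {within [set: set_type X] `*` `[0, 1], continuous H}.
Proof.
move=> HP; apply/subspace_continuousP => -[x0 u0] [_ /= u0I] W.
move=> HW; have : nbhs (H (x0, u0)) W by exact: HW.
rewrite nbhsE => -[W' [/set_type_openP[U oU <-] /= UH] sW].
rewrite in_itv /= in u0I.
have [m [A [a [gA aa e]]]] := charts_cover (set_valE x0).
have [beta [ub db]] := dominant_basis_exists (coloop_system_unimodular gA) (weights a).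
have Uu0 : U (link_point (cone A (full m)) (flow A beta (weights a) u0)).
  by rewrite -(HP x0 u0 u0I m A a beta).
have [e0 e0_gt0 He0] : exists2 e0 : R, 0 < e0 & forall u, `|u - u0| <= e0 -> 0 <= u <= 1 ->
    U (link_point (cone A (full m)) (flow A beta (weights a) u)).
  have := link_point_flow_near gA aa ub u0I oU Uu0 => -[[N1 N2]] /= [N1a N2u] sN.
  have [r /= r0 br] := (nbhs_ballP u0 N2).1 N2u.
  exists (r / 2) => [|u uu u01]; first by rewrite divr_gt0.
  apply: (sN (a, u)) => //; split => /=; first exact: nbhs_singleton.
  apply: br; rewrite /ball /= distrC (le_lt_trans uu) // ltr_pdivrMr //.
  by rewrite ltr_pMr // ltr1n.
pose J : set R := `[Num.max 0 (u0 - e0), Num.min 1 (u0 + e0)]%classic.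
have JP u : J u <-> 0 <= u <= 1 /\ `|u - u0| <= e0.
  rewrite /J /= in_itv /= ge_max le_min ler_distl.
  split; first by move=> /andP[/andP[-> ->] /andP[-> ->]].
  by move=> [/andP[-> ->] /andP[-> ->]].
pose V := [set xi | exists2 x : set_type X, set_val x = xi &
   forall u, J u -> U (set_val (H (x, u)))].
have VX : V `<=` X by move=> xi [x <- _]; exact: set_valE.
have V0 : V (set_val x0).
  by exists x0 => // u /JP[u01 uu]; rewrite (HP _ _ u01 m A a beta) //; exact: He0.
have [N oN VN] : exists2 N, open N & V = N `&` X.
  apply: (charts_final g0 charts_cover VX) => n B b gB ab [x xb Jx].
  (* The dominant basis may vary near [b], but there are finitely many candidates: those not
     dominant at [b] drop out nearby, and for the others compactness of [J] gives a uniform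
     neighbourhood. *)
  have near_b (gam : {ffun 'I_g -> 'I_n}) : \forall b' \near b,
      admissible b' -> basis B gam -> dominant B gam (weights b') ->
      forall u, J u -> U (link_point (cone B (full n)) (flow B gam (weights b') u)).
    have [ugam|nug] := boolP (basis B gam); last first.
      have h0 : \forall b' \near b, True by exact: (@filterE _ (nbhs b)).
      by apply: filterS h0 => b' _ _.
    have [dgam|ndg] := pselect (dominant B gam (weights b)); last first.
      by apply: filterS (near_dominant ndg) => b' nd _ _ /nd.
    have cJ : compact J by exact: segment_compact.
    have cov := (compact_near_coveringP J).1 cJ.
    pose P (b' : 'rV[R]_n) (u : R) := admissible b' -> 0 <= u <= 1 ->
       U (link_point (cone B (full n)) (flow B gam (weights b') u)).
    have : \forall b' \near b, J `<=` P b'.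
      apply: (cov _ (nbhs b) P) => u Ju; have [u01 _] := (JP u).1 Ju.
      have Uu : U (link_point (cone B (full n)) (flow B gam (weights b) u)).
        by rewrite -(HP x u u01 n B b gam) //; exact: Jx.
      have := link_point_flow_near gB ab ugam u01 oU Uu => -[[N1 N2]] /= [N1b N2u] sN.
      exists (N2, N1) => //= -[u' b'] /= [h1 h2]; exact: (sN (b', u')).
    apply: filterS => b' JPb ab' _ _ u Ju; apply: JPb => //.
    by have [] := (JP u).1 Ju.
  have : \forall b' \near b, forall gam : {ffun 'I_g -> 'I_n},
      admissible b' -> basis B gam -> dominant B gam (weights b') ->
      forall u, J u -> U (link_point (cone B (full n)) (flow B gam (weights b') u)).
    exact: (@filter_forall _ _ (fun (gam : {ffun 'I_g -> 'I_n}) b' => admissible b' ->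
      basis B gam -> dominant B gam (weights b') -> forall u, J u ->
      U (link_point (cone B (full n)) (flow B gam (weights b') u))) (nbhs b) _ near_b).
  apply: filterS => b' hb ab'.
  have [gam [ugam dgam]] := dominant_basis_exists (coloop_system_unimodular gB) (weights b').
  exists (set_type_elt (chart_mem xi0 g0 gB ab')) => // u Ju; have [u01 _] := (JP u).1 Ju.
  by rewrite (HP _ _ u01 n B b' gam) //; exact: (hb gam).
have nx0 : nbhs x0 (set_val @^-1` N).
  apply: open_nbhs_nbhs; split; first by apply/set_type_openP; exists N.
  by have : V (set_val x0) by []; rewrite VN => -[].
have nu0 : nbhs u0 [set u | `|u - u0| < e0].
  by apply/nbhs_ballP; exists e0 => //= u; rewrite /ball /= distrC.
exists (set_val @^-1` N, [set u | `|u - u0| < e0]) => //=.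
move=> [x u] /= [Nx ue] [_ uI]; apply: sW; rewrite /= in_itv /= in uI.
have : V (set_val x) by rewrite VN; split => //; exact: set_valE.
move=> [x' /set_val_inj -> hx]; apply: hx; apply/JP; split=> //.
exact: ltW.
Qed.

Lemma contractible_of_charts :
  (exists m (A : 'M[int]_(g, m)), coloop_system R A) -> contractible R (set_type X).
Proof.
move=> [m [A gA]]; have [H HP] := contraction_exists.
have [beta ub] := basis_exists (coloop_system_unimodular gA).
have a1 : admissible (const_mx 1 : 'rV[R]_m).
  split=> [k|]; first by rewrite /weights mxE ler01.
  by exists (beta (Ordinal g0)); rewrite /weights mxE oner_eq0.
pose x := set_type_elt (chart_mem xi0 g0 gA a1).
exists (H (x, 1)), H; split.
- exact: contraction_continuous.
- by move=> y; exact: contraction_start.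
- by move=> y; apply: set_val_inj; rewrite !(contraction_end _ HP gA ub).
Qed.

End Contraction.

(** * Matroids and representations *)

Section KernelFree.
Variables (F : fieldType) (d n : nat) (A : 'M[F]_(d, n)).

Definition kernel_free (S : {set 'I_n}) : Prop :=
  forall x : 'cV[F]_n, (forall j, j \notin S -> x j 0 = 0) -> A *m x = 0 -> x = 0.

Lemma mulmx_sum_cols (x : 'cV[F]_n) : A *m x = \sum_j x j 0 *: col j A.
Proof.
apply/colP => i; rewrite mxE summxE; apply: eq_bigr => j _.
by rewrite !mxE mulrC.
Qed.

Lemma free_kernel (S : {set 'I_n}) :
  free [seq col j A | j in S] <-> kernel_free S.
Proof.
have szE : size [seq col j A | j in S] == #|S| by rewrite size_map -cardE.
have nthE (i : 'I_#|S|) : (Tuple szE)`_i = col (enum_val i) A.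
  rewrite /= (nth_map (enum_val i)); last by rewrite -cardE.
  by rewrite -(enum_val_nth (enum_val i)).
split=> [fr x xS Ax|kf].
  apply/colP => j; rewrite [RHS]mxE; have [jS|/xS//] := boolP (j \in S).
  have /freeP := fr : free (Tuple szE); move=> /(_ (fun i => x (enum_val i) 0)).
  move=> /(_ _ (enum_rank_in jS j)); rewrite enum_rankK_in //; apply.
  rewrite -[RHS]Ax mulmx_sum_cols (bigID (mem S)) /= [X in _ = _ + X]big1 ?addr0.
    rewrite [RHS]big_enum_val; apply: eq_bigr => i _; by rewrite nthE.
  by move=> k /xS ->; rewrite scale0r.
apply/(@freeP _ _ _ (Tuple szE)) => c c0 i.
pose x : 'cV[F]_n := \col_j (if j \in S =P true is ReflectT jS then c (enum_rank_in jS j) else 0).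
have xE k : x (enum_val k) 0 = c k.
  rewrite mxE; case: eqP => [jS|]; last by rewrite enum_valP.
  by rewrite enum_valK_in.
suff x0 : x = 0 by rewrite -xE x0 mxE.
apply: kf => [j jS|].
  by rewrite mxE; case: eqP => // h; rewrite h in jS.
rewrite mulmx_sum_cols (bigID (mem S)) /= [X in _ + X]big1 ?addr0; last first.
  by move=> j jS; rewrite mxE; case: eqP => [h|_]; [rewrite h in jS|rewrite scale0r].
rewrite big_enum_val -[RHS]c0; apply: eq_bigr => k _; by rewrite xE nthE.
Qed.

Lemma card_kernel_free (S : {set 'I_n}) : kernel_free S -> (#|S| <= d)%N.
Proof.
move=> /free_kernel; rewrite /free size_map -cardE => /eqP <-.
by apply: leq_trans (dimvS (subvf _)) _; rewrite dimvf /dim /= muln1.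
Qed.

Lemma kernel_freeS (S T : {set 'I_n}) : S \subset T -> kernel_free T -> kernel_free S.
Proof.
move=> /fintype.subsetP ST kf x xS; apply: kf => j jT; apply: xS.
by apply: contra jT; exact: ST.
Qed.

(** Every dependent set contains a circuit, so agreement on circuits is agreement on independent
    sets. *)
Lemma represents_kernel (M : matroid 'I_n) :
  represents A M <-> forall S, indep M S <-> kernel_free S.
Proof.
split=> [rep S|h C]; last first.
  apply: minset_eq => S; apply/negP/negP => e fr; apply: e.
    exact/h/free_kernel.
  exact/free_kernel/h.
split.
  move=> iS; apply/free_kernel; apply: contraT => nfr.
  have [C Cmin CS] := minset_exists (P := fun S => ~~ free [seq col j A | j in S]) nfr.
  have : circuit M C by rewrite rep.
  by move=> /minsetp; rewrite (indepS CS).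
move=> kf; apply: contraT => nin.
have [C Cmin CS] := minset_exists (P := fun S => ~~ indep M S) nin.
have := rep C; rewrite /circuit Cmin => /esym/minsetp.
suff -> : free [seq col j A | j in C] by [].
by apply/free_kernel; apply: kernel_freeS kf.
Qed.

End KernelFree.

Lemma simple_small n (M : matroid 'I_n) :
  simple_matroid M <-> forall S : {set 'I_n}, (#|S| <= 2)%N -> indep M S.
Proof.
split=> [sM S S2|h C /minsetp Cdep]; last first.
  by split; apply/eqP => e; move: Cdep; rewrite h // e.
apply: contraT => nin.
have [C Cmin CS] := minset_exists (P := fun S => ~~ indep M S) nin.
have [C1 C2] := sM C Cmin; have := minsetp Cmin.
have C3 : (#|C| <= 2)%N := leq_trans (subset_leq_card CS) S2.
have /cards0_eq -> : #|C| = 0%N by move: C1 C2 C3; case: #|C| => [|[|[|]]].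
by rewrite indep0.
Qed.

Section MatroidLemmas.
Variables (n : nat) (M : matroid 'I_n).

Definition old_part (S : {set 'I_(n + 1)}) : {set 'I_n} := [set j | lshift 1 j \in S]%SET.
Definition new_elt : 'I_(n + 1) := rshift n ord0.

Lemma card_old_part (S : {set 'I_(n + 1)}) : #|S| = (#|old_part S| + (new_elt \in S))%N.
Proof.
rewrite -!sum1_card (big_mkcond (mem S)) /= big_split_ord /= big_ord1 -big_mkcond /=.
congr (_ + _)%N.
by apply: eq_bigl => j; rewrite inE.
Qed.

Lemma new_or_old (e : 'I_(n + 1)) : e = new_elt \/ exists j, e = lshift 1 j.
Proof.
case: (splitP e) => j ej; [right; exists j|left]; apply: val_inj => //=.
by rewrite ej; case: j ej => -[].
Qed.

Lemma old_partU j (S : {set 'I_(n + 1)}) : old_part (lshift 1 j |: S) = j |: old_part S.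
Proof. by apply/setP => k; rewrite !inE (inj_eq (@lshift_inj _ _)). Qed.

Lemma old_partU_new (S : {set 'I_(n + 1)}) : old_part (new_elt |: S) = old_part S.
Proof. by apply/setP => k; rewrite !inE eq_lrshift. Qed.

Lemma old_partS (S T : {set 'I_(n + 1)}) : S \subset T -> old_part S \subset old_part T.
Proof. by move=> /fintype.subsetP h; apply/fintype.subsetP => j; rewrite !inE; exact: h. Qed.

Lemma coloop_ext_aug (I J : {set 'I_(n + 1)}) :
  indep M (old_part I) -> indep M (old_part J) -> (#|I| < #|J|)%N ->
  exists2 e, e \in (J :\: I)%SET & indep M (old_part (e |: I)%SET).
Proof.
move=> iI iJ; rewrite !card_old_part => lt_IJ.
have [|new] := boolP (new_elt \in J :\: I)%SET.
  by exists new_elt => //; rewrite old_partU_new.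
have [|e eJI ie] := indep_aug iI iJ.
  by move: new lt_IJ; rewrite !inE; case: (new_elt \in I); case: (new_elt \in J) => //=; lia.
exists (lshift 1 e); last by rewrite old_partU.
by move: eJI; rewrite !inE.
Qed.

Lemma coloop_ext_indep0 : indep M (old_part finset.set0).
Proof.
suff -> : old_part finset.set0 = finset.set0 by exact: indep0.
by apply/setP => j; rewrite !inE.
Qed.

(** Direct sum of [M] with a single coloop. *)
Definition coloop_ext : matroid 'I_(n + 1) :=
  @Matroid _ (fun S => indep M (old_part S)) coloop_ext_indep0
    (fun I J IJ iJ => indepS (old_partS IJ) iJ) coloop_ext_aug.

Lemma coloop_ext_simple : simple_matroid M -> simple_matroid coloop_ext.
Proof.
move=> /simple_small sM; apply/simple_small => S S2; apply: sM.
by apply: leq_trans S2; rewrite card_old_part leq_addr.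
Qed.

Lemma coloop_ext_coloop : coloop coloop_ext new_elt.
Proof.
move=> C Cc; apply/negP => nC; have dC := minsetp Cc.
have := minsetinf Cc (_ : (fun S => ~~ indep coloop_ext S) (C :\ new_elt)%SET).
have e : old_part (C :\ new_elt) = old_part C.
  by apply/setP => j; rewrite !inE eq_lrshift.
move=> /(_ _ (subD1set _ _)) h.
have : new_elt \in (C :\ new_elt)%SET by rewrite h //= e.
by rewrite !inE eqxx.
Qed.

Lemma coloop_ext_rank : (matroid_rank M < matroid_rank coloop_ext)%N.
Proof.
have [S iS ->] : exists2 S, indep M S & matroid_rank M = #|S|.
  have [|S ? ?] := @eq_bigmax_cond _ [pred S | indep M S] (fun S : {set 'I_n} => #|S|).
    by apply/card_gt0P; exists finset.set0; rewrite inE indep0.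
  by exists S.
pose S' := (new_elt |: [set lshift 1 j | j in S])%SET.
have S'o : old_part S' = S.
  apply/setP => j; rewrite !inE eq_lrshift /=; apply/imsetP/idP => [[k kS /lshift_inj ->]//|jS].
  by exists j.
have S'c : #|S'| = #|S|.+1.
  have new : new_elt \in S' by rewrite !inE eqxx.
  rewrite card_old_part S'o new; exact: addn1.
rewrite -S'c /matroid_rank.
have iS' : indep coloop_ext S' by rewrite /= S'o.
exact: (@leq_bigmax_cond _ (fun T : {set 'I_(n + 1)} => indep coloop_ext T) (fun T => #|T|) S').
Qed.

Lemma coloop_ext_represents (F : fieldType) d d' (A : 'M[F]_(d, n)) (A' : 'M[F]_(d', n + 1)) :
  (forall x : 'cV[F]_(n + 1), A' *m x = 0 <-> A *m usubmx x = 0 /\ x new_elt 0 = 0) ->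
  represents A M -> represents A' coloop_ext.
Proof.
move=> AA' /represents_kernel rep; apply/represents_kernel => S /=; rewrite rep.
split=> kf x xS.
  move=> /AA'[Ax x0]; have u0 : usubmx x = 0.
    by apply: kf => // j jS; rewrite mxE xS //; move: jS; rewrite inE.
  apply/colP => e; rewrite [RHS]mxE; have [->//|[j ->]] := new_or_old e.
  by have := congr1 (fun y : 'cV_n => y j 0) u0; rewrite !mxE.
move=> Ax; pose y : 'cV[F]_(n + 1) := col_mx x 0.
have : y = 0.
  apply: kf => [e eS|].
    have [->|[j ej]] := new_or_old e; first by rewrite /y col_mxEd mxE.
    by rewrite ej /y col_mxEu xS // inE -ej.
  by apply/AA'; rewrite /y col_mxKu col_mxEd mxE.
by move=> y0; rewrite -[x](@col_mxKu _ _ _ _ x (0 : 'cV[F]_1)) -/y y0 linear0.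
Qed.

Lemma coloop_ext_regular : regular M -> regular coloop_ext.
Proof.
move=> rM F; have [d [A rep]] := rM F.
exists (d + 1)%N, (block_mx A 0 0 1%:M); apply: coloop_ext_represents rep => x.
rewrite -{1}[x]vsubmxK mul_block_col !mul0mx addr0 add0r mul1mx.
have dE : dsubmx x = 0 <-> x new_elt 0 = 0.
  split=> [/(congr1 (fun y : 'cV_1 => y ord0 0))|e]; first by rewrite !mxE.
  by apply/colP => i; rewrite !mxE ord1.
split=> [e|[-> /dE ->]]; last by rewrite col_mx0.
have /eq_col_mx[h1 /dE h2] : col_mx (A *m usubmx x) (dsubmx x) = col_mx 0 0 by rewrite e col_mx0.
by [].
Qed.

End MatroidLemmas.

(** The support of a kernel vector is dependent and contains a circuit, which avoids [e].
    Subtracting a multiple of a kernel vector supported on that circuit shrinks the support without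
    changing the entry at [e]. *)
Lemma coloop_kernel (F : fieldType) d n (A : 'M[F]_(d, n)) (M : matroid 'I_n) e :
  represents A M -> coloop M e -> forall x : 'cV[F]_n, A *m x = 0 -> x e 0 = 0.
Proof.
move=> /represents_kernel rep col x Ax; apply: contrapT => /eqP xe.
have [m] := ubnP #|[set j | x j 0%R != 0%R]%SET|.
elim: m x Ax xe => // m IH x Ax xe; rewrite ltnS => le_m.
have nin : ~~ indep M [set j | x j 0%R != 0%R]%SET.
  apply/negP => /rep kf; case/eqP: xe; rewrite (kf x) ?mxE // => j.
  by rewrite inE negbK => /eqP.
have [C Cc CS] := minset_exists (P := fun S => ~~ indep M S) nin.
have eC := col C Cc.
have /existsNP[y] : ~ kernel_free A C by move=> /rep; apply/negP; exact: (minsetp Cc).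
move=> /not_implyP[yC /not_implyP[Ay y0]].
have [k yk] : exists k, y k 0 != 0.
  apply: contrapT => h; apply: y0; apply/colP => j; rewrite [RHS]mxE.
  by apply/eqP/negPn/negP => yj; apply: h; exists j.
have kC : k \in C by apply: contraT => /yC /eqP; rewrite (negbTE yk).
have xk : x k 0 != 0 by move/fintype.subsetP: CS => /(_ k kC); rewrite inE.
pose x' := x - (x k 0 / y k 0) *: y.
have x'e : x' e 0 = x e 0 by rewrite !mxE (yC e eC) mulr0 subr0.
apply: (IH x').
- by rewrite mulmxBr -scalemxAr Ax Ay scaler0 subr0.
- by rewrite x'e.
- apply: leq_trans le_m; apply: proper_card; apply/properP; split.
    apply/fintype.subsetP => j; rewrite !inE; apply: contra => /eqP xj.
    rewrite !mxE xj; have [jC|/yC ->] := boolP (j \in C); last by rewrite mulr0 subr0.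
    by move/fintype.subsetP: CS => /(_ j jC); rewrite inE xj eqxx.
  exists k; rewrite inE //.
  by rewrite !mxE divfK // subrr eqxx.
Qed.

(** The unit row at [e] is orthogonal to the kernel by [coloop_kernel], hence lies in the row
    space. *)
Lemma coloop_functional (F : fieldType) d n (A : 'M[F]_(d, n)) (M : matroid 'I_n) e :
  represents A M -> coloop M e -> exists z : 'rV[F]_d, forall j, (z *m A) 0 j = (j == e)%:R.
Proof.
move=> rep col; have /submxP[z zE] : ((delta_mx 0 e : 'rV[F]_n) <= A)%MS.
  rewrite submxE -rowE; apply/eqP/rowP => j; rewrite [LHS]mxE [RHS]mxE.
  have Ax : A *m (cokermx A *m (delta_mx j 0 : 'cV[F]_n)) = 0 by rewrite mulmxA mulmx_coker mul0mx.
  by have := coloop_kernel rep col Ax; rewrite -colE [LHS]mxE.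
by exists z => j; rewrite -zE mxE eqxx.
Qed.

Lemma col_mulmx (K : pzRingType) p q n (h : 'M[K]_(p, q)) (Z : 'M[K]_(q, n)) k :
  col k (h *m Z) = h *m col k Z.
Proof. by apply/colP => i; rewrite !mxE; apply: eq_bigr => j _; rewrite !mxE. Qed.

Lemma enum_val_lt n (T : {set 'I_n}) :
  {homo (@enum_val _ (mem T)) : i j / (i < j)%N}.
Proof.
have sE : sorted (relpre val ltn) (enum T).
  rewrite {1}/enum_mem -enumT; apply: sorted_filter; first by move=> ? ? ?; exact: ltn_trans.
  by rewrite -sorted_map val_enum_ord iota_ltn_sorted.
move=> i j ij; rewrite (enum_val_nth (enum_val i)) [in X in (_ < X)%N](enum_val_nth (enum_val i)).
apply: (sorted_ltn_nth (leT := relpre val ltn) _ _ sE) => //.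
- by move=> ? ? ?; exact: ltn_trans.
- by rewrite inE -cardE.
- by rewrite inE -cardE.
Qed.

(** * From totally unimodular matrices to unimodular systems *)

Section TotallyUnimodular.
Variables (R : realType) (g : nat).

Lemma real_of_int_inv (E : 'M[int]_g) : E \in unitmx ->
  real_of_int R (invmx E) = invmx (real_of_int R E).
Proof.
move=> uE; have uER := real_of_int_unit R uE.
rewrite -[LHS](mulmxK uER) -[RHS]mul1mx; congr (_ *m _).
by rewrite /real_of_int -map_mxM mulVmx // map_mx1.
Qed.

Lemma tu_entry n (A : 'M[R]_(g, n)) i j : totally_unimodular A ->
  [\/ A i j = -1, A i j = 0 | A i j = 1].
Proof.
move=> /(_ 1%N (fun=> i) (fun=> j)); rewrite det_mx11 mxE; apply.
  by move=> x y; rewrite !ord1.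
by move=> x y; rewrite !ord1.
Qed.

Lemma tu_integral n (A : 'M[R]_(g, n)) : totally_unimodular A ->
  exists Z : 'M[int]_(g, n), A = real_of_int R Z.
Proof.
move=> tuA; have /choice[f fP] (p : 'I_g * 'I_n) : exists z : int, A p.1 p.2 = z%:~R.
  by case: (tu_entry p.1 p.2 tuA) => ->; [exists (-1)|exists 0|exists 1].
exists (\matrix_(i, j) f (i, j)); apply/matrixP => i j.
by rewrite !mxE; exact: (fP (i, j)).
Qed.

(** Choose [g] spanning columns in [S] and list them in increasing order, as total unimodularity
    demands. Their determinant is nonzero, hence 1 or -1, and the integral inverse recovers [y] from
    its integral values. *)
Lemma tu_unimod n (Z : 'M[int]_(g, n)) : totally_unimodular (real_of_int R Z) ->
  unimod R Z.
Proof.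
move=> tuZ S y sp yS.
have fA : row_full (real_of_int R (colsub (@enum_val _ (mem S)) Z))^T.
  rewrite /row_full mxrank_tr -/(row_free _) -kermx_eq0.
  apply/eqP/row_matrixP => i; rewrite row0; apply: (spans_colsub sp) => k _.
  by rewrite dot_col -row_mul mulmx_ker row0 mxE.
pose f i := enum_val (fullrankfun fA i) : 'I_n.
have f_inj : injective f by move=> i j /enum_val_inj /fullrankfun_inj.
have f_spans (z : 'rV[R]_g) : (forall i, dot z (col (f i) Z) = 0) -> z = 0.
  move=> hz; have uF : rowsub (fullrankfun fA) (real_of_int R (colsub (@enum_val _ (mem S)) Z))^T \in unitmx.
    by rewrite -row_full_unit; exact: fullrowsub_full.
  have : z *m (rowsub (fullrankfun fA) (real_of_int R (colsub (@enum_val _ (mem S)) Z))^T)^T = 0.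
    apply/rowP => i; rewrite [RHS]mxE -(hz i) /dot !mxE.
    by apply: eq_bigr => j _; rewrite !mxE.
  move=> /(congr1 (mulmx^~ (invmx (rowsub (fullrankfun fA) (real_of_int R (colsub (@enum_val _ (mem S)) Z))^T)^T))).
  by rewrite mul0mx mulmxK // unitmx_tr.
pose T := [set f i | i in 'I_g]%SET.
have cT : #|T| = g by rewrite card_imset // card_ord.
pose e i : 'I_n := enum_val (cast_ord (esym cT) i).
have e_lt : {homo e : i j / (i < j)%N} by move=> i j ij; apply: enum_val_lt.
have eS i : e i \in S.
  by have /imsetP[j _ ej] := enum_valP (cast_ord (esym cT) i); rewrite /e ej; exact: enum_valP.
have e_spans (z : 'rV[R]_g) : (forall i, dot z (col (e i) Z) = 0) -> z = 0.
  move=> hz; apply: f_spans => i; have fT : f i \in T by exact: imset_f.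
  by have := hz (cast_ord cT (enum_rank_in fT (f i))); rewrite /e cast_ordK enum_rankK_in.
pose E := colsub e Z.
have detE : \det (real_of_int R E) != 0.
  rewrite -unitfE -unitmxE -row_free_unit -kermx_eq0.
  apply/eqP/row_matrixP => i; rewrite row0; apply: e_spans => k.
  by rewrite -col_colsub dot_col -row_mul mulmx_ker row0 mxE.
have dE : (\det E == 1) || (\det E == -1).
  have idh : {homo (fun i : 'I_g => i) : i j / (i < j)%N} by [].
  have := tuZ g (fun i => i) e idh e_lt.
  have -> : mxsub (fun i => i) e (real_of_int R Z) = real_of_int R E.
    by apply/matrixP => i j; rewrite !mxE.
  rewrite /real_of_int det_map_mx in detE *; case=> [|h|].
  - by rewrite -[-1](_ : (-1)%:~R = _) // => /intr_inj ->; rewrite eqxx orbT.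
  - by rewrite h eqxx in detE.
  - by rewrite -[1](_ : 1%:~R = _) // => /intr_inj ->.
have uE : E \in unitmx.
  by rewrite unitmxE; case/orP: dE => /eqP ->; rewrite ?unitrN unitr1.
have /choice[w wP] i : exists z : int, dot y (col (e i) Z) = z%:~R.
  by have /intrP[z ->] := yS _ (eS i); exists z.
exists ((\row_i w i) *m invmx E); rewrite /real_of_int map_mxM -/(real_of_int R (invmx E)) real_of_int_inv //.
have uER : real_of_int R E \in unitmx := real_of_int_unit R uE.
rewrite -[LHS](mulmxK uER); congr (_ *m _); apply/rowP => i.
have -> : map_mx intr (\row_i w i) 0 i = (w i)%:~R :> R by rewrite !mxE.
by rewrite -wP -col_colsub dot_col.
Qed.

Lemma tu_primitive n (Z : 'M[int]_(g, n)) : totally_unimodular (real_of_int R Z) ->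
  (forall k, col k Z != 0) -> primitive_cols Z.
Proof.
move=> tuZ Z0 k; have [i ik] : exists i, Z i k != 0.
  apply: contrapT => /forallNP h; case/eqP: (Z0 k); apply/colP => i.
  by rewrite !mxE; apply/eqP/negPn/negP/h.
have dE c : idot (c *: delta_mx 0 i) (col k Z) = c * Z i k.
  by rewrite /idot -scalemxAl -rowE !mxE.
have := tu_entry i k tuZ; rewrite mxE; case.
- rewrite -[-1](_ : (-1)%:~R = _) // => /intr_inj e.
  by exists ((-1) *: delta_mx 0 i); rewrite dE e mulrNN mulr1.
- by move=> /eqP; rewrite intr_eq0 (negbTE ik).
- rewrite -[1](_ : 1%:~R = _) // => /intr_inj e.
  by exists (1 *: delta_mx 0 i); rewrite dE e mulr1.
Qed.

Lemma system_act m (A : 'M[int]_(g, m)) h : h \in unitmx ->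
  unimodular_system R A -> unimodular_system R (h *m A).
Proof.
move=> uh sysA; have uhR := real_of_int_unit R uh; split.
- move=> z hz; suff : z *m real_of_int R h = 0.
    by move=> /(congr1 (mulmx^~ (invmx (real_of_int R h)))); rewrite mul0mx mulmxK.
  by apply: (sys_spans sysA) => k kS; rewrite -dot_mul -col_mulmx; exact: hz.
- move=> S y sp yS.
  have [||y' yE] := sys_unimod sysA (S := S) (y := y *m real_of_int R h).
  + move=> z hz; suff : z *m invmx (real_of_int R h) = 0.
      by move=> /(congr1 (mulmx^~ (real_of_int R h))); rewrite mul0mx mulmxKV.
    by apply: sp => k kS; rewrite col_mulmx dot_mul mulmxKV // hz.
  + by move=> k kS; rewrite -dot_mul -col_mulmx; exact: yS.
  + exists (y' *m invmx h); rewrite -[y](mulmxK uhR) yE /real_of_int map_mxM.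
    by congr (_ *m _); rewrite -/(real_of_int R (invmx h)) real_of_int_inv.
- move=> k; have [y yk] := sys_primitive sysA k; exists (y *m invmx h).
  by rewrite col_mulmx idot_mul mulmxKV.
- move=> k l /(sys_distinct sysA)[n1 n2]; rewrite !col_mulmx; split=> e.
    by apply: n1; rewrite -[LHS](mulKmx uh) e mulKmx.
  by apply: n2; rewrite -[LHS](mulKmx uh) e mulmxN mulKmx.
Qed.

(** Columns are selected in increasing order, so the new one can only come last; expanding along it
    leaves 0 or a signed minor of [A]. *)
Lemma tu_unit_ext n (A : 'M[R]_(g, n)) i0 : totally_unimodular A ->
  totally_unimodular (row_mx A (delta_mx i0 0 : 'cV[R]_g)).
Proof.
move=> tuA k f h flt hlt.
have [[j hj]|/forallNP old] := pselect (exists j, h j = new_elt n); last first.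
  have /choice[h' h'E] j : exists l, h j = lshift 1 l.
    by have [/old|//] := new_or_old (h j).
  have -> : mxsub f h (row_mx A (delta_mx i0 0 : 'cV[R]_g)) = mxsub f h' A.
    by apply/matrixP => a b; rewrite [LHS]mxE h'E row_mxEl [RHS]mxE.
  apply: tuA => // a b /hlt; by rewrite !h'E.
case: k f h flt hlt j hj => [|k] f h flt hlt j hj; first by case: j {hj}.
have hmax : h ord_max = new_elt n.
  have [<-//|jm] := eqVneq j ord_max.
  have /hlt : (j < (ord_max : 'I_k.+1))%N.
    by rewrite ltn_neqAle (inj_eq val_inj) jm /= -ltnS ltn_ord.
  rewrite hj /= addn0 => lt_n; have := ltn_ord (h ord_max).
  by move: lt_n; move: (nat_of_ord (h ord_max)) => x; lia.
have /choice[h' h'E] b : exists l, h (lift ord_max b) = lshift 1 l.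
  have [e|//] := new_or_old (h (lift ord_max b)).
  have /hlt : (lift ord_max b < (ord_max : 'I_k.+1))%N by rewrite lift_max.
  by rewrite e hmax ltnn.
have h'lt : {homo h' : a b / (a < b)%N}.
  move=> a b ab; have /hlt : (lift ord_max a < lift ord_max b)%N by rewrite !lift_max.
  by rewrite !h'E.
have f_inj : injective f.
  move=> a b e; apply/val_inj; case: (ltngtP a b) => // /flt; by rewrite e ltnn.
rewrite (expand_det_col _ ord_max).
have XE a : mxsub f h (row_mx A (delta_mx i0 0 : 'cV[R]_g)) a ord_max = (f a == i0)%:R.
  by rewrite mxE hmax row_mxEr mxE eqxx andbT.
have cofE a : cofactor (mxsub f h (row_mx A (delta_mx i0 0 : 'cV[R]_g))) a ord_max =
    (-1) ^+ (a + k) * \det (mxsub (fun b => f (lift a b)) h' A).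
  rewrite /cofactor; congr (_ * \det _); apply/matrixP => b c.
  by do 3 rewrite [LHS]mxE; rewrite h'E row_mxEl [RHS]mxE.
have [[a fa]|/forallNP fN] := pselect (exists a, f a = i0); last first.
  rewrite big1; first by constructor 2.
  by move=> a _; rewrite XE; have /eqP/negbTE -> := fN a; rewrite mul0r.
rewrite (bigD1 a) //= big1 => [|b ba]; last first.
  by rewrite XE -fa (inj_eq f_inj) (negbTE ba) mul0r.
rewrite addr0 XE fa eqxx mul1r cofE -signr_odd.
have := tuA k (fun b => f (lift a b)) h' _ h'lt.
move=> /(_ _)[].
- move=> b c bc; apply: flt; rewrite /= /bump.
  by case: (leqP a b) => [ab|ab]; case: (leqP a c) => ac /=; lia.
- by move=> ->; case: odd; rewrite ?expr1 ?expr0 ?mulrNN ?mulr1 ?mul1r; [constructor 3|constructor 1].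
- by move=> ->; rewrite mulr0; constructor 2.
- by move=> ->; case: odd; rewrite ?expr1 ?expr0 ?mulr1; [constructor 1|constructor 3].
Qed.

End TotallyUnimodular.

(** * Covering the coloop locus by charts *)

Section Completion.
Variables (R : realType) (g : nat).
Hypothesis g0 : (0 < g)%N.

Record matroid_data n (M : matroid 'I_n) (Z : 'M[int]_(g, n)) : Prop := MatroidData {
  data_simple : simple_matroid M;
  data_regular : regular M;
  data_rank : (matroid_rank M <= g)%N;
  data_tu : totally_unimodular (real_of_int R Z);
  data_represents : represents (real_of_int R Z) M }.

Lemma data_kernel n (M : matroid 'I_n) (Z : 'M[int]_(g, n)) (x : 'cV[R]_n) :
  matroid_data M Z -> (#|[set j | x j 0%R != 0%R]%SET| <= 2)%N ->
  real_of_int R Z *m x = 0 -> x = 0.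
Proof.
move=> dZ x2; apply: (_ : kernel_free _ [set j | x j 0 != 0]%SET).
  apply/(proj1 (represents_kernel _ _) (data_represents dZ)).
  exact: (proj1 (simple_small M) (data_simple dZ)).
by move=> j; rewrite inE negbK => /eqP.
Qed.

(** Simplicity makes sets of at most two columns independent, which excludes zero columns and
    columns equal up to sign. *)
Lemma data_system n (M : matroid 'I_n) (Z : 'M[int]_(g, n)) :
  matroid_data M Z -> spans R Z (full n) -> unimodular_system R Z.
Proof.
move=> dZ sp; have pair k l (c : int) : col k Z + c *: col l Z = 0 -> k != l -> False.
  move=> e kl; pose x : 'cV[R]_n := delta_mx k 0 + c%:~R *: delta_mx l 0.
  have /colP/(_ k) : x = 0.
    apply: (data_kernel dZ).
      apply: leq_trans (_ : #|[set k; l]%SET| <= 2)%N; last by rewrite cards2; case: (_ != _).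
      apply: subset_leq_card; apply/fintype.subsetP => j; rewrite !inE !mxE eqxx !andbT.
      by case: (j == k); case: (j == l) => //=; rewrite mulr0 addr0 eqxx.
    rewrite /x mulmxDr -scalemxAr -!colE /real_of_int -!map_col -map_mxZ -map_mxD e map_mx0 //.
  by rewrite !mxE !eqxx (negbTE kl) mulr0 addr0 => /eqP; rewrite oner_eq0.
have Z0 k : col k Z != 0.
  apply/eqP => e; pose x : 'cV[R]_n := delta_mx k 0.
  have /colP/(_ k) : x = 0.
    apply: (data_kernel dZ).
      apply: leq_trans (_ : #|[set k]%SET| <= 2)%N; last by rewrite cards1.
      apply: subset_leq_card; apply/fintype.subsetP => j; rewrite !inE !mxE eqxx !andbT.
      by case: (j == k) => //=; rewrite eqxx.
    by rewrite /x -colE /real_of_int -map_col e map_mx0.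
  by rewrite !mxE !eqxx => /eqP; rewrite oner_eq0.
split => //; first exact: tu_unimod (data_tu dZ).
  exact: tu_primitive (data_tu dZ) Z0.
move=> k l kl; split=> e.
  by apply: (pair k l (-1)) => //; rewrite scaleN1r e subrr.
by apply: (pair k l 1) => //; rewrite scale1r e addNr.
Qed.

(** A functional [z] killing all columns has a nonzero entry [i]. The new column is the unit vector
    at [i]: it preserves total unimodularity, and [z] separates it from the old columns. *)
Lemma data_step n (M : matroid 'I_n) (Z : 'M[int]_(g, n)) :
  matroid_data M Z -> ~ spans R Z (full n) ->
  exists (Z1 : 'M[int]_(g, n + 1)) (z : 'rV[R]_g),
    [/\ matroid_data (coloop_ext M) Z1, forall j, col (lshift 1 j) Z1 = col j Z,
        forall j, dot z (col j Z) = 0 & dot z (col (new_elt n) Z1) != 0].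
Proof.
move=> dZ /existsNP[z /not_implyP[zZ z0]].
have [i zi] : exists i, z 0 i != 0.
  apply: contrapT => /forallNP h; apply: z0; apply/rowP => i; rewrite [RHS]mxE.
  by apply/eqP/negPn/negP/h.
have {}zZ j : dot z (col j Z) = 0 by apply: zZ; rewrite finset.in_setT.
pose Z1 : 'M[int]_(g, n + 1) := row_mx Z (delta_mx i 0).
have Z1E : real_of_int R Z1 = row_mx (real_of_int R Z) (delta_mx i 0).
  by rewrite /real_of_int map_row_mx map_delta_mx.
have rep : represents (real_of_int R Z1) (coloop_ext M).
  apply: coloop_ext_represents (data_represents dZ) => x.
  have xE : real_of_int R Z1 *m x =
      real_of_int R Z *m usubmx x + x (new_elt n) 0 *: delta_mx i 0.
    rewrite Z1E -{1}[x]vsubmxK mul_row_col; congr (_ + _); apply/colP => k.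
    by rewrite !mxE big_ord1 !mxE ord1 mulrC.
  rewrite xE; split=> [e|[-> ->]]; last by rewrite scale0r addr0.
  have x0 : x (new_elt n) 0 = 0.
    have := congr1 (mulmx z) e; rewrite mulmxDr mulmx0 mulmxA -scalemxAr.
    have -> : z *m real_of_int R Z = 0.
      by apply/rowP => j; rewrite -dot_col zZ mxE.
    rewrite mul0mx add0r -colE => /colP/(_ 0)/eqP.
    by rewrite !mxE mulf_eq0 (negbTE zi) orbF => /eqP.
  by move: e; rewrite x0 scale0r addr0.
exists Z1, z; split.
- split.
  + exact: coloop_ext_simple (data_simple dZ).
  + exact: coloop_ext_regular (data_regular dZ).
  + apply/bigmax_leqP => S /(proj1 (represents_kernel _ _) rep); exact: card_kernel_free.
  + by rewrite Z1E; apply: tu_unit_ext; exact: data_tu dZ.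
  + exact: rep.
- move=> j; apply/colP => k; by rewrite mxE row_mxEl [RHS]mxE.
- exact: zZ.
- have -> : col (new_elt n) Z1 = delta_mx i 0.
    by apply/colP => k; rewrite mxE row_mxEr.
  by rewrite /dot /real_of_int map_delta_mx -colE mxE.
Qed.

(** Induction on the corank. [Q] accumulates the squares of the separating functionals: it vanishes
    exactly on the old columns and so exposes the old cone as a face of the completed one. *)
Lemma data_complete n (M : matroid 'I_n) (Z : 'M[int]_(g, n)) :
  matroid_data M Z -> (spans R Z (full n) -> exists e, coloop M e) ->
  exists n' (M' : matroid 'I_n') (Z' : 'M[int]_(g, n')) (iota : 'I_n -> 'I_n') (Q : 'M[R]_g),
   [/\ matroid_data M' Z', spans R Z' (full n'), exists e, coloop M' e &
    [/\ forall v, 0 <= qform Q v, forall j, col (iota j) Z' = col j Z,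
        forall j, qform Q (real_of_int R (col j Z')) = 0 -> exists i, iota i = j
      & forall j, qform Q (real_of_int R (col j Z)) = 0]].
Proof.
have [c] := ubnP (g - matroid_rank M); elim: c n M Z => // c IH n M Z.
rewrite ltnS => le_c dZ col0.
have [sp|nsp] := pselect (spans R Z (full n)).
  exists n, M, Z, id, 0; split=> //; first exact: col0.
  by split=> [v|//|j _|j]; rewrite ?qform0 //; exists j.
have [Z1 [z [dZ1 colZ1 zZ znew]]] := data_step dZ nsp.
have [||n' [M' [Z' [iota [Q [dZ' sp' co' [Q0 iE iQ QZ1]]]]]]] := IH _ _ _ _ dZ1.
- have := coloop_ext_rank M; have := data_rank dZ1.
  by move: (matroid_rank _) (matroid_rank _) le_c => a b; lia.
- by move=> _; exists (new_elt n); exact: coloop_ext_coloop.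
exists n', M', Z', (fun j => iota (lshift 1 j)), (Q + z^T *m z); split=> //.
have QE v : qform (Q + z^T *m z) v = qform Q v + ((z *m v) 0 0) ^+ 2.
  by rewrite qformD qform_sqr.
split=> [v|j|j|j].
- by rewrite QE addr_ge0 ?Q0 ?sqr_ge0.
- by rewrite iE colZ1.
- rewrite QE => /eqP; rewrite paddr_eq0 ?Q0 ?sqr_ge0 // => /andP[/eqP/iQ[i ij]].
  rewrite -ij iE sqrf_eq0 -/(dot _ _) => zi; have [e|[k ->]] := new_or_old i.
    by move: zi; rewrite e (negbTE znew).
  by exists k.
- by rewrite QE -colZ1 QZ1 colZ1 -/(dot _ _) zZ expr0n addr0.
Qed.

Lemma matroid_cone_cone n (Z : 'M[int]_(g, n)) (h : 'M[int]_g) :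
  act h @` matroid_cone (real_of_int R Z) = cone (R := R) (h *m Z) (full n).
Proof.
have -> : matroid_cone (real_of_int R Z) = cone (R := R) Z (full n).
  rewrite coneE /matroid_cone; congr nonneg_span; apply/seteqP; split=> X.
    move=> [j _ <-]; exists j; first by rewrite /= finset.in_setT.
    by rewrite /sq /real_of_int map_col.
  by move=> [j _ <-]; exists j => //; rewrite /sq /real_of_int map_col.
apply/seteqP; split=> X.
  move=> [Y /coneT[a a0 ->] <-]; apply/coneT; exists a => //.
  by rewrite act_sum; apply: eq_bigr => k _; rewrite actZ act_sq col_mulmx.
move=> /coneT[a a0 ->]; exists (wform Z a); first by apply/coneT; exists a.
by rewrite act_sum; apply: eq_bigr => k _; rewrite actZ act_sq col_mulmx.
Qed.

Lemma cone_rank_full m (A : 'M[int]_(g, m)) : spans R A (full m) ->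
  cone_rank (cone (R := R) A (full m)) = g.
Proof.
move=> sp; apply/eqP; rewrite eqn_leq; apply/andP; split.
  by apply/bigmax_leqP => k _; rewrite -ltnS.
have P : `[< exists2 X, cone (R := R) A (full m) X & \rank X = (ord_max : 'I_g.+1) >].
  apply/asboolP; exists (wform A (fun=> 1)); first by apply/coneT; exists (fun=> 1).
  apply/eqP; rewrite -[_ == _]/(row_free _) -kermx_eq0.
  apply/eqP/row_matrixP => i; rewrite row0; set z := row i _.
  have zX : z *m wform A (fun=> 1) = 0 by rewrite /z -row_mul mulmx_ker row0.
  apply: sp => k _.
  have : trform (z^T *m z) (wform A (fun=> 1)) = 0.
    by rewrite /trform /= -mulmxA zX mulmx0 mxtrace0.
  rewrite trform_wsum => /eqP; rewrite psumr_eq0; last first.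
    by move=> j _; rewrite mul1r qform_sqr sqr_ge0.
  move=> /allP/(_ k (mem_index_enum k)).
  by rewrite mul1r qform_sqr sqrf_eq0 => /eqP.
exact: (@leq_bigmax_cond _ (fun k : 'I_g.+1 => `[< exists2 X, cone (R := R) A (full m) X & \rank X = k >])
   (fun k : 'I_g.+1 => nat_of_ord k) ord_max P).
Qed.

Lemma coloop_system_of_data n (M : matroid 'I_n) (Z : 'M[int]_(g, n)) (h : 'M[int]_g) :
  matroid_data M Z -> (spans R Z (full n) -> exists e, coloop M e) -> h \in unitmx ->
  exists m (A : 'M[int]_(g, m)), coloop_system R A /\
    is_face (cone (R := R) (h *m Z) (full n)) (cone A (full m)).
Proof.
move=> dZ col0 uh; have uhR := real_of_int_unit R uh.
have [m [M' [Z' [iota [Q [dZ' sp' [e ce] [Q0 iE iQ QZ]]]]]]] := data_complete dZ col0.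
have sysA := system_act uh (data_system dZ' sp').
exists m, (h *m Z'); split.
  split=> //.
    have [z zE] := coloop_functional (data_represents dZ') ce.
    exists e, (z *m invmx (real_of_int R h)).
    have dE j : dot (z *m invmx (real_of_int R h)) (col j (h *m Z')) = (j == e)%:R.
      by rewrite col_mulmx dot_mul mulmxKV // dot_col zE.
    by split=> [|j je]; rewrite dE ?eqxx ?oner_eq0 // (negbTE je).
  exists m, M'; split; last first.
    by right; split; [exact: cone_rank_full (sys_spans sysA)|exists e].
  split; [exact: data_simple dZ'|exact: data_regular dZ'|exact: data_rank dZ'|].
  exists (real_of_int R Z'), h; split=> //; first exact: data_tu dZ'.
    exact: data_represents dZ'.
  by rewrite matroid_cone_cone.
(* The exposing form [Q], transported along [h]. *)
pose P := (invmx (real_of_int R h))^T *m Q *m invmx (real_of_int R h).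
have PE v : qform P (real_of_int R (h *m v)) = qform Q (real_of_int R v).
  have qT (T : 'M[R]_g) w : qform (T^T *m Q *m T) w = qform Q (T *m w).
    by rewrite /qform trmx_mul !mulmxA.
  by rewrite /P qT /real_of_int map_mxM -/(real_of_int R h) mulKmx.
pose S := [set j | qform Q (real_of_int R (col j Z')) == 0]%SET.
have -> : cone (R := R) (h *m Z) (full n) = cone (h *m Z') S.
  have cE j : col (iota j) (h *m Z') = col j (h *m Z) by rewrite !col_mulmx iE.
  have iS j : iota j \in S by rewrite inE iE QZ.
  apply/seteqP; split=> X [a a0 ->]; apply: cone_sum => j jS; apply: coneZ => //.
    by rewrite -cE; exact: cone_sq.
  move: jS; rewrite inE => /eqP/iQ[i <-]; rewrite cE.
  by apply: cone_sq; rewrite finset.in_setT.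
apply: (@cone_face_of_form _ _ _ _ _ _ P); first exact: finset.subsetT.
  by move=> j; rewrite inE col_mulmx PE => /eqP.
by move=> j _; rewrite inE col_mulmx PE lt_def Q0 andbT.
Qed.

Lemma charts_cover (xi0 : LAtrop R g) xi : coloop_subcomplex R g xi ->
  exists m (A : 'M[int]_(g, m)) (a : 'rV[R]_m),
    [/\ coloop_system R A, admissible a & xi = chart xi0 A a].
Proof.
move=> [[s Ds] /= [cs _] [p _ <-]].
have [[y ys] pE] := gen_class_surj (p : cone_link s); rewrite {p}pE.
have [sy y0] := set_mem ys; have Ds' := set_mem Ds.
have v : valid s y by [].
have ptE' : @link_map R g (exist _ s Ds) (ray (exist _ y ys)) = link_point xi0 s y.
  rewrite (link_pointE xi0 v) /links_point; case: v => ? ? ?; rewrite /link_map /set_type_elt.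
  by rewrite (bool_irrelevance (mem_set _) Ds) (bool_irrelevance (mem_set (conj _ _)) ys).
suff [m [A [a [gA aa e]]]] : exists m (A : 'M[int]_(g, m)) (a : 'rV[R]_m),
    [/\ coloop_system R A, admissible a & link_point xi0 s y = chart xi0 A a].
  by exists m, A, a; split=> //; exact: (etrans ptE' e).
have {}cs : coloop_cone s := cs.
have [n [M [[sM rM kM [A [h [tuA repA uh sE]]]] rk]]] := cs.
have [Z ZE] := tu_integral tuA; rewrite ZE in tuA repA sE.
rewrite matroid_cone_cone in sE.
have dZ : matroid_data M Z by split.
(* If the columns span, the cone has rank [g], so membership in the coloop locus must come from a
   coloop. *)
have col0 : spans R Z (full n) -> exists e, coloop M e.
  move=> sp; have sph : spans R (h *m Z) (full n).
    exact: sys_spans (system_act uh (data_system dZ sp)).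
  by case: rk => [|[]//]; rewrite sE cone_rank_full // ltnn.
have [m [B [gB fB]]] := coloop_system_of_data dZ col0 uh.
have gy : cone B (full m) y by have [l [_ lE]] := fB; move: sy; rewrite sE lE => -[].
have -> : link_point xi0 s y = link_point xi0 (cone B (full m)) y.
  rewrite -[y in RHS]act1; apply: link_point_arrow => //; last 2 first.
  - exact: unitmx1.
  - have -> : act 1%:M @` s = s.
      by apply/seteqP; split=> w; [move=> [w' ? <-]|exists w => //]; rewrite act1.
    by rewrite sE.
  by have [] := coloop_system_valid g0 gB gy y0.
have /coneT[a a0 ya] := gy; exists m, B, (\row_k a k).
have wE : weights (\row_k a k) = a by apply/funext => k; rewrite /weights mxE.
split=> //; last by rewrite /chart wE ya.
split; first by rewrite wE.
rewrite wE; apply: contrapT => /forallNP h0; apply: y0; rewrite ya /wform big1 // => k _.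
by have /negP := h0 k; rewrite negbK => /eqP ->; rewrite scale0r.
Qed.

Lemma empty_matroid_aug (I J : {set 'I_0}) : true -> true -> (#|I| < #|J|)%N ->
  exists2 e, e \in (J :\: I)%SET & true.
Proof.
by move=> _ _; rewrite ltnNge (leq_trans (max_card _)) // card_ord.
Qed.

Definition empty_matroid : matroid 'I_0 :=
  @Matroid _ (fun=> true) isT (fun _ _ _ _ => isT) empty_matroid_aug.

(** Completing the empty system adds at least one coloop, because no columns span nothing when
    [g > 0]. *)
Lemma coloop_system_exists : exists m (A : 'M[int]_(g, m)), coloop_system R A.
Proof.
have rep (F : fieldType) d (A : 'M[F]_(d, 0)) : represents A empty_matroid.
  apply/represents_kernel => S; split=> // _ x _ _; apply/colP => -[] //.
have [||m [A [gA _]]] := @coloop_system_of_data 0 empty_matroid 0 1%:M _ _ (unitmx1 _ _).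
- split.
  + by apply/simple_small.
  + by move=> F; exists 0%N, 0; exact: rep.
  + by apply/bigmax_leqP => S _; rewrite (leq_trans (max_card _)) // card_ord.
  + move=> k f h _ _; case: k f h => [|k] f h; last by case: (h ord0).
    by rewrite det_mx00; constructor 3.
  + exact: rep.
- move=> sp; have /rowP/(_ (Ordinal g0))/eqP : (const_mx 1 : 'rV[R]_g) = 0.
    by apply: sp => -[].
  by rewrite !mxE oner_eq0.
by exists m, A.
Qed.

End Completion.

Theorem theorem1p3 (R : realType) (g : nat) (hg : (1 <= g)%N) :
  contractible R (set_type (coloop_subcomplex R g)).
Proof.
have [m [A gA]] := coloop_system_exists R hg.
(* Some point of the link is needed as the default value of [link_point]. *)
have [xi0 _] : exists xi : LAtrop R g, True.
  have Ds : perfect_decomposition (cone (R := R) A (full m)).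
    apply: (cone_perfect (coloop_system_unimodular gA)) => //.
    exact: (sys_spans (coloop_system_unimodular gA)).
  have [k _] := spans_nonempty hg (sys_spans (coloop_system_unimodular gA)).
  have cs : cone (R := R) A (full m) (sq R (col k A)).
    by apply: cone_sq; rewrite finset.in_setT.
  have s0 : sq R (col k A) <> 0.
    have [y yk] := sys_primitive (coloop_system_unimodular gA) k; move=> s0.
    have : trform ((real_of_int R y)^T *m real_of_int R y) (sq R (col k A)) = 1.
      by rewrite trform_sq qform_sqr -/(dot _ _) dot_int yk expr1n.
    by rewrite s0 linear0 => /eqP; rewrite eq_sym oner_eq0.
  by exists (gen_class (@link_arrow R g) (links_point (And3 Ds cs s0))).
apply: (contractible_of_charts (xi0 := xi0)) => //; last by exists m, A.
exact: charts_cover.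
Qed.
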